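(* For every real $s<0$, the Cauchy problem for the one-dimensional cubic defocusing nonlinear Schr\''odinger equation $$-iu_t+u_{xx}=|u|^2u,\qquad u(0,x)=u_0(x),\qquad x\in\mathbb R,$$ with $u$ complex-valued, is not locally well-posed in $H^s(\mathbb R)$.
   Context: For every initial datum $u_0$ in the Schwartz class $\mathcal S(\mathbb R)$ there is a unique global smooth solution $u\in C^\infty_t(\mathbb R;\mathcal S(\mathbb R))$; this defines the solution map $S:\mathcal S(\mathbb R)\to C^\infty_t(\mathbb R;\mathcal S(\mathbb R))$, $Su_0:=u$. Definition (local well-posedness). The equation is locally well-posed in $H^s(\mathbb R)$ if for every radius $R>0$ there exists a time $T=T(R)>0$ such that the solution map $S$ (restricted to Schwartz data) can be uniformly continuously and uniquely extended to a map from the ball $\{u_0\in H^s(\mathbb R):\|u_0\|_{H^s}<R\}$ (with the $H^s$ norm) to the space $C^0_t((-T,T);H^s(\mathbb R))$, the latter endowed with the topology induced by the norm $\sup_{t\in(-T,T)}\|u(t)\|_{H^s}$. *)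

(* Defs.v *)
From HB Require Import structures.
From mathcomp Require Import all_boot all_order all_algebra complex.
From mathcomp Require Import all_classical all_reals all_analysis.

Set Implicit Arguments.
Unset Strict Implicit.
Unset Printing Implicit Defensive.

Import Order.TTheory GRing.Theory Num.Theory.
Import ComplexField.Normc.
Import numFieldNormedType.Exports.

Local Open Scope classical_set_scope.
Local Open Scope ring_scope.
Local Open Scope complex_scope.

Local Notation Re := (@complex.Re _).
Local Notation Im := (@complex.Im _).

Section ComplexValued.
Context {R : realType}.
Implicit Types f : R -> R[i].

(* R[i] is not a normed module over R in the libraries, so derivatives and
   integrals of complex-valued functions are taken componentwise. *)
Definition rsmooth (f : R -> R) :=
  forall n (x : R), derivable (derive1n n f) x 1.

Definition smooth f := rsmooth (Re \o f) /\ rsmooth (Im \o f).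

Definition cderiven n f (x : R) : R[i] :=
  derive1n n (Re \o f) x +i* derive1n n (Im \o f) x.

Definition cintegral f : R[i] :=
  (\int[lebesgue_measure]_x Re (f x)) +i* (\int[lebesgue_measure]_x Im (f x)).

Definition cmeasurable f :=
  measurable_fun setT (Re \o f) /\ measurable_fun setT (Im \o f).

Definition cis (x : R) : R[i] := cos x +i* sin x.

Definition fourier f (xi : R) : R[i] := cintegral (fun x => cis (- (x * xi)) * f x).

Definition seminorm k n f : \bar R :=
  ereal_sup (range (fun x : R => (`|x| ^+ k * normc (cderiven n f x))%:E)).

End ComplexValued.

Definition schwartz_fun {R : realType} : {pred R -> R[i]^o} :=
  mem [set f : R -> R[i]^o | smooth f /\ forall k n, (seminorm k n f < +oo)%E].

Section SchwartzClosed.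
Context {R : realType}.

Let deriven_lin n (a : R) (f g : R -> R) : rsmooth f -> rsmooth g ->
  derive1n n (fun x => a * f x + g x) =
  (fun x => a * derive1n n f x + derive1n n g x).
Proof.
move=> sf sg; elim: n => [//|n IH].
rewrite !derive1nS IH; apply/funext => x; rewrite !derive1E.
rewrite (@deriveD _ _ _ (a *: derive1n n f)) ?deriveZ//.
exact: derivableZ.
Qed.

Let smooth_lin (a : R) (f g : R -> R) : rsmooth f -> rsmooth g ->
  rsmooth (fun x => a * f x + g x).
Proof.
move=> sf sg n x; rewrite deriven_lin//.
apply: (@derivableD _ _ _ (a *: derive1n n f)) => //.
exact: derivableZ.
Qed.

Let smooth0 : rsmooth (0 : R -> R) /\ forall n, derive1n n (0 : R -> R) = 0.
Proof.
have D0 n : derive1n n (0 : R -> R) = 0.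
  elim: n => [//|n IH]; rewrite derive1nS IH; apply/funext => x.
  by rewrite derive1E (derive_cst (0 : R)).
by split=> // n x; rewrite D0; exact: derivable_cst.
Qed.

Let ReE (a : R[i]) (f g : R -> R[i]^o) : Re \o (a *: f + g) =
  (fun x => Re a * Re (f x) + (- Im a * Im (f x) + Re (g x))).
Proof.
apply/funext => x; rewrite !fctE /=.
by case: a (f x) (g x) => [a b] [c d] [e h] /=; rewrite addrA mulNr.
Qed.

Let ImE (a : R[i]) (f g : R -> R[i]^o) : Im \o (a *: f + g) =
  (fun x => Re a * Im (f x) + (Im a * Re (f x) + Im (g x))).
Proof.
apply/funext => x; rewrite !fctE /=.
by case: a (f x) (g x) => [a b] [c d] [e h] /=; rewrite addrA.
Qed.

Let cderiven_lin n (a : R[i]) (f g : R -> R[i]^o) (x : R) :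
  smooth f -> smooth g ->
  cderiven n (a *: f + g) x = a * cderiven n f x + cderiven n g x.
Proof.
move=> [f1 f2] [g1 g2]; rewrite /cderiven ReE ImE.
rewrite (@deriven_lin n _ _ _ f1 (@smooth_lin _ _ _ f2 g1)).
rewrite (@deriven_lin n _ _ _ f2 (@smooth_lin _ _ _ f1 g2)).
rewrite (@deriven_lin n _ _ _ f2 g1) (@deriven_lin n _ _ _ f1 g2).
by case: a => a b; rewrite !addrA mulNr.
Qed.

Let smooth_clin (a : R[i]) (f g : R -> R[i]^o) :
  smooth f -> smooth g -> smooth (a *: f + g).
Proof.
move=> [f1 f2] [g1 g2]; rewrite /smooth ReE ImE; split.
  exact: (@smooth_lin _ _ _ f1 (@smooth_lin _ _ _ f2 g1)).
exact: (@smooth_lin _ _ _ f2 (@smooth_lin _ _ _ f1 g2)).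
Qed.

Let normc_ge0 (a : R[i]) : 0 <= normc a.
Proof. by case: a => a b; exact: sqrtr_ge0. Qed.

Let seminorm_clin k n (a : R[i]) (f g : R -> R[i]^o) :
  smooth f -> smooth g ->
  (seminorm k n (a *: f + g)%R <=
   (normc a)%:E * seminorm k n f + seminorm k n g)%E.
Proof.
move=> sf sg; apply: ge_ereal_sup => _ [x _ <-]; rewrite cderiven_lin//.
apply: (@le_trans _ _ (normc a * (`|x| ^+ k * normc (cderiven n f x)) +
                       `|x| ^+ k * normc (cderiven n g x))%:E).
  rewrite lee_fin mulrCA -mulrDr ler_wpM2l ?exprn_ge0// -normcM.
  exact: le_normcD.
rewrite EFinD EFinM leeD//; last by apply: ereal_sup_ubound; exists x.
rewrite lee_wpmul2l//; first by rewrite lee_fin normc_ge0.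
by apply: ereal_sup_ubound; exists x.
Qed.

Lemma schwartz_submod_closed : submod_closed (@schwartz_fun R).
Proof.
split=> [|a f g].
  rewrite inE; have [s0 d0] := smooth0.
  have R0 : Re \o (0 : R -> R[i]^o) = 0 by apply/funext.
  have I0 : Im \o (0 : R -> R[i]^o) = 0 by apply/funext.
  split=> [|k n]; first by rewrite /smooth R0 I0.
  apply: (@le_lt_trans _ _ 0%E); last by rewrite ltry.
  apply: ge_ereal_sup => _ [x _ <-].
  by rewrite /cderiven R0 I0 d0 [X in normc X](_ : _ = 0)// normc0 mulr0.
rewrite !inE => -[sf nf] [sg ng]; split; first exact: smooth_clin.
move=> k n; apply: le_lt_trans (seminorm_clin k n a sf sg) _.
rewrite lte_add_pinfty//.
by rewrite lte_mul_pinfty ?lee_fin ?normc_ge0.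
Qed.

End SchwartzClosed.

HB.instance Definition _ (R : realType) :=
  GRing.isSubmodClosed.Build _ _ (@schwartz_fun R) schwartz_submod_closed.

Record schwartz (R : realType) := Schwartz {
  schwartz_val :> R -> R[i]^o ;
  _ : schwartz_val \in schwartz_fun }.

HB.instance Definition _ (R : realType) := [isSub for @schwartz_val R].
HB.instance Definition _ (R : realType) := [Choice of schwartz R by <:].
HB.instance Definition _ (R : realType) :=
  [SubChoice_isSubLmodule of schwartz R by <:].

Section Sobolev.
Context {R : realType}.
Implicit Types (T : schwartz R -> R[i]) (s t r tau : R).

Definition tempered T :=
  (forall a phi psi, T (a *: phi + psi) = a * T phi + T psi) /\
  exists (C : R) (N : nat), forall phi,
    ((normc (T phi))%:E <=
     C%:E * \sum_(k < N) \sum_(n < N) seminorm k n phi)%E.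

Definition distr (u : schwartz R) : schwartz R -> R[i] :=
  fun phi => cintegral (fun x => u x * phi x).

(* g represents the Fourier transform of T, itself defined by duality.  The
   transform of a Schwartz function is again one; psi is that transform, bundled
   as an element of schwartz R. *)
Definition fourier_distr T (g : R -> R[i]) :=
  cmeasurable g /\
  forall phi psi : schwartz R, (psi : R -> R[i]) = fourier phi ->
    T psi = cintegral (fun xi => g xi * phi xi).

(* At most one g up to a.e. equality has a finite weighted norm below, so the
   infimum only serves to give the value +oo to distributions outside H^s. *)
Definition sobolev_norm s T : \bar R :=
  ereal_inf [set Lnorm lebesgue_measure 2%:E
                    (fun xi => ((1 + xi ^+ 2) `^ (s / 2) * normc (g xi))%:E)
            | g in fourier_distr T].

Definition sobolev s T := tempered T /\ (sobolev_norm s T < +oo)%E.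

Definition sobolev_ball s r :=
  [set T | sobolev s T /\ (sobolev_norm s T < r%:E)%E].

(* C^0((-tau, tau); H^s); values of F outside (-tau, tau) are irrelevant. *)
Definition continuous_path s tau (F : R -> schwartz R -> R[i]) :=
  forall t, `|t| < tau ->
    sobolev s (F t) /\ sobolev_norm s (F t' - F t) @[t' --> t] --> 0%E.

Definition path_norm s tau (F : R -> schwartz R -> R[i]) : \bar R :=
  ereal_sup [set sobolev_norm s (F t) | t in `]- tau, tau[].

End Sobolev.

Section NLS.
Context {R : realType}.
Implicit Types (u : R -> schwartz R) (s t r tau : R).
Implicit Types S : schwartz R -> R -> schwartz R.
Implicit Types Phi : (schwartz R -> R[i]) -> R -> schwartz R -> R[i].

(* v is the derivative of u at t for the Frechet topology of schwartz R *)
Definition is_schwartz_derive u t (v : schwartz R) := forall k n,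
  seminorm k n (h^-1%:C *: (u (t + h) - u t) - v) @[h --> 0^'] --> 0%E.

(* C^\infty(R; schwartz R); D j is the j-th time derivative of u *)
Definition smooth_in_time u :=
  exists2 D : nat -> R -> schwartz R, D 0%N = u &
    forall j t, is_schwartz_derive (D j) t (D j.+1 t).

Definition nls_solution (u0 : schwartz R) u :=
  [/\ smooth_in_time u, u 0 = u0 &
      forall t x, - 'i%C * cderiven 1 (fun t' => u t' x) t + cderiven 2 (u t) x
                  = (normc (u t x) ^+ 2)%:C * u t x].

Definition is_solution_map S :=
  forall u0 : schwartz R,
    nls_solution u0 (S u0) /\ forall u, nls_solution u0 u -> u = S u0.

Definition uniformly_continuous_on_ball s r tau Phi :=
  forall eps : R, 0 < eps -> exists2 delta : R, 0 < delta &
    forall f g, sobolev_ball s r f -> sobolev_ball s r g ->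
      (sobolev_norm s (f - g)%R < delta%:E)%E ->
      (path_norm s tau (fun t => Phi f t - Phi g t)%R < eps%:E)%E.

Definition is_extension S s r tau Phi :=
  [/\ forall f, sobolev_ball s r f -> continuous_path s tau (Phi f),
      uniformly_continuous_on_ball s r tau Phi &
      forall u0 : schwartz R, sobolev_ball s r (distr u0) ->
        forall t, `|t| < tau -> Phi (distr u0) t = distr (S u0 t)].

Definition locally_well_posed S s :=
  forall r, 0 < r -> exists2 tau, 0 < tau &
    exists Phi, is_extension S s r tau Phi /\
      forall Psi, is_extension S s r tau Psi ->
        forall f, sobolev_ball s r f -> forall t, `|t| < tau -> Psi f t = Phi f t.

End NLS.

(* Main.v *)
(* Fix a time T below the existence time, and a < b with T (b^2 - a^2) = pi.
   The data a h and b h, with h(x) = w(x / L) e^{iNx}, w(y) = exp(- y^(2k)) and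
   L large, are close in H^s once N is chosen with N^(2s) L ~ 1 / a^2, but they
   are multiplied by phases e^{iTa^2} = - e^{iTb^2} at time T.

   No existence or continuity theory is used.  In the frame moving with velocity
   -2N, the rescaled energy \int 2 |u_x - iNu|^2 + (|u|^2 - beta)^2 + c |u|^2,
   beta = a^2 w(./L)^2 and c ~ L^-2, satisfies Z' <= Z and is O(1 / L) at time 0,
   so |u|^2 stays close to beta.  Hence the pairing of u with
   G(./L) exp(- i(Nx + N^2 t + T a^2 + beta (t - T))), G a Gaussian, moves by O(1)
   only; at time 0 it has size a L, as the phase T a^2 (1 - w^2) is small on the
   support of G when k is large.  At time T the beta term vanishes and the test
   function is the Fourier transform of a modulated Gaussian, so Hoelder's inequality
   on the Fourier side turns the pairings with the two solutions, opposite in sign,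
   into a lower bound for their H^s distance.

   All integrals are dominated by the Lorentzian lor, whose primitive is atan. *)

Require Import Defs.
From HB Require Import structures.
From mathcomp Require Import all_boot all_order all_algebra complex.
From mathcomp Require Import all_classical all_reals all_analysis measurable_realfun.
From mathcomp Require Import ring lra.

Set Implicit Arguments.
Unset Strict Implicit.
Unset Printing Implicit Defensive.

Import Order.TTheory GRing.Theory Num.Theory.
Import ComplexField.Normc.
Import numFieldNormedType.Exports.

Local Open Scope classical_set_scope.
Local Open Scope ring_scope.
Local Open Scope complex_scope.

(** * Integration on the line *)

Section LineIntegral.
Context {R : realType}.
Implicit Types (f g F : R -> R) (l : R).
Local Notation mu := (@lebesgue_measure R).

Lemma contD f g : continuous f -> continuous g -> continuous (fun x => f x + g x).
Proof. by move=> cf cg x; exact: (cvgD (cf x) (cg x)). Qed.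

Lemma contB f g : continuous f -> continuous g -> continuous (fun x => f x - g x).
Proof. by move=> cf cg x; exact: (cvgB (cf x) (cg x)). Qed.

Lemma contM f g : continuous f -> continuous g -> continuous (fun x => f x * g x).
Proof. by move=> cf cg x; exact: (cvgM (cf x) (cg x)). Qed.

Lemma contC (c : R) : continuous (fun _ : R => c).
Proof. by move=> x; exact: cvg_cst. Qed.

Arguments contC : clear implicits.

Lemma contid : continuous (fun x : R => x).
Proof. by move=> x; exact: cvg_id. Qed.

Lemma contX f n : continuous f -> continuous (fun x => f x ^+ n).
Proof.
move=> cf; elim: n => [|n ih]; first exact: (contC 1).
by under eq_fun do rewrite exprS; exact: contM.
Qed.

Lemma contcomp f g : continuous f -> continuous g -> continuous (fun x => f (g x)).
Proof. by move=> cf cg x; exact: continuous_comp (cg x) (cf (g x)). Qed.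

Section Rules.
Variables (x : R) (f g : R -> R) (a b : R).
Local Notation D h c := (is_derive (x : R) (1 : R) (h : R -> R) (c : R)).

Lemma Deq : D f a -> a = b -> D f b. Proof. by move=> ? <-. Qed.

Lemma Dcst c : D (fun=> c) 0. Proof. exact: is_derive_cst. Qed.

Lemma Did : D (fun y => y) 1. Proof. exact: is_derive_id. Qed.

Lemma Dadd : D f a -> D g b -> D (fun y => f y + g y) (a + b).
Proof. by move=> fa gb; exact: is_deriveD. Qed.

Lemma Dsub : D f a -> D g b -> D (fun y => f y - g y) (a - b).
Proof. by move=> fa gb; exact: is_deriveB. Qed.

Lemma Dopp : D f a -> D (fun y => - f y) (- a).
Proof. by move=> fa; exact: is_deriveN. Qed.

Lemma Dmul : D f a -> D g b -> D (fun y => f y * g y) (a * g x + f x * b).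
Proof.
move=> fa gb; have H := is_deriveM fa gb.
by apply: (is_derive_eq H); rewrite addrC mulrC.
Qed.

Lemma Dexp n : D f a -> D (fun y => f y ^+ n) (n%:R * f x ^+ n.-1 * a).
Proof.
move=> fa; have H := is_deriveX n fa.
rewrite (_ : (fun y => f y ^+ n) = f ^+ n)//.
by apply/funext => y; rewrite fctE.
Qed.

Lemma Dcomp : D g b -> is_derive (g x) (1 : R) f a -> D (fun y => f (g y)) (b * a).
Proof. by move=> gb fa; have := is_derive1_comp fa gb; rewrite mulrC. Qed.

End Rules.

Definition derf (F f : R -> R) := forall x : R, is_derive x (1 : R) F (f x).

Lemma continuous_mfun f : continuous f -> measurable_fun [set: R] f.
Proof. by move=> cf; apply: continuous_measurable_fun. Qed.

Lemma is_derive_continuous f g : derf f g -> continuous f.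
Proof.
move=> df x; apply: differentiable_continuous.
by apply/derivable1_diffP; have [] := df x.
Qed.

Let ge0_FTC_half f F l : continuous f -> (forall x, 0 <= f x) ->
  derf F f -> F x @[x --> +oo%R] --> l ->
  (\int[mu]_(x in `[0%R, +oo[) (f x)%:E = l%:E - (F 0%R)%:E)%E.
Proof.
move=> cf f0 dF Fl.
have cF := is_derive_continuous dF.
apply: ge0_continuous_FTC2y => //.
- exact: continuous_subspaceT.
- by move=> x _; case: (dF x).
- exact: cvg_at_right_filter (cF 0).
- by move=> x _; have [_ <-] := dF x; rewrite derive1E.
Qed.

Lemma ge0_FTC_line f F l l' : continuous f -> (forall x, 0 <= f x) ->
  derf F f ->
  F x @[x --> +oo%R] --> l -> F x @[x --> -oo%R] --> l' ->
  (\int[mu]_x (f x)%:E = (l - l')%R%:E)%E.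
Proof.
move=> cf f0 dF Fl Fl'.
have mf : measurable_fun [set: R] f by exact: continuous_measurable_fun.
rewrite -(setUv `[0%R, +oo[%classic) ge0_integral_setU//=; last 4 first.
- exact: measurableC.
- by apply/measurable_EFinP; rewrite setUv.
- by move=> x _; rewrite lee_fin.
- exact/disj_setPCl.
rewrite (@ge0_FTC_half f F l)// setCitvr.
rewrite integral_itv_bndo_bndc; last exact/measurable_EFinP/measurable_funTS.
have -> : `]-oo, 0%R]%classic = `]-oo, (- 0)%R]%classic :> set R by rewrite oppr0.
rewrite ge0_integration_by_substitutionNy//; last first.
  exact: continuous_subspaceT.
rewrite (@ge0_FTC_half (f \o -%R) (fun x => - F (- x)) (- l'))//.
- by rewrite oppr0 -!EFinB -EFinD; congr (_%:E); ring.
- by move=> x; apply: continuous_comp; [exact: opp_continuous|exact: cf].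
- by move=> x; exact: f0.
- move=> x; apply: (Deq (Dopp (Dcomp (Dopp (Did x)) (dF (- x))))).
  by rewrite /= mulN1r opprK.
- apply: cvgN; exact/cvgNy_compNP.
Qed.

End LineIntegral.
Arguments contC {R} c.

Section Lorentz.
Context {R : realType}.
Implicit Types (f g F : R -> R) (l m x c : R).
Local Notation mu := (@lebesgue_measure R).

Definition lor m l x : R := (1 + ((x - m) / l) ^+ 2)^-1.

Lemma lor_den_gt0 m l x : 0 < 1 + ((x - m) / l) ^+ 2.
Proof. by rewrite ltr_wpDr ?sqr_ge0. Qed.

Lemma lor_gt0 m l x : 0 < lor m l x.
Proof. by rewrite invr_gt0 lor_den_gt0. Qed.

Lemma lor_ge0 m l x : 0 <= lor m l x. Proof. exact/ltW/lor_gt0. Qed.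

Lemma lor_le1 m l x : lor m l x <= 1.
Proof. by rewrite invf_le1 ?lor_den_gt0// lerDl sqr_ge0. Qed.

Lemma derf_atan m l : l != 0 -> derf (fun x => l * atan ((x - m) / l)) (lor m l).
Proof.
move=> l0 x.
apply: (Deq (Dmul (Dcst _ l) (Dcomp (Dmul (Dsub (Did x) (Dcst x m)) (Dcst x l^-1))
  (is_derive1_atan _)))).
by rewrite mul0r add0r mulr0 addr0 subr0 mul1r mulrA divff// mul1r.
Qed.

Lemma lor_continuous m l : continuous (lor m l).
Proof.
move=> x; apply: cvgV; first by rewrite gt_eqF// lor_den_gt0.
apply: cvgD; first exact: cvg_cst.
have c : {for x, continuous (fun y : R => (y - m) / l)}.
  by apply: cvgM; [apply: cvgB; [exact: cvg_id|exact: cvg_cst]|exact: cvg_cst].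
by under eq_fun do rewrite expr2; rewrite expr2; exact: cvgM.
Qed.

Lemma cvgy_aff m l : 0 < l -> (x - m) / l @[x --> +oo%R] --> +oo%R.
Proof. by move=> l0; apply: gt0_cvgMly; rewrite ?invr_gt0//; exact: cvg_addrr. Qed.

Lemma cvgy_atan_aff m l : 0 < l ->
  l * atan ((x - m) / l) @[x --> +oo%R] --> l * (pi / 2).
Proof.
move=> l0; apply: cvgM; first exact: cvg_cst.
by apply: (cvg_comp (fun x => (x - m) / l) atan); [exact: cvgy_aff|exact: cvgy_atan].
Qed.

Lemma cvgNy_atan_aff m l : 0 < l ->
  l * atan ((x - m) / l) @[x --> -oo%R] --> - (l * (pi / 2)).
Proof.
move=> l0; apply/cvgNy_compNP => /=.
under eq_fun do rewrite -opprD mulNr atanN mulrN.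
by apply: cvgN; have := @cvgy_atan_aff (- m) l l0; under eq_fun do rewrite opprK.
Qed.

Lemma integral_lor m l : 0 < l -> (\int[mu]_x (lor m l x)%:E = (pi * l)%:E)%E.
Proof.
move=> l0; rewrite (ge0_FTC_line (@lor_continuous m l) (@lor_ge0 m l) (derf_atan _ _)
  (cvgy_atan_aff m l0) (cvgNy_atan_aff m l0)) ?gt_eqF//.
by congr (_%:E); field.
Qed.

Definition intg f := mu.-integrable setT (EFin \o f).

Lemma intg_dom f g : continuous f -> intg g -> (forall x, `|f x| <= g x) -> intg f.
Proof.
move=> cf ig fg; apply: (le_integrable measurableT _ _ ig).
  by apply/measurable_EFinP; exact: continuous_mfun.
by move=> x _ /=; rewrite lee_fin (le_trans (fg x))// ler_norm.
Qed.

Lemma intg_mdom f g : measurable_fun setT f -> intg g -> (forall x, `|f x| <= g x) -> intg f.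
Proof.
move=> mf ig fg; apply: (le_integrable measurableT _ _ ig).
  exact/measurable_EFinP.
by move=> x _ /=; rewrite lee_fin (le_trans (fg x))// ler_norm.
Qed.

Lemma intg_lor m l : 0 < l -> intg (lor m l).
Proof.
move=> l0; apply/integrableP; split.
  by apply/measurable_EFinP; apply: continuous_mfun; exact: lor_continuous.
under eq_integral => x _ do rewrite /= ger0_norm ?lor_ge0//.
by rewrite integral_lor// ltry.
Qed.

Lemma Rint_lor m l : 0 < l -> \int[mu]_x lor m l x = pi * l.
Proof. by move=> l0; rewrite /Rintegral integral_lor. Qed.

Lemma intgZ c f : intg f -> intg (fun x => c * f x).
Proof.
by move=> h; exact: (integrableZl measurableT c h).
Qed.

Lemma intgD f g : intg f -> intg g -> intg (fun x => f x + g x).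
Proof. by move=> hf hg; exact: (integrableD measurableT hf hg). Qed.

Lemma intgB f g : intg f -> intg g -> intg (fun x => f x - g x).
Proof. by move=> hf hg; exact: (integrableB measurableT hf hg). Qed.

Lemma intg_lordom f c m l : 0 < l -> continuous f ->
  (forall x, `|f x| <= c * lor m l x) -> intg f.
Proof. by move=> l0 cf; apply: intg_dom => //; exact: intgZ (intg_lor _ _). Qed.

Lemma Rint_lordom f c m l : 0 < l -> continuous f ->
  (forall x, `|f x| <= c * lor m l x) -> \int[mu]_x f x <= c * (pi * l).
Proof.
move=> l0 cf h; rewrite -(Rint_lor m l0) -RintegralZl//; last exact: intg_lor.
apply: le_Rintegral => //; first exact: intg_lordom h.
  exact/intgZ/intg_lor.
by move=> x _; exact: le_trans (ler_norm _) (h x).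
Qed.

Lemma le_Rint f g : intg f -> intg g -> (forall x, f x <= g x) ->
  \int[mu]_x f x <= \int[mu]_x g x.
Proof. by move=> hf hg fg; exact: le_Rintegral. Qed.

Lemma Rint_ge_box f g (a b k : R) : a <= b -> 0 <= k -> intg f -> intg g ->
  (forall x, g x <= f x) -> (forall x, a <= x <= b -> k + g x <= f x) ->
  k * (b - a) + \int[mu]_x g x <= \int[mu]_x f x.
Proof.
move=> ab k0 hf hg h1 h2.
have iI : intg (\1_(`[a, b]%classic : set R)) by exact: integrable_indic_itv.
have mE : lebesgue_measure (`[a, b]%classic : set R) = (b - a)%:E.
  rewrite lebesgue_measure_itv/= lte_fin.
  by case: ltgtP ab => // -> _; rewrite subrr.
have E : \int[mu]_x (\1_(`[a, b]%classic : set R) x : R) = b - a.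
  rewrite /Rintegral integral_indic// setIT; exact: (congr1 fine mE).
rewrite -E -(RintegralZl k measurableT iI) -(RintegralD measurableT (intgZ k iI) hg).
apply: le_Rint => //; first exact: intgD (intgZ k iI) hg.
move=> x; rewrite indicE; case: (boolP (x \in _)) => [|_] /=; last by rewrite mulr0 add0r.
by rewrite inE /= in_itv /= mulr1 => /h2.
Qed.

Lemma lor01 x : lor 0 1 x = (1 + x ^+ 2)^-1.
Proof. by rewrite /lor subr0 divr1. Qed.

Lemma cvgy_lor : lor 0 1 x @[x --> +oo%R] --> 0.
Proof.
apply/cvgrPdist_le => /= e e0; near=> x.
have x1 : 1 <= x by near: x; apply: nbhs_pinfty_ge; exact: num_real.
have xe : e^-1 <= x by near: x; apply: nbhs_pinfty_ge; exact: num_real.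
rewrite sub0r normrN ger0_norm ?lor_ge0// lor01 invf_ple ?posrE//; last first.
  by rewrite ltr_wpDr ?sqr_ge0.
nra.
Unshelve. end_near. Qed.

Lemma cvgNy_lor : lor 0 1 x @[x --> -oo%R] --> 0.
Proof.
apply/cvgNy_compNP => /=; under eq_fun do rewrite lor01 sqrrN -lor01.
exact: cvgy_lor.
Qed.

Lemma Rint_derive0 f F c : continuous f -> derf F f ->
  (forall x, `|f x| <= c * lor 0 1 x) -> (forall x, `|F x| <= c * lor 0 1 x) ->
  \int[mu]_x f x = 0.
Proof.
move=> cf dF fc Fc.
have lim0 (G : set_system R) : Filter G -> lor 0 1 x @[x --> G] --> 0 ->
    F x @[x --> G] --> 0.
  move=> FG h; apply: (@squeeze_cvgr _ _ _ _ (fun x => - (c * lor 0 1 x))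
      (fun x => c * lor 0 1 x)).
  - by apply/nearW => x; rewrite -ler_norml.
  - have := cvgN (cvgM (@cvg_cst _ c _ G _) h); rewrite mulr0 oppr0; exact.
  - have := cvgM (@cvg_cst _ c _ G _) h; rewrite mulr0; exact.
have Fy := lim0 _ _ cvgy_lor; have FNy := lim0 _ _ cvgNy_lor.
have l1 : 0 < 1 :> R by [].
pose g x := f x + c * lor 0 1 x.
have ig : intg f by exact: (intg_lordom l1 cf fc).
have il := intg_lor 0 l1.
have cg : continuous g.
  exact: (contD cf (contM (contC c) (@lor_continuous 0 1))).
have g0 x : 0 <= g x by move: (fc x); rewrite ler_norml /g => /andP[]; lra.
have dG : derf (fun x => F x + c * (1 * atan ((x - 0) / 1))) g.
  move=> x; apply: (Deq (Dadd (dF x) (Dmul (Dcst x c) (derf_atan 0 _ x)))) => //.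
  by rewrite mul0r add0r.
have cc (G : set_system R) : Filter G -> (fun=> c) x @[x --> G] --> c.
  by move=> FG; exact: cvg_cst.
have H := ge0_FTC_line cg g0 dG (cvgD (Fy _) (cvgM (cc _ _) (cvgy_atan_aff 0 l1)))
  (cvgD (FNy _) (cvgM (cc _ _) (cvgNy_atan_aff 0 l1))).
have : \int[mu]_x g x = \int[mu]_x f x + c * (pi * 1).
  rewrite RintegralD//; last exact: intgZ.
  by rewrite RintegralZl// Rint_lor.
rewrite {1}/Rintegral H /=; lra.
Qed.

End Lorentz.

Section GaussianClass.
Context {R : realType}.
Implicit Types (f g : R -> R) (p q : {poly R}) (c m x y z nu theta : R).

Lemma expX_bound n c : 0 < c -> exists C, forall z, 0 <= z -> z ^+ n * expR (- (c * z)) <= C.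
Proof.
elim: n c => [|n ih] c c0.
  by exists 1 => z z0; rewrite mul1r -expR0 ler_expR oppr_le0 mulr_ge0// ltW.
have c2 : 0 < c / 2 by rewrite divr_gt0.
have [C hC] := ih _ c2; exists (C * (c / 2)^-1) => z z0.
have -> : - (c * z) = - (c / 2 * z) + - (c / 2 * z) by field.
rewrite expRD exprSr mulrACA ler_pM//.
- by rewrite mulr_ge0 ?exprn_ge0 ?expR_ge0.
- by rewrite mulr_ge0 ?expR_ge0.
- exact: hC.
- rewrite expRN -ler_pdivlMr ?invr_gt0 ?expR_gt0// invrK mulrC ler_pdivlMr//.
  by rewrite mulrC (le_trans _ (expR_ge1Dx _))// lerDr.
Qed.

Variables (k : nat) (c m : R).
Hypotheses (k0 : (0 < k)%N) (c0 : 0 < c).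

Definition gexp x := expR (- (c * (x - m) ^+ (2 * k))).

Lemma gexp_gt0 x : 0 < gexp x. Proof. exact: expR_gt0. Qed.

Lemma gexp_le1 x : gexp x <= 1.
Proof. by rewrite -expR0 ler_expR oppr_le0 mulr_ge0 ?(ltW c0)// exprM exprn_ge0 ?sqr_ge0. Qed.

Lemma monom_bound n : exists C, forall x, `|x - m| ^+ n * gexp x <= C.
Proof.
have [C hC] := expX_bound n c0; exists (1 + C) => x.
have C0 : 0 <= C.
  by apply: le_trans (hC 0 (lexx _)); rewrite mulr_ge0 ?exprn_ge0 ?expR_ge0.
have [x1|x1] := leP `|x - m| 1.
  rewrite (@le_trans _ _ 1) ?lerDl// mulr_ile1 ?exprn_ge0 ?(ltW (gexp_gt0 _)) ?gexp_le1//.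
  by rewrite exprn_ile1.
rewrite (@le_trans _ _ C) ?lerDr//; apply: le_trans (hC _ (normr_ge0 (x - m))).
rewrite ler_wpM2l ?exprn_ge0// ler_expR lerN2 ler_wpM2l ?(ltW c0)//.
rewrite -[leRHS]ger0_norm; last by rewrite exprM exprn_ge0 ?sqr_ge0.
rewrite normrX -{1}[`|x - m|]expr1 ler_eXn2l//.
by rewrite mulSn mul1n addn_gt0 k0.
Qed.

Lemma poly_bound p : exists C, forall x, `|p.[x]| * gexp x <= C.
Proof.
have H q n : exists C, forall x, `|q.[x - m]| * `|x - m| ^+ n * gexp x <= C.
  elim/poly_ind: q n => [|q a ih] n.
    by exists 0 => x; rewrite horner0 normr0 !mul0r.
  have [C1 h1] := ih n.+1; have [C2 h2] := monom_bound n.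
  exists (C1 + `|a| * C2) => x; rewrite !hornerE.
  apply: le_trans (lerD (h1 x) (ler_wpM2l (normr_ge0 a) (h2 x))).
  rewrite exprS !mulrA -!mulrDl ler_wpM2r ?(ltW (gexp_gt0 _))// ler_wpM2r ?exprn_ge0//.
  by rewrite -normrM ler_normD.
have [C hC] := H (p \Po ('X + m%:P)) 0%N; exists C => x.
by have := hC x; rewrite horner_comp !hornerE subrK.
Qed.

Lemma poly_lor_bound p : exists C, forall x, `|p.[x]| * gexp x <= C * lor 0 1 x.
Proof.
have [C hC] := poly_bound (p * (1 + 'X^2)); exists C => x.
have h : 0 < 1 + x ^+ 2 by rewrite ltr_wpDr ?sqr_ge0.
rewrite lor01 ler_pdivlMr//; apply: le_trans (hC x).
by rewrite !hornerE normrM (ger0_norm (ltW h)) mulrAC.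
Qed.

Variables (nu theta : R).

Definition gclass f := exists p q, forall x,
  f x = (p.[x] * cos (nu * x + theta) + q.[x] * sin (nu * x + theta)) * gexp x.

Lemma gclass_lor f : gclass f -> forall p, exists C, forall x, `|p.[x] * f x| <= C * lor 0 1 x.
Proof.
move=> [p [q fE]] r.
have [C1 h1] := poly_lor_bound (r * p); have [C2 h2] := poly_lor_bound (r * q).
exists (C1 + C2) => x; rewrite mulrDl; apply: le_trans (lerD (h1 x) (h2 x)).
rewrite fE mulrA -mulrDl normrM (ger0_norm (ltW (gexp_gt0 x))) ler_wpM2r ?(ltW (gexp_gt0 _))//.
rewrite !hornerE mulrDr !mulrA (le_trans (ler_normD _ _))// lerD// normrM ler_piMr//.
  by rewrite ler_norml cos_geN1 cos_le1.
by rewrite ler_norml sin_geN1 sin_le1.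
Qed.

Lemma dgexp : derf gexp (fun x => - (c * ((2 * k)%:R * (x - m) ^+ (2 * k).-1)) * gexp x).
Proof.
move=> x; apply: (Deq (Dcomp (Dopp (Dmul (Dcst x c) (Dexp (2 * k) (Dsub (Did x) (Dcst x m)))))
  (is_derive_expR _))).
by rewrite mul0r add0r subr0 mulr1.
Qed.

Lemma derf_horner p : derf (fun x => p.[x]) (fun x => p^`().[x]).
Proof. by move=> x; exact: is_derive_poly. Qed.

Lemma gclass_derive f : gclass f -> exists2 g, gclass g & derf f g.
Proof.
move=> [p [q fE]].
pose w := (- (c * (2 * k)%:R)) *: ('X - m%:P) ^+ (2 * k).-1.
pose P := p^`() + nu *: q + w * p; pose Q := q^`() - nu *: p + w * q.
exists (fun x => (P.[x] * cos (nu * x + theta) + Q.[x] * sin (nu * x + theta)) * gexp x).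
  by exists P, Q.
move=> x; rewrite (_ : f = fun y => (p.[y] * cos (nu * y + theta) +
  q.[y] * sin (nu * y + theta)) * gexp y); last exact/funext.
have dl := Dadd (Dmul (Dcst x nu) (Did x)) (Dcst x theta).
apply: (Deq (Dmul (Dadd (Dmul (derf_horner p x) (Dcomp dl (is_derive_cos _)))
  (Dmul (derf_horner q x) (Dcomp dl (is_derive_sin _)))) (dgexp x))).
rewrite /P /Q /w !(hornerD, hornerN, hornerZ, hornerM, horner_exp, hornerX, hornerC); ring.
Qed.

Lemma gclass_smooth f : gclass f -> rsmooth f /\ forall n, gclass (derive1n n f).
Proof.
move=> cf; have H n : gclass (derive1n n f).
  elim: n => [//|n ih]; have [g cg dg] := gclass_derive ih; rewrite derive1nS.
  rewrite (_ : derive1 (derive1n n f) = g)//; apply/funext => x.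
  by have [_ <-] := dg x; rewrite derive1E.
split=> // n x; have [g _ dg] := gclass_derive (H n).
by have [] := dg x.
Qed.

Lemma gclass_schwartz (f : R -> R[i]^o) :
  gclass (fun x => complex.Re (f x)) -> gclass (fun x => complex.Im (f x)) ->
  f \in @schwartz_fun R.
Proof.
move=> c1 c2; rewrite inE; have [s1 d1] := gclass_smooth c1.
have [s2 d2] := gclass_smooth c2; split=> // j n.
have [C1 h1] := gclass_lor (d1 n) 'X^j; have [C2 h2] := gclass_lor (d2 n) 'X^j.
have H (C x : R) g : `|'X^j.[x] * g x| <= C * lor 0 1 x -> `|x| ^+ j * `|g x| <= `|C|.
  rewrite hornerXn normrM normrX => h; apply: (le_trans h).
  rewrite (le_trans (ler_norm _))// normrM ler_piMr// ger0_norm ?lor_ge0//.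
  exact: lor_le1.
apply: (@le_lt_trans _ _ (`|C1| + `|C2|)%:E); last by rewrite ltry.
apply: ge_ereal_sup => _ [x _ <-]; rewrite lee_fin.
apply: le_trans (lerD (H _ _ _ (h1 x)) (H _ _ _ (h2 x))).
rewrite -mulrDr ler_wpM2l ?exprn_ge0// /cderiven /=.
rewrite -[leRHS]ger0_norm ?addr_ge0// -sqrtr_sqr ler_sqrt ?sqr_ge0//.
rewrite sqrrD !real_normK ?num_real// -addrA lerD2l lerDr.
by rewrite mulrn_wge0// mulr_ge0.
Qed.

End GaussianClass.

Section LocallyUniform.
Context {R : realType}.
Implicit Types (f g e : R -> R -> R) (t x c : R).
Local Notation mu := (@lebesgue_measure R).

Definition ldec t0 f := exists C, \forall t \near t0, forall x, `|f t x| <= C * lor 0 1 x.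
Definition lbdd t0 f := exists C, \forall t \near t0, forall x, `|f t x| <= C.

Variable t0 : R.

Lemma ldec_lbdd f : ldec t0 f -> lbdd t0 f.
Proof.
move=> [C h]; exists `|C|; apply: filterS h => t H x.
apply: (le_trans (H x)); rewrite (le_trans (ler_norm _))// normrM ler_piMr//.
by rewrite ger0_norm ?lor_ge0 ?lor_le1.
Qed.

Lemma lbdd_cst c : lbdd t0 (fun _ _ => c).
Proof. by exists `|c|; near=> t => x. Unshelve. end_near. Qed.

Lemma ldecD f g : ldec t0 f -> ldec t0 g -> ldec t0 (fun t x => f t x + g t x).
Proof.
move=> [C h] [C' h']; exists (C + C'); apply: filterS2 h h' => t a b x; rewrite mulrDl.
apply: (le_trans (ler_normD _ _)); exact: lerD.
Qed.

Lemma lbddD f g : lbdd t0 f -> lbdd t0 g -> lbdd t0 (fun t x => f t x + g t x).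
Proof.
move=> [C h] [C' h']; exists (C + C'); apply: filterS2 h h' => t a b x.
apply: (le_trans (ler_normD _ _)); exact: lerD.
Qed.

Lemma ldecN f : ldec t0 f -> ldec t0 (fun t x => - f t x).
Proof. by move=> [C h]; exists C; apply: filterS h => t h x; rewrite normrN. Qed.

Lemma lbddN f : lbdd t0 f -> lbdd t0 (fun t x => - f t x).
Proof. by move=> [C h]; exists C; apply: filterS h => t h x; rewrite normrN. Qed.

Lemma ldecMr f g : ldec t0 f -> lbdd t0 g -> ldec t0 (fun t x => f t x * g t x).
Proof.
move=> [C h] [C' h']; exists (C * C'); apply: filterS2 h h' => t a b x; rewrite normrM mulrAC.
exact: ler_pM.
Qed.

Lemma ldecMl f g : lbdd t0 f -> ldec t0 g -> ldec t0 (fun t x => f t x * g t x).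
Proof.
move=> hf hg; have [C h] := ldecMr hg hf; exists C; apply: filterS h => t h x.
by rewrite mulrC.
Qed.

Lemma lbddM f g : lbdd t0 f -> lbdd t0 g -> lbdd t0 (fun t x => f t x * g t x).
Proof.
move=> [C h] [C' h']; exists (C * C'); apply: filterS2 h h' => t a b x; rewrite normrM.
exact: ler_pM.
Qed.

Lemma lbddX f n : lbdd t0 f -> lbdd t0 (fun t x => f t x ^+ n).
Proof.
move=> hf; elim: n => [|n ih]; first exact: (lbdd_cst 1).
have [C h] := lbddM hf ih; exists C; apply: filterS h => t h x.
by rewrite exprS.
Qed.

Lemma ldecX f n : (0 < n)%N -> ldec t0 f -> ldec t0 (fun t x => f t x ^+ n).
Proof.
case: n => // n _ hf; have [C h] := ldecMr hf (lbddX n (ldec_lbdd hf)).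
by exists C; apply: filterS h => t h x; rewrite exprS.
Qed.

Lemma ldec_at f : ldec t0 f -> exists C, forall x, `|f t0 x| <= C * lor 0 1 x.
Proof. by move=> [C h]; exists C; exact: (nbhs_singleton h). Qed.

Lemma derive_Rint e et : (forall t, continuous (e t)) ->
  (forall t x, is_derive t (1 : R) (e ^~ x) (et t x)) ->
  ldec t0 e -> ldec t0 et ->
  is_derive t0 (1 : R) (fun t => \int[mu]_x e t x) (\int[mu]_x et t0 x).
Proof.
move=> ce de [C h] [C' h'].
have [/= d d0 H] : \forall t \near t0, forall x, `|e t x| <= C * lor 0 1 x /\
    `|et t x| <= C' * lor 0 1 x.
  by apply: filterS2 h h' => t a b x; split.
have Hd t : t \in `]t0 - d, t0 + d[ -> ball t0 d t.
  by rewrite in_itv/= -ball_normE /= => /andP[a b]; rewrite ltr_distlC; apply/andP.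
have I0 : `]t0 - d, t0 + d[%classic t0.
  by rewrite /= in_itv/= ltrBlDr !ltrDl d0.
have ie t : `]t0 - d, t0 + d[%classic t -> mu.-integrable setT (EFin \o e t).
  move=> /Hd /H /= Ht; apply: (@intg_lordom _ _ C 0 1) => // x.
  by have [] := Ht x.
have dd t x : `]t0 - d, t0 + d[%classic t -> setT x -> derivable (e^~ x) t 1.
  by move=> _ _; have [] := de t x.
have C0 : 0 <= C'.
  have [_] := H _ (Hd _ I0) 0; move=> /(le_trans (normr_ge0 _)).
  by rewrite pmulr_lge0// lor_gt0.
have g0 (x : R) : 0 <= C' * lor 0 1 x by rewrite mulr_ge0 ?lor_ge0.
have ig : mu.-integrable setT (EFin \o (fun x => C' * lor 0 1 x)).
  exact: (intgZ C' (intg_lor 0 _)).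
have dub t x : `]t0 - d, t0 + d[%classic t -> setT x ->
    `|partial1of2 e t x| <= C' * lor 0 1 x.
  move=> /Hd /H /(_ x) [_ Ht] _; rewrite partial1of2E.
  by have [_ ->] := de t x.
have E : partial1of2 e t0 = et t0.
  by apply/funext => x; rewrite partial1of2E; have [_ ->] := de t0 x.
apply: DeriveDef; first exact: (derivable_under_integral measurableT I0 ie dd g0 ig dub).
have := differentiation_under_integral measurableT I0 ie dd g0 ig dub.
by rewrite derive1E => ->; rewrite E.
Qed.

End LocallyUniform.

(** * Schwartz functions and their paths *)

Section SchwartzPath.
Context {R : realType}.
Implicit Types (u v : schwartz R) (w : R -> schwartz R) (t x : R).

Definition sre n u x : R := complex.Re (cderiven n u x).
Definition sim n u x : R := complex.Im (cderiven n u x).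

Lemma schwartzP u : smooth u /\ forall k n, (seminorm k n u < +oo)%E.
Proof. by case: u => u /= /set_mem. Qed.

Lemma derf_sre n u : derf (sre n u) (sre n.+1 u).
Proof.
move=> x; have [[h _] _] := schwartzP u; apply: DeriveDef; first exact: h.
by rewrite -derive1E -derive1nS.
Qed.

Lemma derf_sim n u : derf (sim n u) (sim n.+1 u).
Proof.
move=> x; have [[_ h] _] := schwartzP u; apply: DeriveDef; first exact: h.
by rewrite -derive1E -derive1nS.
Qed.

Lemma Re_le_normc (z : R[i]) : `|complex.Re z| <= normc z.
Proof. by case: z => a b /=; rewrite -sqrtr_sqr ler_sqrt ?addr_ge0 ?sqr_ge0// lerDl sqr_ge0. Qed.

Lemma Im_le_normc (z : R[i]) : `|complex.Im z| <= normc z.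
Proof. by case: z => a b /=; rewrite -sqrtr_sqr ler_sqrt ?addr_ge0 ?sqr_ge0// lerDr sqr_ge0. Qed.

Lemma seminorm_normc k n u x C : (seminorm k n u <= C%:E)%E ->
  `|x| ^+ k * normc (cderiven n u x) <= C.
Proof.
by move=> h; rewrite -lee_fin; apply: le_trans h; apply: ereal_sup_ubound; exists x.
Qed.

Lemma seminorm_lor n u x C : (seminorm 0 n u <= C%:E)%E -> (seminorm 2 n u <= C%:E)%E ->
  normc (cderiven n u x) <= (C + C) * lor 0 1 x.
Proof.
move=> /(@seminorm_normc _ _ _ x) h0 /(@seminorm_normc _ _ _ x) h2.
rewrite lor01 ler_pdivlMr ?ltr_wpDr ?sqr_ge0// mulrDr mulr1 lerD//.
  by rewrite -[leLHS]mul1r.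
by rewrite mulrC -real_normK ?num_real.
Qed.

Lemma normc_lor n u : exists C, forall x, normc (cderiven n u x) <= C * lor 0 1 x.
Proof.
have [_ h] := schwartzP u.
have fin k : exists C, (seminorm k n u <= C%:E)%E.
  have := h k n; case: (seminorm k n u) => [r| |] // _; first by exists r.
  by exists 0; rewrite leNye.
have [C1 h1] := fin 0%N; have [C2 h2] := fin 2%N.
exists (Num.max C1 C2 + Num.max C1 C2) => x.
by apply: seminorm_lor; [apply: le_trans h1 _|apply: le_trans h2 _];
  rewrite lee_fin le_max lexx ?orbT.
Qed.

Lemma cderiven_lin n (a : R) u v x :
  cderiven n (schwartz_val (a%:C *: u + v)) x = a%:C * cderiven n u x + cderiven n v x.
Proof.
have L (f g : R -> R) : rsmooth f -> rsmooth g ->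
    derive1n n (fun x => a * f x + g x) = (fun x => a * derive1n n f x + derive1n n g x).
  move=> sf sg; elim: n => [//|n ih]; rewrite !derive1nS ih; apply/funext => y.
  have df : is_derive y (1 : R) (derive1n n f) (derive1 (derive1n n f) y).
    by apply: DeriveDef; [exact: sf|rewrite derive1E].
  have dg : is_derive y (1 : R) (derive1n n g) (derive1 (derive1n n g) y).
    by apply: DeriveDef; [exact: sg|rewrite derive1E].
  rewrite derive1E; have [_ ->] := Dadd (Dmul (Dcst y a) df) dg.
  by rewrite mul0r add0r.
have [[u1 u2] _] := schwartzP u; have [[v1 v2] _] := schwartzP v.
have E1 : @complex.Re R \o (a%:C *: u + v : schwartz R) =
    (fun x => a * (@complex.Re R \o u) x + (@complex.Re R \o v) x).
  apply/funext => y /=; rewrite !fctE /=.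
  by case: (u y) (v y) => [? ?] [? ?] /=; rewrite mul0r subr0.
have E2 : @complex.Im R \o (a%:C *: u + v : schwartz R) =
    (fun x => a * (@complex.Im R \o u) x + (@complex.Im R \o v) x).
  apply/funext => y /=; rewrite !fctE /=.
  by case: (u y) (v y) => [? ?] [? ?] /=; rewrite mul0r addr0.
by rewrite /cderiven E1 E2 !L//=; apply/eqP; rewrite eq_complex /= !mul0r subr0 addr0 !eqxx.
Qed.

End SchwartzPath.

Section PathDerivative.
Context {R : realType}.
Implicit Types (u v : schwartz R) (w : R -> schwartz R) (t x : R).

Lemma cderiven0 n x : cderiven n (schwartz_val 0) x = 0 :> R[i].
Proof.
have := cderiven_lin n 1 0 0 x; rewrite scaler0 addr0 mul1r => h.
by apply/(@addrI _ (cderiven n (schwartz_val 0) x)); rewrite -h addr0.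
Qed.

Lemma cderivenB n u v x : cderiven n (schwartz_val (u - v)) x = cderiven n u x - cderiven n v x.
Proof.
have -> : u - v = (-1)%:C *: v + u.
  by rewrite (_ : (-1)%:C = -1 :> R[i]) ?scaleN1r 1?addrC// rmorphN.
by rewrite (cderiven_lin n (-1) v u x) rmorphN mulN1r addrC.
Qed.

Lemma cderivenZ n (a : R) u x : cderiven n (schwartz_val (a%:C *: u)) x = a%:C * cderiven n u x.
Proof. by have := cderiven_lin n a u 0 x; rewrite addr0 cderiven0 addr0. Qed.

Lemma is_schwartz_derive_near w t v k n : is_schwartz_derive w t v ->
  forall eps : R, 0 < eps -> \forall h \near 0^',
    (seminorm k n (h^-1%:C *: (w (t + h) - w t) - v)%R <= eps%:E)%E.
Proof.
move=> /(_ k n) /fine_cvgP [hf hc] eps e0.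
move/cvgrPdist_le : hc => /(_ _ e0) hc.
apply: filterS2 hf hc => h hf; rewrite /= sub0r normrN => he.
by rewrite -(fineK hf) lee_fin (le_trans (ler_norm _)).
Qed.

Section RealPart.
Variable phi : R[i] -> R.
Hypotheses (phiB : forall z z', phi (z - z') = phi z - phi z')
  (phiZ : forall (a : R) z, phi (a%:C * z) = a * phi z)
  (phi_le : forall z, `|phi z| <= normc z).

Lemma path_derive_aux w t v n x : is_schwartz_derive w t v ->
  is_derive t (1 : R) (fun t' => phi (cderiven n (w t') x)) (phi (cderiven n v x)).
Proof.
move=> wv; have H : h^-1 *: (phi (cderiven n (w (h *: (1 : R) + t)) x) -
    phi (cderiven n (w t) x)) @[h --> 0^'] --> phi (cderiven n v x).
  apply/(@cvgrPdist_le _ R^o) => eps e0.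
  apply: filterS (is_schwartz_derive_near 0 n wv e0) => h /(@seminorm_normc _ _ _ _ x).
  rewrite mul1r !(cderivenB, cderivenZ) => /(le_trans (phi_le _)).
  have -> : h *: (1 : R) = h by rewrite /GRing.scale /= mulr1.
  by rewrite phiB phiZ phiB (addrC h t) distrC.
apply: DeriveDef; last exact: cvg_lim H.
by apply/cvg_ex; exists (phi (cderiven n v x)).
Qed.

Lemma path_ldec_aux w t v n : is_schwartz_derive w t v ->
  ldec t (fun t' x => phi (cderiven n (w t') x)).
Proof.
move=> wv; have [C1 h1] := normc_lor n (w t); have [C2 h2] := normc_lor n v.
exists (C1 + (C2 + 2)).
have [/= d0 d00 N0] := is_schwartz_derive_near 0 n wv (@ltr01 R).
have [/= d2 d20 N2] := is_schwartz_derive_near 2 n wv (@ltr01 R).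
have b1 (z : R) : normc (cderiven n (w t) z) <= (C1 + (C2 + 2)) * lor 0 1 z.
  rewrite mulrDl (le_trans (h1 z))// lerDl mulr_ge0 ?lor_ge0// addr_ge0//.
  by have := le_trans (normr_ge0 _) (le_trans (phi_le _) (h2 0)); rewrite pmulr_lge0 ?lor_gt0.
have dm : 0 < Num.min (Num.min d0 d2) 1 by rewrite !lt_min d00 d20 ltr01.
have := nbhsx_ballx t _ dm; apply: filterS => t'; rewrite -ball_normE /= distrC => td x.
have [->|tt] := eqVneq t' t; first exact: le_trans (phi_le _) (b1 x).
have {td} [a0 a2 a1] : [/\ `|t' - t| < d0, `|t' - t| < d2 & `|t' - t| < 1].
  by move: td; rewrite !lt_min => /andP[/andP[-> ->] ->].
have tt0 : t' - t != 0 by rewrite subr_eq0.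
have [b0 b2] : ball 0 d0 (t' - t) /\ ball 0 d2 (t' - t).
  by rewrite -!ball_normE /= !sub0r !normrN.
have s0 := N0 _ b0 tt0; have s2 := N2 _ b2 tt0; rewrite /= in s0 s2.
have := @seminorm_lor R n (((t' - t)^-1)%:C *: (w (t + (t' - t)) - w t) - v) x 1 s0 s2.
rewrite subrKC => /(le_trans (phi_le _)); rewrite !(cderivenB, cderivenZ).
rewrite phiB phiZ phiB => Q.
have P1 := le_trans (phi_le _) (h1 x); have P2 := le_trans (phi_le _) (h2 x).
set a := phi (cderiven n (w t') x) in Q *; set b := phi (cderiven n (w t) x) in Q P1.
set c := phi (cderiven n v x) in Q P2; set d := t' - t in Q a1 tt0.
have -> : a = b + d * (c + (d^-1 * (a - b) - c)) by field.
clearbody a b c d.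
have W : `|c + (d^-1 * (a - b) - c)| <= (C2 + 2) * lor 0 1 x.
  rewrite mulrDl (le_trans (ler_normD _ _))// lerD//.
have M : `|d * (c + (d^-1 * (a - b) - c))| <= (C2 + 2) * lor 0 1 x.
  by rewrite normrM; apply: le_trans W; rewrite ler_piMl// ltW.
by rewrite (mulrDl C1) (le_trans (ler_normD _ _))// lerD.
Qed.

End RealPart.

Let ReB (z z' : R[i]) : complex.Re (z - z') = complex.Re z - complex.Re z'.
Proof. by case: z z' => [? ?] []. Qed.
Let ImB (z z' : R[i]) : complex.Im (z - z') = complex.Im z - complex.Im z'.
Proof. by case: z z' => [? ?] []. Qed.
Let ReZ (a : R) z : complex.Re (a%:C * z) = a * complex.Re z.
Proof. by case: z => [? ?] /=; rewrite mul0r subr0. Qed.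
Let ImZ (a : R) z : complex.Im (a%:C * z) = a * complex.Im z.
Proof. by case: z => [? ?] /=; rewrite mul0r addr0. Qed.

Variables (w : R -> schwartz R) (t : R) (v : schwartz R).
Hypothesis wv : is_schwartz_derive w t v.

Lemma path_derive_sre n x : is_derive t (1 : R) (fun t' => sre n (w t') x) (sre n v x).
Proof. exact: (path_derive_aux ReB ReZ (@Re_le_normc R)). Qed.

Lemma path_derive_sim n x : is_derive t (1 : R) (fun t' => sim n (w t') x) (sim n v x).
Proof. exact: (path_derive_aux ImB ImZ (@Im_le_normc R)). Qed.

Lemma path_ldec_sre n : ldec t (fun t' x => sre n (w t') x).
Proof. exact: (path_ldec_aux ReB ReZ (@Re_le_normc R) n wv). Qed.

Lemma path_ldec_sim n : ldec t (fun t' x => sim n (w t') x).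
Proof. exact: (path_ldec_aux ImB ImZ (@Im_le_normc R) n wv). Qed.

End PathDerivative.

Section Automation.
Context {R : realType}.
Implicit Types f g : R -> R.

(* A plain definition rather than the type class is_derive, so that
   eapply does not trigger instance resolution. *)
Definition isD f (x a : R) : Prop := is_derive x (1 : R) f a.
Definition cont f : Prop := continuous f.

Lemma isD_eq f x a b : isD f x a -> a = b -> isD f x b.
Proof. by move=> ? <-. Qed.
Lemma isD_cst c x : isD (fun _ => c) x 0. Proof. exact: Dcst. Qed.
Lemma isD_id x : isD (fun y => y) x 1. Proof. exact: Did. Qed.
Lemma isD_add f g x a b : isD f x a -> isD g x b -> isD (fun y => f y + g y) x (a + b).
Proof. exact: Dadd. Qed.
Lemma isD_opp f x a : isD f x a -> isD (fun y => - f y) x (- a).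
Proof. exact: Dopp. Qed.
Lemma isD_mul f g x a b : isD f x a -> isD g x b ->
  isD (fun y => f y * g y) x (a * g x + f x * b).
Proof. exact: Dmul. Qed.
Lemma isD_cmul c f x a : isD f x a -> isD (fun y => c * f y) x (c * a).
Proof. by move=> h; apply: isD_eq (isD_mul (isD_cst c x) h) _; rewrite mul0r add0r. Qed.
Lemma isD_exp f n x a : isD f x a -> isD (fun y => f y ^+ n) x (n%:R * f x ^+ n.-1 * a).
Proof. exact: Dexp. Qed.
Lemma isD_comp f g x a b : isD g x b -> isD f (g x) a -> isD (fun y => f (g y)) x (b * a).
Proof. exact: Dcomp. Qed.
Lemma isD_cos f x a : isD f x a -> isD (fun y => cos (f y)) x (a * - sin (f x)).
Proof. by move=> h; exact: Dcomp h (is_derive_cos _). Qed.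
Lemma isD_sin f x a : isD f x a -> isD (fun y => sin (f y)) x (a * cos (f x)).
Proof. by move=> h; exact: Dcomp h (is_derive_sin _). Qed.
Lemma isD_expR f x a : isD f x a -> isD (fun y => expR (f y)) x (a * expR (f x)).
Proof. by move=> h; exact: Dcomp h (is_derive_expR _). Qed.

Lemma cont_cst c : cont (fun _ => c). Proof. exact: (contC c). Qed.
Lemma cont_id : cont (fun x => x). Proof. exact: contid. Qed.
Lemma cont_add f g : cont f -> cont g -> cont (fun x => f x + g x).
Proof. exact: contD. Qed.
Lemma cont_opp f : cont f -> cont (fun x => - f x).
Proof. by move=> cf x; exact: cvgN (cf x). Qed.
Lemma cont_mul f g : cont f -> cont g -> cont (fun x => f x * g x).
Proof. exact: contM. Qed.
Lemma cont_exp f n : cont f -> cont (fun x => f x ^+ n).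
Proof. exact: contX. Qed.
Lemma cont_comp f g : cont f -> cont g -> cont (fun x => f (g x)).
Proof. exact: contcomp. Qed.
Lemma cont_cos : cont cos. Proof. exact: continuous_cos. Qed.
Lemma cont_sin : cont sin. Proof. exact: continuous_sin. Qed.
Lemma cont_expR : cont expR. Proof. exact: continuous_expR. Qed.
Lemma derf_cont f g : derf f g -> cont f.
Proof. exact: is_derive_continuous. Qed.

End Automation.

(* The *leaf tactics treat the atoms; they are redefined below for the
   functions at hand. *)
Ltac dleaf := fail.
Ltac drec :=
  match goal with
  | |- isD (fun _ => ?c) _ _ => apply isD_cst
  | |- isD (fun y => y) _ _ => apply isD_id
  | |- isD (fun y => @GRing.add _ (@?f y) (@?g y)) _ _ =>
      eapply (@isD_add _ f g); [drec | drec]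
  | |- isD (fun y => @GRing.opp _ (@?f y)) _ _ => eapply (@isD_opp _ f); drec
  | |- isD (fun y => @GRing.mul _ ?c (@?g y)) _ _ => eapply (@isD_cmul _ c g); drec
  | |- isD (fun y => @GRing.mul _ (@?f y) (@?g y)) _ _ =>
      eapply (@isD_mul _ f g); [drec | drec]
  | |- isD (fun y => @GRing.exp _ (@?f y) ?n) _ _ => eapply (@isD_exp _ f n); drec
  | |- isD (fun y => cos (@?f y)) _ _ => eapply (@isD_cos _ f); drec
  | |- isD (fun y => sin (@?f y)) _ _ => eapply (@isD_sin _ f); drec
  | |- isD (fun y => expR (@?f y)) _ _ => eapply (@isD_expR _ f); drec
  | _ => dleaf
  end.

Ltac cleaf := fail.
Ltac crec :=
  match goal with
  | |- cont (fun _ => ?c) => apply cont_cst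
  | |- cont (fun y => y) => apply cont_id
  | |- cont (fun y => @GRing.add _ (@?f y) (@?g y)) => apply (@cont_add _ f g); crec
  | |- cont (fun y => @GRing.opp _ (@?f y)) => apply (@cont_opp _ f); crec
  | |- cont (fun y => @GRing.mul _ (@?f y) (@?g y)) => apply (@cont_mul _ f g); crec
  | |- cont (fun y => @GRing.exp _ (@?f y) ?n) => apply (@cont_exp _ f n); crec
  | |- cont (fun y => cos (@?f y)) => apply (@cont_comp _ cos f cont_cos); crec
  | |- cont (fun y => sin (@?f y)) => apply (@cont_comp _ sin f cont_sin); crec
  | |- cont (fun y => expR (@?f y)) => apply (@cont_comp _ expR f cont_expR); crec
  | _ => cleaf
  end.

Ltac lbleaf := fail.
Ltac lbrec :=
  match goal with
  | |- lbdd _ (fun _ _ => ?c) => apply lbdd_cst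
  | |- lbdd _ (fun t y => @GRing.add _ (@?f t y) (@?g t y)) => apply (@lbddD _ _ f g); lbrec
  | |- lbdd _ (fun t y => @GRing.opp _ (@?f t y)) => apply (@lbddN _ _ f); lbrec
  | |- lbdd _ (fun t y => @GRing.mul _ (@?f t y) (@?g t y)) => apply (@lbddM _ _ f g); lbrec
  | |- lbdd _ (fun t y => @GRing.exp _ (@?f t y) ?n) => apply (@lbddX _ _ f n); lbrec
  | _ => lbleaf
  end.

Ltac ldleaf := fail.
Ltac ldrec :=
  match goal with
  | |- ldec _ (fun t y => @GRing.add _ (@?f t y) (@?g t y)) => apply (@ldecD _ _ f g); ldrec
  | |- ldec _ (fun t y => @GRing.opp _ (@?f t y)) => apply (@ldecN _ _ f); ldrec
  | |- ldec _ (fun t y => @GRing.mul _ (@?f t y) (@?g t y)) =>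
      first [ apply (@ldecMr _ _ f g); [solve [ldrec] | solve [lbrec]]
            | apply (@ldecMl _ _ f g); [solve [lbrec] | solve [ldrec]] ]
  | |- ldec _ (fun t y => @GRing.exp _ (@?f t y) ?n) =>
      apply (@ldecX _ _ f n); [exact isT | ldrec]
  | _ => ldleaf
  end.

Section Conservation.
Context {R : realType}.
Local Notation mu := (@lebesgue_measure R).

Lemma derive_Rint_flux (t0 : R) (e et F fx r : R -> R -> R) :
  (forall t, cont (e t)) -> (forall t x, isD (e ^~ x) t (et t x)) ->
  ldec t0 e -> ldec t0 et ->
  (forall x, isD (F t0) x (fx t0 x)) -> cont (fx t0) -> cont (r t0) ->
  ldec t0 F -> ldec t0 fx -> ldec t0 r ->
  (forall x, et t0 x = fx t0 x + r t0 x) ->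
  isD (fun t => \int[mu]_x e t x) t0 (\int[mu]_x r t0 x).
Proof.
move=> ce de le let_ dF cfx cr lF lfx lr E.
apply: isD_eq; first exact: (derive_Rint ce de le let_).
have -> : et t0 = (fun x => fx t0 x + r t0 x) by apply/funext.
have [C1 h1] := ldec_at lF; have [C2 h2] := ldec_at lfx; have [C3 h3] := ldec_at lr.
rewrite RintegralD//; last 2 first.
- exact: (intg_lordom (m := 0) (l := 1) _ cfx h2).
- exact: (intg_lordom (m := 0) (l := 1) _ cr h3).
rewrite (@Rint_derive0 _ _ (F t0) (Num.max C1 C2)) ?add0r//.
- move=> x; apply: (le_trans (h2 x)).
  by rewrite ler_wpM2r ?lor_ge0// le_max lexx orbT.
- move=> x; apply: (le_trans (h1 x)).
  by rewrite ler_wpM2r ?lor_ge0// le_max lexx.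
Qed.

End Conservation.

Section MeanValue.
Context {R : realType}.

Lemma isD_incr_le (g dg : R -> R) (a b C : R) : a <= b -> (forall t, isD g t (dg t)) ->
  (forall t, a <= t <= b -> dg t <= C) -> g b - g a <= C * (b - a).
Proof.
move=> ab dgt h; have cg : continuous g := is_derive_continuous dgt.
have [||c + ->] := @MVT_segment R g dg a b ab.
- by move=> x _; exact: dgt.
- exact: continuous_subspaceT.
by rewrite in_itv /= => /h hc; rewrite ler_wpM2r ?subr_ge0.
Qed.

Lemma gronwall (Z dZ : R -> R) (t : R) : 0 <= t -> (forall t, isD Z t (dZ t)) ->
  (forall t, dZ t <= Z t) -> Z t <= expR t * Z 0.
Proof.
move=> t0 dz h.
have dg s : isD (fun s => expR (- s) * Z s) s (expR (- s) * (dZ s - Z s)).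
  apply: isD_eq; first exact: isD_mul (isD_expR (isD_opp (isD_id s))) (dz s).
  by rewrite mulN1r; ring.
have := @isD_incr_le _ _ 0 t 0 t0 dg; rewrite mul0r oppr0 expR0 mul1r subr_le0.
move=> H; have {}H := H (fun s _ => mulr_ge0_le0 (expR_ge0 _) _).
have -> : Z t = expR t * (expR (- t) * Z t).
  by rewrite mulrA -expRD subrr expR0 mul1r.
rewrite ler_wpM2l ?expR_ge0//; apply: H => s.
by rewrite subr_le0.
Qed.

Lemma lor_shift (x s M : R) : `|s| <= M -> lor 0 1 (x + s) <= 2 * (1 + M ^+ 2) * lor 0 1 x.
Proof.
move=> sM; rewrite !lor01.
have s2 : s ^+ 2 <= M ^+ 2 by rewrite -real_normK ?num_real// ler_pXn2r ?nnegrE// (le_trans _ sM).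
have h1 : 0 < 1 + x ^+ 2 by rewrite ltr_wpDr ?sqr_ge0.
have h2 : 0 < 1 + (x + s) ^+ 2 by rewrite ltr_wpDr ?sqr_ge0.
rewrite ler_pdivlMr// mulrC ler_pdivrMr//.
set y := x + s in h2 *; have -> : x = y - s by rewrite /y addrK.
have y2 : 0 <= y ^+ 2 by rewrite sqr_ge0.
have s0 := sqr_ge0 s; have := sqr_ge0 (y + s); nra.
Qed.

Lemma lbdd_shift (b : R -> R) (C v t0 : R) : (forall z, `|b z| <= C) ->
  lbdd t0 (fun t x => b (x + v * t)).
Proof. by move=> h; exists C; near=> t => x; exact: h. Unshelve. end_near. Qed.

Lemma lbdd_cos (f : R -> R -> R) t0 : lbdd t0 (fun t x => cos (f t x)).
Proof. by exists 1; near=> t => x; rewrite ler_norml cos_geN1 cos_le1. Unshelve. end_near. Qed.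

Lemma lbdd_sin (f : R -> R -> R) t0 : lbdd t0 (fun t x => sin (f t x)).
Proof. by exists 1; near=> t => x; rewrite ler_norml sin_geN1 sin_le1. Unshelve. end_near. Qed.

Lemma lbdd_time (t0 : R) : lbdd t0 (fun t _ => t).
Proof.
exists (`|t0| + 1); have := nbhsx_ballx t0 _ (@ltr01 R); apply: filterS => t.
rewrite -ball_normE /= => tt _; rewrite -[t](subrK t0) (le_trans (ler_normD _ _))//.
by rewrite addrC lerD2l distrC ltW.
Qed.

Lemma ldec_shift (b : R -> R) (C v t0 : R) : (forall z, `|b z| <= C * lor 0 1 z) ->
  ldec t0 (fun t x => b (x + v * t)).
Proof.
move=> h; exists (C * (2 * (1 + (`|v| * (`|t0| + 1)) ^+ 2))).
have C0 : 0 <= C by have := le_trans (normr_ge0 _) (h 0); rewrite pmulr_lge0 ?lor_gt0.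
have := nbhsx_ballx t0 _ (@ltr01 R); apply: filterS => t; rewrite -ball_normE /= => tt x.
apply: (le_trans (h _)); rewrite -mulrA ler_wpM2l//; apply: lor_shift.
rewrite normrM ler_wpM2l// -[t](subrK t0) (le_trans (ler_normD _ _))// addrC lerD2l.
by rewrite distrC ltW.
Qed.

End MeanValue.

(** * Energy and phase of a solution *)

Section Solution.
Context {R : realType}.
Local Notation mu := (@lebesgue_measure R).
Variables (u : R -> schwartz R) (D : nat -> R -> schwartz R).
Hypothesis D0 : D 0%N = u.
Hypothesis DS : forall j t, is_schwartz_derive (D j) t (D j.+1 t).
Hypothesis nls : forall t x,
  - 'i%C * cderiven 1 (fun t' => u t' x) t + cderiven 2 (u t) x
    = (normc (u t x) ^+ 2)%:C * u t x.

Local Notation p := (fun t x => sre 0 (u t) x).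
Local Notation q := (fun t x => sim 0 (u t) x).

Let du t : is_schwartz_derive u t (D 1%N t). Proof. by rewrite -D0. Qed.

Let dtre n x t : isD (fun t => sre n (u t) x) t (sre n (D 1%N t) x).
Proof. exact: path_derive_sre. Qed.
Let dtim n x t : isD (fun t => sim n (u t) x) t (sim n (D 1%N t) x).
Proof. exact: path_derive_sim. Qed.
Let dxre n (v : schwartz R) x : isD (fun x => sre n v x) x (sre n.+1 v x). Proof. exact: derf_sre. Qed.
Let dxim n (v : schwartz R) x : isD (fun x => sim n v x) x (sim n.+1 v x). Proof. exact: derf_sim. Qed.
Let cre n (v : schwartz R) : cont (fun x => sre n v x).
Proof. exact: derf_cont (@derf_sre R n v). Qed.
Let cim n (v : schwartz R) : cont (fun x => sim n v x).
Proof. exact: derf_cont (@derf_sim R n v). Qed.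
Let ldre n t0 : ldec t0 (fun t x => sre n (u t) x). Proof. exact: path_ldec_sre. Qed.
Let ldim n t0 : ldec t0 (fun t x => sim n (u t) x). Proof. exact: path_ldec_sim. Qed.
Let ldre1 n t0 : ldec t0 (fun t x => sre n (D 1%N t) x).
Proof. exact: (path_ldec_sre (DS 1%N t0) n). Qed.
Let ldim1 n t0 : ldec t0 (fun t x => sim n (D 1%N t) x).
Proof. exact: (path_ldec_sim (DS 1%N t0) n). Qed.

(* Abstracting the atoms keeps ring and lra from comparing them up to conversion. *)
Ltac genatoms := repeat match goal with
  | |- context [sre ?n ?v ?x] => generalize (sre n v x); intro
  | |- context [sim ?n ?v ?x] => generalize (sim n v x); intro
  end.

Lemma nls_re_im t x :
  sre 0 (D 1%N t) x = sim 2 (u t) x - (sre 0 (u t) x ^+ 2 + sim 0 (u t) x ^+ 2) * sim 0 (u t) x /\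
  sim 0 (D 1%N t) x = (sre 0 (u t) x ^+ 2 + sim 0 (u t) x ^+ 2) * sre 0 (u t) x - sre 2 (u t) x.
Proof.
have E : cderiven 1 (fun t' => u t' x) t = sre 0 (D 1%N t) x +i* sim 0 (D 1%N t) x.
  rewrite /cderiven !derive1nS !derive1E /=; congr (_ +i* _).
    by have [_ <-] := dtre 0 x t.
  by have [_ <-] := dtim 0 x t.
have := nls t x; rewrite E; set a := sre 0 (D 1%N t) x; set b := sim 0 (D 1%N t) x.
have -> : normc (u t x) ^+ 2 = sre 0 (u t) x ^+ 2 + sim 0 (u t) x ^+ 2.
  rewrite /sre /sim /cderiven /=; case: (u t x) => c d /=.
  by rewrite sqr_sqrtr// addr_ge0 ?sqr_ge0.
have -> : u t x = sre 0 (u t) x +i* sim 0 (u t) x.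
  by rewrite /sre /sim /cderiven /=; case: (u t x).
have -> : cderiven 2 (u t) x = sre 2 (u t) x +i* sim 2 (u t) x.
  by rewrite /sre /sim; case: (cderiven _ _ _).
by clearbody a b; genatoms; case=> h1 h2; split; lra.
Qed.

Ltac ldhook := fail.
Ltac lbhook := fail.
Ltac dleaf ::=
  match goal with
  | |- isD (fun t => sre _ (_ t) _) _ _ => apply dtre
  | |- isD (fun t => sim _ (_ t) _) _ _ => apply dtim
  | |- isD (fun x => sre _ _ x) _ _ => apply dxre
  | |- isD (fun x => sim _ _ x) _ _ => apply dxim
  | |- isD (fun y => ?b (@?g y)) _ _ => eapply (@isD_comp _ b g); [drec | solve [eauto]]
  end.
Ltac cleaf ::=
  match goal with
  | |- cont (fun x => sre _ _ x) => apply cre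
  | |- cont (fun x => sim _ _ x) => apply cim
  | |- cont (fun y => ?b (@?g y)) => apply (@cont_comp _ b g); [solve [eauto] | crec]
  end.
Ltac ldleaf ::=
  match goal with
  | |- ldec _ (fun t x => sre _ (u t) x) => apply ldre
  | |- ldec _ (fun t x => sim _ (u t) x) => apply ldim
  | |- ldec _ (fun t x => sre _ (_ t) x) => apply ldre1
  | |- ldec _ (fun t x => sim _ (_ t) x) => apply ldim1
  | |- ldec _ (fun t x => ?b (@?g t x)) => ldhook
  end.
Ltac lbleaf ::=
  match goal with
  | |- lbdd _ (fun t _ => t) => apply lbdd_time
  | |- lbdd _ (fun t x => cos (@?f t x)) => apply (@lbdd_cos _ f)
  | |- lbdd _ (fun t x => sin (@?f t x)) => apply (@lbdd_sin _ f)
  | |- lbdd _ (fun t x => sre _ _ x) => apply ldec_lbdd; ldleaf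
  | |- lbdd _ (fun t x => sim _ _ x) => apply ldec_lbdd; ldleaf
  | _ => first [lbhook | apply ldec_lbdd; ldhook]
  end.

Section Energy.
Variables (N c C : R) (b db : R -> R).
Hypotheses (Hb : forall z, isD b z (db z)) (cdb : cont db)
  (bC : forall z, `|b z| <= C * lor 0 1 z) (dbC : forall z, 2 * db z ^+ 2 <= c).

(* Twice the energy of the solution seen in the frame moving with velocity
   -2N, with the quartic term centred at the profile b, plus c times the mass. *)
Definition endens t x :=
  2 * ((sre 1 (u t) x + N * sim 0 (u t) x) ^+ 2 + (sim 1 (u t) x - N * sre 0 (u t) x) ^+ 2)
  + (sre 0 (u t) x ^+ 2 + sim 0 (u t) x ^+ 2 - b (x + 2 * N * t)) ^+ 2
  + c * (sre 0 (u t) x ^+ 2 + sim 0 (u t) x ^+ 2).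

Let r t x := 4 * (sre 0 (u t) x * (sim 1 (u t) x - N * sre 0 (u t) x)
  - sim 0 (u t) x * (sre 1 (u t) x + N * sim 0 (u t) x)) * db (x + 2 * N * t).

Let F t x :=
  2 * (2 * (sre 0 (D 1%N t) x * (sre 1 (u t) x + N * sim 0 (u t) x)
            + sim 0 (D 1%N t) x * (sim 1 (u t) x - N * sre 0 (u t) x))
       - 2 * N * ((sre 1 (u t) x + N * sim 0 (u t) x) ^+ 2
                  + (sim 1 (u t) x - N * sre 0 (u t) x) ^+ 2)
       + N * (sre 0 (u t) x ^+ 2 + sim 0 (u t) x ^+ 2) ^+ 2
       - 2 * N ^+ 2 * (sre 0 (u t) x * (sim 1 (u t) x - N * sre 0 (u t) x)
                      - sim 0 (u t) x * (sre 1 (u t) x + N * sim 0 (u t) x)))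
  - 2 * (2 * (sre 0 (u t) x * (sim 1 (u t) x - N * sre 0 (u t) x)
              - sim 0 (u t) x * (sre 1 (u t) x + N * sim 0 (u t) x))
         + 2 * N * (sre 0 (u t) x ^+ 2 + sim 0 (u t) x ^+ 2)) * b (x + 2 * N * t)
  + 2 * N * b (x + 2 * N * t) ^+ 2
  + 2 * c * (sre 0 (u t) x * sim 1 (u t) x - sim 0 (u t) x * sre 1 (u t) x).

Let cb : cont b. Proof. exact: derf_cont Hb. Qed.

Lemma endens_cont t : cont (endens t).
Proof. rewrite /endens; crec. Qed.

Let ldb t0 : ldec t0 (fun t x => b (x + 2 * N * t)).
Proof. exact: ldec_shift bC. Qed.

Let lddb t0 : lbdd t0 (fun t x => db (x + 2 * N * t)).
Proof.
apply: (@lbdd_shift _ _ (1 + c)) => z; have := dbC z.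
by rewrite ler_norml; nra.
Qed.

Ltac ldhook ::= match goal with
  |- ldec _ (fun t x => ?f (@?g t x)) => constr_eq f b; apply ldb end.
Ltac lbhook ::= match goal with
  |- lbdd _ (fun t x => ?f (@?g t x)) => constr_eq f db; apply lddb end.

Lemma endens_ldec t0 : ldec t0 endens.
Proof. rewrite /endens; ldrec. Qed.

Let energy_derive t0 : isD (fun t => \int[mu]_x endens t x) t0 (\int[mu]_x r t0 x).
Proof.
evar (et : R -> R -> R); evar (fx : R -> R -> R).
have H1 : forall t x, isD (endens ^~ x) t (et t x).
  move=> t x; rewrite /endens /et; drec.
have H2 : forall t x, isD (F t) x (fx t x).
  move=> t x; rewrite /F /fx; drec.
apply: (derive_Rint_flux (et := et) (F := F) (fx := fx) (r := r)).
- exact: endens_cont.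
- exact: H1.
- exact: endens_ldec.
- rewrite /et; ldrec.
- exact: H2.
- rewrite /fx; crec.
- rewrite /r; crec.
- rewrite /F; ldrec.
- rewrite /fx; ldrec.
- rewrite /r; ldrec.
move=> x; rewrite /et /fx /r; have [] := nls_re_im t0 x.
by genatoms => -> ->; ring.
Qed.

Lemma endens_ge0 t x : 0 <= c -> 0 <= endens t x.
Proof.
move=> c0; have h y z : 0 <= y ^+ 2 + z ^+ 2 :> R by rewrite addr_ge0 ?sqr_ge0.
by rewrite /endens addr_ge0// ?mulr_ge0// addr_ge0 ?sqr_ge0// mulr_ge0.
Qed.

Let flux_le (P Q a d db' s : R) : 2 * db' ^+ 2 <= c ->
  4 * (P * d - Q * a) * db' <= 2 * (a ^+ 2 + d ^+ 2) + s ^+ 2 + c * (P ^+ 2 + Q ^+ 2).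
Proof.
move=> hc; have h1 := sqr_ge0 (d - P * db'); have h2 := sqr_ge0 (a + Q * db').
have h3 := sqr_ge0 s.
have h4 : 2 * db' ^+ 2 * (P ^+ 2 + Q ^+ 2) <= c * (P ^+ 2 + Q ^+ 2).
  by rewrite ler_wpM2r// addr_ge0 ?sqr_ge0.
lra.
Qed.

Lemma intg_endens t : intg (endens t).
Proof.
have [C' h] := ldec_at (endens_ldec t).
exact: (intg_lordom (m := 0) (l := 1) _ (@endens_cont t) h).
Qed.

Lemma energy_gronwall t : 0 <= t ->
  \int[mu]_x endens t x <= expR t * \int[mu]_x endens 0 x.
Proof.
move=> t0; apply: (gronwall t0 energy_derive) => s.
have [|C' h] := @ldec_at _ s r; first by rewrite /r; ldrec.
apply: le_Rint.
- apply: (intg_lordom (m := 0) (l := 1) _ _ h) => //.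
  by rewrite -/(cont (r s)) /r; crec.
- exact: intg_endens.
by move=> x; apply: flux_le; exact: dbC.
Qed.

Section Phase.
Variables (T theta CG M L K : R) (G dG ddG ddb : R -> R).
Hypotheses (HG : forall z, isD G z (dG z)) (HdG : forall z, isD dG z (ddG z))
  (Hdb : forall z, isD db z (ddb z)) (cddG : cont ddG) (cddb : cont ddb)
  (GC : forall z, `|G z| <= CG) (dGC : forall z, `|dG z| <= CG)
  (ddGC : forall z, `|ddG z| <= CG) (ddbC : forall z, `|ddb z| <= CG)
  (T0 : 0 <= T) (L0 : 0 < L) (K0 : 0 < K) (cK : 1 <= c * K ^+ 2)
  (G1 : forall z, G z ^+ 2 <= 1)
  (AB : forall tau z : R, - T <= tau <= 0 ->
     (ddG z - tau ^+ 2 * db z ^+ 2 * G z) ^+ 2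
     + (2 * tau * db z * dG z + tau * ddb z * G z) ^+ 2 <= M * lor 0 L z).

Let Theta t x := N * x + N ^+ 2 * t + theta + b (x + 2 * N * t) * (t - T).

(* Real part of u times the test function G exp(-i Theta). *)
Definition phdens t x := G (x + 2 * N * t) *
  (sre 0 (u t) x * cos (N * x + N ^+ 2 * t + theta + b (x + 2 * N * t) * (t - T))
   + sim 0 (u t) x * sin (N * x + N ^+ 2 * t + theta + b (x + 2 * N * t) * (t - T))).

Let X t x := sre 0 (u t) x * cos (Theta t x) + sim 0 (u t) x * sin (Theta t x).
Let Y t x := sim 0 (u t) x * cos (Theta t x) - sre 0 (u t) x * sin (Theta t x).

Let rr t x :=
  - ((sre 0 (u t) x ^+ 2 + sim 0 (u t) x ^+ 2 - b (x + 2 * N * t))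
     * G (x + 2 * N * t) * Y t x)
  + (Y t x * (ddG (x + 2 * N * t) - (t - T) ^+ 2 * db (x + 2 * N * t) ^+ 2 * G (x + 2 * N * t))
     - X t x * (2 * (t - T) * db (x + 2 * N * t) * dG (x + 2 * N * t)
                + (t - T) * ddb (x + 2 * N * t) * G (x + 2 * N * t))).

Let FF t x :=
  G (x + 2 * N * t) * (sim 1 (u t) x * cos (Theta t x) - sre 1 (u t) x * sin (Theta t x))
  - Y t x * dG (x + 2 * N * t)
  + X t x * G (x + 2 * N * t) * (N + (t - T) * db (x + 2 * N * t)).

Let cG : cont G. Proof. exact: derf_cont HG. Qed.
Let cdG : cont dG. Proof. exact: derf_cont HdG. Qed.
Let lbs (f : R -> R) (C' t0 : R) : (forall z, `|f z| <= C') -> lbdd t0 (fun t x => f (x + 2 * N * t)).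
Proof. exact: lbdd_shift. Qed.

Ltac lbhook ::= match goal with
  |- lbdd _ (fun t x => ?f (@?g t x)) =>
     first [ constr_eq f db; apply lddb | constr_eq f G; apply (lbs _ GC)
     | constr_eq f dG; apply (lbs _ dGC) | constr_eq f ddG; apply (lbs _ ddGC)
     | constr_eq f ddb; apply (lbs _ ddbC) ] end.

Lemma phdens_cont t : cont (phdens t).
Proof. rewrite /phdens; crec. Qed.

Lemma phdens_ldec t0 : ldec t0 phdens.
Proof. rewrite /phdens; ldrec. Qed.

Let phase_derive t0 : isD (fun t => \int[mu]_x phdens t x) t0 (\int[mu]_x rr t0 x).
Proof.
evar (et : R -> R -> R); evar (fx : R -> R -> R).
have H1 : forall t x, isD (phdens ^~ x) t (et t x).
  move=> t x; rewrite /phdens /et; drec.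
have H2 : forall t x, isD (FF t) x (fx t x).
  move=> t x; rewrite /FF /X /Y /Theta /fx; drec.
apply: (derive_Rint_flux (et := et) (F := FF) (fx := fx) (r := rr)).
- exact: phdens_cont.
- exact: H1.
- exact: phdens_ldec.
- rewrite /et; ldrec.
- exact: H2.
- rewrite /fx; crec.
- rewrite /rr /X /Y /Theta; crec.
- rewrite /FF /X /Y /Theta; ldrec.
- rewrite /fx; ldrec.
- rewrite /rr /X /Y /Theta; ldrec.
move=> x; rewrite /et /fx /rr /X /Y /Theta; have [] := nls_re_im t0 x.
genatoms => e1 e2; rewrite e1 e2; ring.
Qed.

Let r_le (C0 S P Q s g A' B' : R) : C0 ^+ 2 + S ^+ 2 = 1 -> g ^+ 2 <= 1 ->
  `|- (s * g * (Q * C0 - P * S)) + ((Q * C0 - P * S) * A' - (P * C0 + Q * S) * B')|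
  <= K * (s ^+ 2 + c * (P ^+ 2 + Q ^+ 2)) + K / 2 * (A' ^+ 2 + B' ^+ 2).
Proof.
move=> CS g1; set y := Q * C0 - _; set x := P * C0 + _.
have xy : x ^+ 2 + y ^+ 2 = P ^+ 2 + Q ^+ 2.
  by rewrite -[RHS]mulr1 -CS /x /y; ring.
have x0 : 0 <= x ^+ 2 := sqr_ge0 x; have y0 : 0 <= y ^+ 2 := sqr_ge0 y.
have KV : K * K^-1 = 1 by rewrite divff// gt_eqF.
have kv0 : 0 < K^-1 by rewrite invr_gt0.
rewrite -xy; clearbody x y.
(* AM-GM: 2 |s g y| <= K s^2 + y^2 / K, and similarly for y A' and x B' *)
have h (v w : R) : 2 * `|v * w| <= K * v ^+ 2 + K^-1 * w ^+ 2.
  have -> : K * v ^+ 2 + K^-1 * w ^+ 2 = K^-1 * ((K * v) ^+ 2 + w ^+ 2).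
    by field; rewrite gt_eqF.
  rewrite ler_pdivlMl// mulrCA -{1}(ger0_norm (ltW K0)) -normrM mulrA.
  have := sqr_ge0 (`|K * v| - `|w|); rewrite sqrrB !real_normK ?num_real//.
  by rewrite normrM -mulr_natl => ?; lra.
have h1 := h s (g * y); have h2 := h A' y; have h3 := h B' x.
have gy : K^-1 * (g * y) ^+ 2 <= K^-1 * y ^+ 2.
  by rewrite ler_pM2l// exprMn ler_piMl.
have cx : K^-1 * (x ^+ 2 + y ^+ 2) <= K * (c * (x ^+ 2 + y ^+ 2)).
  rewrite mulrA ler_wpM2r ?addr_ge0// -[leLHS]mul1r ler_pdivrMr//.
  by rewrite mulrAC -expr2 mulrC.
have t1 := ler_normD (- (s * g * y)) (y * A' - x * B').
have t2 := ler_normB (y * A') (x * B').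
rewrite normrN -(mulrA s) in t1; rewrite (mulrC y) (mulrC x) in t2.
have kx : 0 <= K^-1 * x ^+ 2 by rewrite mulr_ge0 ?(ltW kv0).
have ks : 0 <= K * s ^+ 2 by rewrite mulr_ge0 ?(ltW K0) ?sqr_ge0.
have ky : 0 <= K^-1 * y ^+ 2 by rewrite mulr_ge0 ?(ltW kv0).
rewrite -(mulrA s) (mulrC y) (mulrC x) in t1 *.
lra.
Qed.

Lemma phase_lower :
  (\int[mu]_x phdens 0 x) - T * (K * (expR T * (\int[mu]_x endens 0 x)) + K / 2 * (M * (pi * L)))
  <= \int[mu]_x phdens T x.
Proof.
set J := K * _ + _.
have J0 t : isD (fun t => - \int[mu]_x phdens t x) t (- \int[mu]_x rr t x).
  exact: isD_opp.
have c0 : 0 <= c by apply: le_trans (dbC 0); rewrite mulr_ge0 ?sqr_ge0.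
have := @isD_incr_le _ _ _ 0 T J T0 J0; rewrite subr0 => H.
suff : forall t : R, 0 <= t <= T -> - (\int[mu]_x rr t x) <= J by move=> h; have := H h; lra.
move=> t /andP[t0 tT]; have [|C' h] := @ldec_at _ t rr.
  by rewrite /rr /X /Y /Theta; ldrec.
have ir : intg (rr t).
  apply: (intg_lordom (m := 0) (l := 1) _ _ h) => //.
  by rewrite -/(cont (rr t)) /rr /X /Y /Theta; crec.
have il := intg_lor (- (2 * N * t)) L0.
have ie := intg_endens t.
rewrite -[leLHS]mulN1r -(RintegralZl _ measurableT ir).
have -> : J = K * expR T * (\int[mu]_x endens 0 x) + K / 2 * (M * (pi * L)).
  by rewrite /J mulrA.
apply: (@le_trans _ _ (K * (\int[mu]_x endens t x) + K / 2 * (M * (pi * L)))); last first.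
  rewrite lerD2r -mulrA ler_wpM2l ?(ltW K0)//; apply: le_trans (energy_gronwall t0) _.
  by rewrite ler_wpM2r ?ler_expR//; apply: Rintegral_ge0 => x _; exact: endens_ge0.
rewrite -(Rint_lor (- (2 * N * t)) L0) -(RintegralZl _ measurableT ie).
rewrite -(RintegralZl _ measurableT il) -(RintegralZl _ measurableT (intgZ M il)).
rewrite -(RintegralD measurableT (intgZ _ ie) (intgZ _ (intgZ _ il))).
apply: le_Rint; first exact: intgZ.
  exact: intgD (intgZ _ ie) (intgZ _ (intgZ _ il)).
move=> x; rewrite mulN1r; apply: le_trans (ler_norm _) _; rewrite normrN.
apply: le_trans (@r_le _ _ _ _ _ _ _ _ (cos2Dsin2 (Theta t x)) (G1 _)) _.
apply: lerD.
  rewrite ler_wpM2l ?(ltW K0)// /endens -[leRHS]addrA lerDr.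
  by rewrite mulr_ge0// addr_ge0 ?sqr_ge0.
rewrite ler_wpM2l ?divr_ge0 ?(ltW K0)//.
have -> : lor (- (2 * N * t)) L x = lor 0 L (x + 2 * N * t) by rewrite /lor opprK subr0.
by apply: AB; lra.
Qed.

End Phase.

End Energy.

End Solution.

(** * Sobolev norms and the Fourier transform *)

Section L2Norm.
Context {R : realType}.
Local Notation mu := (@lebesgue_measure R).

Lemma Lnorm2_le (f : R -> R) (B : R) : 0 <= B ->
  intg (fun x => f x ^+ 2) -> \int[mu]_x (f x ^+ 2) <= B ^+ 2 ->
  (Lnorm mu 2%:E (fun x => (f x)%:E) <= B%:E)%E.
Proof.
move=> B0 if2 h.
have E : (\int[mu]_x (`|(f x)%:E| `^ 2) = (\int[mu]_x (f x ^+ 2))%:E)%E.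
  rewrite /Rintegral fineK; last exact: integrable_fin_num.
  apply: eq_integral => x _; rewrite /= ?poweR_EFin powR_mulrn//.
  by rewrite real_normK ?num_real.
have -> : B = (B `^ 2) `^ 2^-1 by rewrite -powRrM divff// powRr1.
rewrite unlock E poweR_EFin lee_fin; apply: ge0_ler_powR; rewrite ?nnegrE ?invr_ge0//.
- by apply: Rintegral_ge0 => x _; exact: sqr_ge0.
- by rewrite powR_ge0.
- by rewrite powR_mulrn.
Qed.

Lemma Rintegral_hoelder2 (f g v : R -> R) : measurable_fun setT f ->
  measurable_fun setT g -> measurable_fun setT v ->
  (forall x, `|v x| <= `|f x * g x|) ->
  (`|\int[mu]_x v x|%:E <= Lnorm mu 2%:E (fun x => (f x)%:E) *
     Lnorm mu 2%:E (fun x => (g x)%:E))%E.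
Proof.
move=> mf mg mv h.
have e2 : 2^-1 + 2^-1 = 1 :> R by field.
have H := @hoelder _ _ _ mu f g 2 2 mf mg (ltr0Sn _ _) (ltr0Sn _ _) e2.
apply: le_trans H.
rewrite Lnorm1; apply: (@le_trans _ _ (\int[mu]_x `|(v x)%:E|)%E).
  apply: le_trans (le_abse_integral mu measurableT _); last exact/measurable_EFinP.
  rewrite /Rintegral; case: (\int[mu]_x (v x)%:E)%E => [r| |] //=.
  - by rewrite normr0 leey.
  - by rewrite normr0 leey.
apply: ge0_le_integral => //.
- by apply: measurableT_comp => //; exact/measurable_EFinP.
- apply: measurableT_comp => //; apply/measurable_EFinP.
  exact: measurable_funM.
- by move=> x _ /=; rewrite lee_fin.
Qed.

End L2Norm.

Section Duality.
Context {R : realType}.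
Local Notation mu := (@lebesgue_measure R).
Implicit Types (s B : R) (T : schwartz R -> R[i]).

Lemma ReM_le (a b : R[i]) : `|complex.Re (a * b)| <= normc a * normc b.
Proof. by rewrite -normcM Re_le_normc. Qed.

Lemma weight_powR_gt0 (x s : R) : 0 < (1 + x ^+ 2) `^ s.
Proof. by rewrite powR_gt0// ltr_wpDr ?sqr_ge0. Qed.

Lemma measurable_weight (s : R) : measurable_fun setT (fun x : R => (1 + x ^+ 2) `^ s).
Proof.
apply: (@measurableT_comp _ _ _ _ _ _ (fun y : R => y `^ s)).
  exact: measurable_powR.
by apply: continuous_mfun; apply: contD; [exact: (contC 1)|exact/contX/contid].
Qed.

Lemma measurable_normc (g : R -> R[i]) : cmeasurable g ->
  measurable_fun setT (fun x => normc (g x)).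
Proof.
move=> [m1 m2]; rewrite (_ : (fun x => normc (g x)) = (fun y => Num.sqrt y) \o
   (fun x => complex.Re (g x) ^+ 2 + complex.Im (g x) ^+ 2)); last first.
  by apply/funext => x /=; case: (g x).
apply: measurableT_comp; first by apply: continuous_mfun; exact: sqrt_continuous.
by apply: measurable_funD; apply: measurable_funX.
Qed.

Lemma sobolev_norm_ge s T (phi psi : schwartz R) B :
  (psi : R -> R[i]) = fourier phi -> 0 < B ->
  (Lnorm mu 2%:E (fun x => ((1 + x ^+ 2) `^ (- (s / 2)) * normc (phi x))%:E) <= B%:E)%E ->
  ((complex.Re (T psi) / B)%:E <= sobolev_norm s T)%E.
Proof.
move=> psiE B0 hB; apply: le_ereal_inf_tmp => _ [g [mg Tg] <-].
rewrite (Tg _ _ psiE) EFinM lee_pdivrMr//.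
apply: (@le_trans _ _ (`|\int[mu]_x complex.Re (g x * phi x)|)%:E).
  by rewrite lee_fin ler_norm.
apply: le_trans (lee_wpmul2l _ hB); last exact: Lnorm_ge0.
have mphi : cmeasurable (phi : R -> R[i]).
  split.
    rewrite (_ : _ \o _ = sre 0 phi)//; apply: continuous_mfun.
    exact: derf_cont (@derf_sre R 0 phi).
  rewrite (_ : _ \o _ = sim 0 phi)//; apply: continuous_mfun.
  exact: derf_cont (@derf_sim R 0 phi).
apply: Rintegral_hoelder2.
- by apply: measurable_funM; [exact: measurable_weight|exact: measurable_normc].
- by apply: measurable_funM; [exact: measurable_weight|exact: measurable_normc].
- have [g1 g2] := mg; have [p1 p2] := mphi.
  rewrite (_ : (fun x => _) = (fun x => complex.Re (g x) * complex.Re (phi x)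
      - complex.Im (g x) * complex.Im (phi x))); last first.
    by apply/funext => x; case: (g x) (phi x) => [? ?] [].
  by apply: measurable_funB; exact: measurable_funM.
move=> x; apply: (le_trans (ReM_le _ _)).
rewrite mulrACA powRN divff ?gt_eqF ?weight_powR_gt0// mul1r.
exact: ler_norm.
Qed.

End Duality.

Section ComplexIntegral.
Context {R : realType}.
Local Notation mu := (@lebesgue_measure R).
Implicit Types (f g : R -> R[i]) (h phi psi : schwartz R).

Definition cintg f := intg (fun x => complex.Re (f x)) /\ intg (fun x => complex.Im (f x)).

Lemma cintegralM z f : cintg f -> z * cintegral f = cintegral (fun x => z * f x).
Proof.
move=> [i1 i2]; case: z => a b; rewrite /cintegral.
have -> : \int[mu]_x complex.Re ((a +i* b) * f x) =
    a * (\int[mu]_x complex.Re (f x)) - b * (\int[mu]_x complex.Im (f x)).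
  rewrite -(RintegralZl a measurableT i1) -(RintegralZl b measurableT i2).
  rewrite -(RintegralB measurableT (intgZ _ i1) (intgZ _ i2)).
  by apply: eq_Rintegral => x _; case: (f x).
have -> : \int[mu]_x complex.Im ((a +i* b) * f x) =
    a * (\int[mu]_x complex.Im (f x)) + b * (\int[mu]_x complex.Re (f x)).
  rewrite -(RintegralZl a measurableT i2) -(RintegralZl b measurableT i1).
  rewrite -(RintegralD measurableT (intgZ _ i2) (intgZ _ i1)).
  by apply: eq_Rintegral => x _; case: (f x) => c d /=; rewrite addrC.
by congr (_ +i* _); rewrite addrC.
Qed.

Lemma cintegralB f g : cintg f -> cintg g ->
  cintegral (fun x => f x - g x) = cintegral f - cintegral g.
Proof.
move=> [i1 i2] [j1 j2]; rewrite /cintegral.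
have -> : \int[mu]_x complex.Re (f x - g x) =
    (\int[mu]_x complex.Re (f x)) - (\int[mu]_x complex.Re (g x)).
  rewrite -(RintegralB measurableT i1 j1).
  by apply: eq_Rintegral => x _; case: (f x) (g x) => [? ?] [].
have -> // : \int[mu]_x complex.Im (f x - g x) =
    (\int[mu]_x complex.Im (f x)) - (\int[mu]_x complex.Im (g x)).
rewrite -(RintegralB measurableT i2 j2).
by apply: eq_Rintegral => x _; case: (f x) (g x) => [? ?] [].
Qed.

Lemma Rfubini (K : R * R -> R) C : measurable_fun setT K ->
  (forall x y, `|K (x, y)| <= C * lor 0 1 x * lor 0 1 y) ->
  \int[mu]_x (\int[mu]_y K (x, y)) = \int[mu]_y (\int[mu]_x K (x, y)).
Proof.
move=> mK hK.
have mE : measurable_fun setT (EFin \o K) by exact/measurable_EFinP.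
have sx x : mu.-integrable setT (fun y => (K (x, y))%:E).
  apply: (le_integrable measurableT _ _ (intgZ (C * lor 0 1 x) (intg_lor 0 (@ltr01 R)))).
    by apply/measurable_EFinP; exact: measurableT_comp mK (pair1_measurable _).
  by move=> y _; rewrite lee_fin; apply: le_trans (hK x y) (ler_norm _).
have sy y : mu.-integrable setT (fun x => (K (x, y))%:E).
  apply: (le_integrable measurableT _ _ (intgZ (C * lor 0 1 y) (intg_lor 0 (@ltr01 R)))).
    by apply/measurable_EFinP; exact: measurableT_comp mK (pair2_measurable _).
  move=> x _; rewrite lee_fin; apply: le_trans (hK x y) _.
  by rewrite mulrAC; exact: ler_norm.
have l1 : 0 < 1 :> R by [].
have iK : (mu \x mu)%E.-integrable setT (EFin \o K).
  apply/(integrable12ltyP mu mu mE).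
  apply: (@le_lt_trans _ _ (\int[mu]_x (C * pi * lor 0 1 x)%:E)%E); last first.
    have /(integrable_fin_num measurableT) := intgZ (C * pi) (intg_lor 0 l1).
    by rewrite fin_numElt => /andP[].
  have C0 : 0 <= C.
    have := le_trans (normr_ge0 _) (hK 0 0).
    by rewrite !pmulr_lge0 ?lor_gt0.
  apply: ge0_le_integral => //.
  - by move=> x _; apply: integral_ge0.
  - apply: (measurable_fun_fubini_tonelli_F (m2 := mu) (abse \o (EFin \o K))) => //=.
    exact: measurableT_comp.
  - apply/measurable_EFinP; apply: continuous_mfun.
    exact: (contM (contC (C * pi)) (@lor_continuous R 0 1)).
  move=> x _; apply: (@le_trans _ _ (\int[mu]_y (C * lor 0 1 x * lor 0 1 y)%:E)%E).
    apply: ge0_le_integral => //.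
    - by apply: measurableT_comp => //; apply/measurable_EFinP;
        exact: measurableT_comp mK (pair1_measurable _).
    - apply/measurable_EFinP; apply: continuous_mfun.
      exact: (contM (contC (C * lor 0 1 x)) (@lor_continuous R 0 1)).
    - by move=> y _; rewrite lee_fin.
  under eq_integral do rewrite EFinM.
  rewrite ge0_integralZl//; last 3 first.
  - by apply/measurable_EFinP; apply: continuous_mfun; exact: lor_continuous.
  - by move=> y _; rewrite lee_fin lor_ge0.
  - by rewrite lee_fin mulr_ge0// lor_ge0.
  by rewrite integral_lor// mulr1 -EFinM lee_fin mulrAC.
have F := Fubini iK.
rewrite /Rintegral; congr fine.
transitivity (\int[mu]_x \int[mu]_y (EFin \o K) (x, y))%E.
  by apply: eq_integral => x _; rewrite fineK//; exact: integrable_fin_num.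
rewrite F; apply: eq_integral => y _; rewrite fineK//; exact: integrable_fin_num.
Qed.

Lemma normc_nneg (z : R[i]) : 0 <= normc z.
Proof. by case: z => a b; exact: sqrtr_ge0. Qed.

Lemma normc_val_lor h : exists C, forall x, normc (h x) <= C * lor 0 1 x.
Proof.
have [C hC] := normc_lor 0 h; exists C => x; have := hC x.
by rewrite /cderiven /=; case: (h x).
Qed.

Lemma sre_val h x : sre 0 h x = complex.Re (h x). Proof. by []. Qed.
Lemma sim_val h x : sim 0 h x = complex.Im (h x). Proof. by []. Qed.

Lemma cont_Re h : cont (fun x => complex.Re (h x)).
Proof. exact: derf_cont (@derf_sre R 0 h). Qed.

Lemma cont_Im h : cont (fun x => complex.Im (h x)).
Proof. exact: derf_cont (@derf_sim R 0 h). Qed.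

Lemma cintg_mul h (g : R -> R[i]) : cont (fun x => complex.Re (g x)) ->
  cont (fun x => complex.Im (g x)) -> (exists C, forall x, normc (g x) <= C) ->
  cintg (fun x => h x * g x).
Proof.
move=> c1 c2 [C hC]; have [C' hC'] := normc_val_lor h.
have b x : normc (h x * g x) <= C' * C * lor 0 1 x.
  by rewrite normcM mulrAC ler_pM// ?normc_nneg.
have cr := @cont_Re h; have ci := @cont_Im h.
split.
- apply: (@intg_lordom _ _ (C' * C) 0 1) => //; last first.
    by move=> x; apply: le_trans (b x); exact: Re_le_normc.
  rewrite (_ : (fun x => _) = fun x => complex.Re (h x) * complex.Re (g x) -
    complex.Im (h x) * complex.Im (g x)); first exact: (contB (contM cr c1) (contM ci c2)).
  by apply/funext => x; case: (h x) (g x) => [? ?] [].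
- apply: (@intg_lordom _ _ (C' * C) 0 1) => //; last first.
    by move=> x; apply: le_trans (b x); exact: Im_le_normc.
  rewrite (_ : (fun x => _) = fun x => complex.Re (h x) * complex.Im (g x) +
    complex.Im (h x) * complex.Re (g x)); first exact: (contD (contM cr c2) (contM ci c1)).
  by apply/funext => x; case: (h x) (g x) => [? ?] [].
Qed.

Lemma cintg_schwartz h phi : cintg (fun x => h x * phi x).
Proof.
apply: cintg_mul; [exact: cont_Re|exact: cont_Im|].
have [C hC] := normc_val_lor phi; exists `|C| => x; apply: (le_trans (hC x)).
rewrite (le_trans (ler_norm _))// normrM ler_piMr// ger0_norm ?lor_ge0//.
exact: lor_le1.
Qed.

Lemma distrB (f g : schwartz R) : distr f - distr g = distr (f - g).
Proof.
apply/funext => phi; rewrite /distr !fctE -cintegralB; [|exact: cintg_schwartz..].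
by congr cintegral; apply/funext => x; rewrite /= mulrBl.
Qed.

Lemma le_normc (z : R[i]) : normc z <= `|complex.Re z| + `|complex.Im z|.
Proof.
case: z => a b /=; rewrite -[leRHS]ger0_norm ?addr_ge0// -sqrtr_sqr ler_sqrt ?sqr_ge0//.
rewrite sqrrD !real_normK ?num_real// -addrA lerD2l lerDr.
by rewrite mulrn_wge0// mulr_ge0.
Qed.

Lemma normc_cintegral_le f (g : R -> R) : cintg f -> intg g ->
  (forall x, normc (f x) <= g x) -> normc (cintegral f) <= 2 * \int[mu]_x g x.
Proof.
move=> [i1 i2] ig h; apply: (le_trans (le_normc _)); rewrite mulr_natl mulr2n /=.
apply: lerD; apply: (le_trans (le_normr_Rintegral measurableT _)) => //.
- apply: le_Rint => //; first exact: (integrable_norm i1).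
  by move=> x; apply: le_trans (h x); exact: Re_le_normc.
- apply: le_Rint => //; first exact: (integrable_norm i2).
  by move=> x; apply: le_trans (h x); exact: Im_le_normc.
Qed.

Lemma distr_tempered h : tempered (distr h).
Proof.
split=> [a phi psi|].
  rewrite /distr cintegralM; last exact: cintg_schwartz.
  have -> : (fun x => h x * (a *: phi + psi : schwartz R) x) =
    (fun x => (fun x => a * (h x * phi x)) x - (fun x => - (h x * psi x)) x).
    by apply/funext => x /=; rewrite mulrDr opprK mulrCA.
  have ci (b : R[i]) f : cintg f -> cintg (fun x => b * f x).
    case: b => b1 b2 [i1 i2]; split.
      rewrite (_ : (fun x => _) = fun x => b1 * complex.Re (f x) - b2 * complex.Im (f x)).
        exact: intgB (intgZ _ i1) (intgZ _ i2).
      by apply/funext => x; case: (f x).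
    rewrite (_ : (fun x => _) = fun x => b1 * complex.Im (f x) + b2 * complex.Re (f x)).
      exact: intgD (intgZ _ i2) (intgZ _ i1).
    by apply/funext => x; case: (f x).
  have E : (fun x => - (h x * psi x)) = (fun x => -1 * (h x * psi x)).
    by apply/funext => x; rewrite mulN1r.
  rewrite cintegralB; [|exact/ci/cintg_schwartz|rewrite E; exact/ci/cintg_schwartz].
  by rewrite E -(@cintegralM (-1)) ?mulN1r ?opprK//; exact: cintg_schwartz.
have [C hC] := normc_val_lor h; exists (2 * (C * pi)), 1%N => phi.
rewrite !big_ord1; have [_ fin] := schwartzP phi.
have s0 : (0 <= seminorm 0 0 phi)%E.
  apply: (@le_trans _ _ (`|0 : R| ^+ 0 * normc (cderiven 0 phi 0))%:E).
    by rewrite lee_fin mulr_ge0 ?normc_nneg.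
  by apply: ereal_sup_ubound; exists 0.
have := fin 0%N 0%N; case E : (seminorm 0 0 phi) s0 => [r| |] // _ _.
have hr x : normc (phi x) <= r.
  have := @seminorm_normc _ 0 0 phi x r; rewrite E lexx => /(_ isT).
  by rewrite mul1r /cderiven /=; case: (phi x).
have l1 : 0 < 1 :> R by [].
rewrite -EFinM lee_fin /distr.
apply: (le_trans (@normc_cintegral_le _ (fun x => C * r * lor 0 1 x) (cintg_schwartz _ _)
  (intgZ _ (intg_lor 0 l1)) _)).
  by move=> x; rewrite normcM mulrAC ler_pM// ?normc_nneg.
by rewrite (RintegralZl (C * r) measurableT (intg_lor 0 l1)) Rint_lor// mulr1; lra.
Qed.

End ComplexIntegral.

Section FourierSchwartz.
Context {R : realType}.
Local Notation mu := (@lebesgue_measure R).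
Implicit Types (h phi psi : schwartz R).

Lemma normc_cis (x : R) : normc (cis x) = 1.
Proof. by rewrite /normc /cis cos2Dsin2 sqrtr1. Qed.

Lemma cont_cisM (a : R) : cont (fun x => complex.Re (cis (- (x * a)))) /\
  cont (fun x => complex.Im (cis (- (x * a)))).
Proof.
have c : cont (fun x => - (x * a)) by apply: cont_opp; apply: cont_mul; [exact: cont_id|exact: cont_cst].
by split; [exact: (cont_comp (@cont_cos R) c)|exact: (cont_comp (@cont_sin R) c)].
Qed.

Lemma cintg_fourier h (xi : R) : cintg (fun x => cis (- (x * xi)) * h x).
Proof.
under eq_fun do rewrite mulrC.
have [c1 c2] := cont_cisM xi; apply: cintg_mul => //.
by exists 1 => x; rewrite normc_cis.
Qed.

Lemma fourier_distr_schwartz h : cmeasurable (fourier h) -> fourier_distr (distr h) (fourier h).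
Proof.
move=> mh; split=> // phi psi psiE; rewrite /distr psiE.
pose K z := h z.1 * (cis (- (z.2 * z.1)) * phi z.2).
have -> : (fun x => h x * fourier phi x) = fun x => cintegral (fun y => K (x, y)).
  by apply/funext => x; rewrite cintegralM//; exact: cintg_fourier.
have -> : (fun y => fourier h y * phi y) = fun y => cintegral (fun x => K (x, y)).
  apply/funext => y; rewrite mulrC cintegralM; last exact: cintg_fourier.
  by congr cintegral; apply/funext => x; rewrite /K /= [y * x]mulrC; ring.
have [C hC] := normc_val_lor h; have [C' hC'] := normc_val_lor phi.
have b x y : normc (K (x, y)) <= C * C' * lor 0 1 x * lor 0 1 y.
  rewrite !normcM normc_cis mul1r (_ : _ * _ * _ * _ = (C * lor 0 1 x) * (C' * lor 0 1 y)).
    by rewrite ler_pM ?normc_nneg.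
  ring.
have mfst (f : R -> R) : cont f -> measurable_fun setT (fun z : R * R => f z.1).
  by move=> cf; exact: measurableT_comp (continuous_mfun cf) measurable_fst.
have msnd (f : R -> R) : cont f -> measurable_fun setT (fun z : R * R => f z.2).
  by move=> cf; exact: measurableT_comp (continuous_mfun cf) measurable_snd.
have mprod (f : R -> R) : cont f -> measurable_fun setT (fun z : R * R => f (z.2 * z.1)).
  move=> cf; apply: measurableT_comp (continuous_mfun cf) _.
  exact: measurable_funM measurable_snd measurable_fst.
have cN : cont (fun y : R => - y) by apply: cont_opp; exact: cont_id.
have mc := mprod _ (cont_comp (@cont_cos R) cN).
have ms := mprod _ (cont_comp (@cont_sin R) cN).
have h1 := mfst _ (@cont_Re R h); have h2 := mfst _ (@cont_Im R h).
have f1 := msnd _ (@cont_Re R phi); have f2 := msnd _ (@cont_Im R phi).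
have mRe := measurable_funB (measurable_funM h1 (measurable_funB (measurable_funM mc f1)
  (measurable_funM ms f2))) (measurable_funM h2 (measurable_funD (measurable_funM mc f2)
  (measurable_funM ms f1))).
have mIm := measurable_funD (measurable_funM h1 (measurable_funD (measurable_funM mc f2)
  (measurable_funM ms f1))) (measurable_funM h2 (measurable_funB (measurable_funM mc f1)
  (measurable_funM ms f2))).
rewrite /cintegral; apply: (f_equal2 (@Complex R)).
  apply: (@Rfubini R (fun z => complex.Re (K z)) (C * C')); last first.
    by move=> x y; apply: le_trans (b x y); exact: Re_le_normc.
  apply: eq_measurable_fun mRe => -[x y] _; rewrite /K /cis /=.
  by case: (h x) (phi y) => [? ?] [].
apply: (@Rfubini R (fun z => complex.Im (K z)) (C * C')); last first.
  by move=> x y; apply: le_trans (b x y); exact: Im_le_normc.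
apply: eq_measurable_fun mIm => -[x y] _; rewrite /K /cis /=.
by case: (h x) (phi y) => [? ?] [].
Qed.

End FourierSchwartz.

Section ConstantDerivative.
Context {R : realType}.

Lemma isD0_cst (g : R -> R) a b : (forall t, isD g t 0) -> g a = g b.
Proof.
have H (f : R -> R) x y : (forall t, isD f t 0) -> x <= y -> f y <= f x.
  move=> df xy; have := @isD_incr_le _ f (fun=> 0) x y 0 xy df (fun _ _ => lexx _).
  by rewrite mul0r subr_le0.
have H' x y : (forall t, isD g t 0) -> x <= y -> g x = g y.
  move=> dg xy; apply/eqP; rewrite eq_le (H g x y dg xy) andbT -lerN2.
  apply: (H (fun t => - g t)) => // t; have := isD_opp (dg t); rewrite oppr0; exact.
by move=> dg; case: (leP a b) => [ab|/ltW ab]; [exact: H'|apply/esym; exact: H'].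
Qed.

End ConstantDerivative.

Section GaussianTransform.
Context {R : realType}.
Local Notation mu := (@lebesgue_measure R).
Variables (N sg : R).
Hypothesis sg0 : 0 < sg.

Let c : R := (2 * sg ^+ 2)^-1.
Let c0 : 0 < c. Proof. by rewrite invr_gt0 mulr_gt0// exprn_gt0. Qed.
Local Notation E := (gexp 1 c N).

Let P (y : R) := \int[mu]_x (cos (y * x) * E x).
Let Q (y : R) := \int[mu]_x (sin (y * x) * E x).

Let HE x : isD E x (- (c * (2 * (x - N))) * E x).
Proof. by apply: isD_eq (dgexp _ _ _ x) _; rewrite expr1. Qed.

Let cE : cont E. Proof. exact: derf_cont HE. Qed.

Let ldE (p : {poly R}) t0 : ldec t0 (fun _ x => p.[x] * E x).
Proof.
have [C hC] := poly_lor_bound N (isT : (0 < 1)%N) c0 p.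
exists C; near=> t => x; rewrite normrM (ger0_norm (ltW (gexp_gt0 _ _ _ _))).
exact: hC.
Unshelve. end_near. Qed.

Let ldE0 t0 : ldec t0 (fun _ x => E x).
Proof. by have := ldE 1 t0; under eq_fun do under eq_fun do rewrite hornerC mul1r. Qed.

Let ldE1 t0 : ldec t0 (fun _ x => x * E x).
Proof. by have := ldE 'X t0; under eq_fun do under eq_fun do rewrite hornerX. Qed.

Let intgE (f : R -> R) (p : {poly R}) : cont f -> (forall x, `|f x| <= 1) ->
  intg (fun x => f x * (p.[x] * E x)).
Proof.
move=> cf f1; have [C hC] := ldec_at (ldE p 0).
apply: (@intg_lordom _ _ C 0 1) => //.
  by apply: (contM cf); apply: (contM _ cE); exact: derf_cont (@derf_horner R p).
move=> x; rewrite normrM; apply: le_trans (hC x).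
by rewrite ler_piMl.
Qed.

Let dP y : isD P y (- (\int[mu]_x (sin (y * x) * (x * E x)))).
Proof.
have -> : - (\int[mu]_x (sin (y * x) * (x * E x))) = \int[mu]_x (- (sin (y * x) * (x * E x))).
  rewrite -mulN1r -RintegralZl//; last first.
    have := @intgE (fun x => sin (y * x)) 'X.
    under [X in intg X]eq_fun do rewrite hornerX; apply.
      by apply: (cont_comp (@cont_sin R)); apply: cont_mul; [exact: cont_cst|exact: cont_id].
    by move=> x; rewrite ler_norml sin_geN1 sin_le1.
  by apply: eq_Rintegral => x _; rewrite mulN1r.
apply: (@derive_Rint R y (fun y x => cos (y * x) * E x)
  (fun y x => - (sin (y * x) * (x * E x)))).
- move=> t; apply: contM => //; apply: (cont_comp (@cont_cos R)).
  by apply: cont_mul; [exact: cont_cst|exact: cont_id].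
- move=> t x; have h : isD (fun y : R => y * x) t x.
    by apply: isD_eq (isD_mul (isD_id t) (isD_cst x t)) _; rewrite mul1r mulr0 addr0.
  by apply: isD_eq (isD_mul (isD_cos h) (isD_cst (E x) t)) _; ring.
- by apply: ldecMl; [exact: lbdd_cos|exact: ldE0].
- by apply: ldecN; apply: ldecMl; [exact: lbdd_sin|exact: ldE1].
Qed.

Let dQ y : isD Q y (\int[mu]_x (cos (y * x) * (x * E x))).
Proof.
apply: (@derive_Rint R y (fun y x => sin (y * x) * E x)
  (fun y x => (cos (y * x) * (x * E x)))).
- move=> t; apply: contM => //; apply: (cont_comp (@cont_sin R)).
  by apply: cont_mul; [exact: cont_cst|exact: cont_id].
- move=> t x; have h : isD (fun y : R => y * x) t x.
    by apply: isD_eq (isD_mul (isD_id t) (isD_cst x t)) _; rewrite mul1r mulr0 addr0.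
  by apply: isD_eq (isD_mul (isD_sin h) (isD_cst (E x) t)) _; ring.
- by apply: ldecMl; [exact: lbdd_sin|exact: ldE0].
- by apply: ldecMl; [exact: lbdd_cos|exact: ldE1].
Qed.

Let contlin (y : R) : cont (fun x : R => y * x).
Proof. by apply: cont_mul; [exact: cont_cst|exact: cont_id]. Qed.

Let intgEs (f : R -> R) : cont f -> (forall x, `|f x| <= 1) ->
  intg (fun x => f x * E x) /\ intg (fun x => f x * (x * E x)).
Proof.
move=> cf f1; have h0 := intgE 1 cf f1; have h1 := intgE 'X cf f1; split.
  by rewrite (_ : (fun x => _) = fun x => f x * (1.[x] * E x))//; apply/funext => x;
    rewrite hornerC mul1r.
by rewrite (_ : (fun x => _) = fun x => f x * ('X.[x] * E x))//; apply/funext => x;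
  rewrite hornerX.
Qed.

(* Integration by parts, from the vanishing of the integral of (f E)'. *)
Let ibp (f df : R -> R) y : cont f -> cont df -> (forall x, `|f x| <= 1) ->
  (forall x, `|df x| <= 1) -> (forall x, isD f x (y * df x)) ->
  \int[mu]_x (f x * (x * E x)) =
  N * (\int[mu]_x (f x * E x)) + sg ^+ 2 * y * \int[mu]_x (df x * E x).
Proof.
move=> cf cdf f1 df1 dff.
have [i0 i1] := intgEs cf f1; have [j0 _] := intgEs cdf df1.
have s2 : sg ^+ 2 != 0 by rewrite expf_neq0// gt_eqF.
have h : \int[mu]_x ((N * (f x * E x) + sg ^+ 2 * y * (df x * E x)) - f x * (x * E x)) = 0.
  have dF x : isD (fun x => sg ^+ 2 * (f x * E x)) x
      ((N * (f x * E x) + sg ^+ 2 * y * (df x * E x)) - f x * (x * E x)).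
    apply: isD_eq (isD_cmul _ (isD_mul (dff x) (HE x))) _; rewrite /c; field.
    by rewrite gt_eqF.
  have ca : cont (fun x => (N * (f x * E x) + sg ^+ 2 * y * (df x * E x)) - f x * (x * E x)).
    apply: contB; last exact: (contM cf (contM contid cE)).
    apply: contD; first exact: (contM (contC N) (contM cf cE)).
    exact: (contM (contC (sg ^+ 2 * y)) (contM cdf cE)).
  have [C0 h0] := ldec_at (ldE0 0); have [C1 h1] := ldec_at (ldE1 0).
  have l0 x : 0 <= lor 0 1 x :> R := lor_ge0 _ _ _.
  have b0 (g : R -> R) x : `|g x| <= 1 -> `|g x * E x| <= C0 * lor 0 1 x.
    by move=> g1; rewrite normrM; apply: le_trans (h0 x); rewrite ler_piMl.
  have b1 x : `|f x * (x * E x)| <= C1 * lor 0 1 x.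
    by rewrite normrM; apply: le_trans (h1 x); rewrite ler_piMl.
  pose M1 := `|N| * C0 + `|sg ^+ 2 * y| * C0 + C1; pose M2 := sg ^+ 2 * C0.
  have bf x : `|(N * (f x * E x) + sg ^+ 2 * y * (df x * E x)) - f x * (x * E x)|
      <= M1 * lor 0 1 x.
    apply: (le_trans (ler_normB _ _)); rewrite mulrDl lerD//.
    apply: (le_trans (ler_normD _ _)); rewrite mulrDl.
    by apply: lerD; rewrite normrM -[leRHS]mulrA; apply: ler_wpM2l => //; exact: b0.
  have bF x : `|sg ^+ 2 * (f x * E x)| <= M2 * lor 0 1 x.
    rewrite normrM (ger0_norm (sqr_ge0 _)) /M2 -[leRHS]mulrA.
    by apply: ler_wpM2l; [exact: sqr_ge0|exact: b0].
  apply: (@Rint_derive0 R _ _ (Num.max M1 M2) ca dF).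
  - by move=> x; apply: le_trans (bf x) _; rewrite ler_wpM2r ?le_max ?lexx.
  - by move=> x; apply: le_trans (bF x) _; rewrite ler_wpM2r ?le_max ?lexx ?orbT.
have i2 := intgD (intgZ N i0) (intgZ (sg ^+ 2 * y) j0).
move: h; rewrite (RintegralB measurableT i2 i1).
rewrite (RintegralD measurableT (intgZ N i0) (intgZ (sg ^+ 2 * y) j0)).
rewrite (RintegralZl N measurableT i0) (RintegralZl _ measurableT j0).
by move/eqP; rewrite subr_eq0 => /eqP.
Qed.

Let cos1 (z : R) : `|cos z| <= 1. Proof. by rewrite ler_norml cos_geN1 cos_le1. Qed.
Let sin1 (z : R) : `|sin z| <= 1. Proof. by rewrite ler_norml sin_geN1 sin_le1. Qed.
Let ccos (y : R) : cont (fun x : R => cos (y * x)).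
Proof. by apply: (@cont_comp R cos); [exact: cont_cos|exact: contlin]. Qed.
Let csin (y : R) : cont (fun x : R => sin (y * x)).
Proof. by apply: (@cont_comp R sin); [exact: cont_sin|exact: contlin]. Qed.

Let dP' y : isD P y (- (N * Q y + sg ^+ 2 * y * P y)).
Proof.
apply: isD_eq (dP y) _; congr (- _).
apply: (@ibp (fun x => sin (y * x)) (fun x => cos (y * x))) => // x.
by apply: isD_eq (isD_sin (isD_cmul y (isD_id x))) _; rewrite mulr1.
Qed.

Let dQ' y : isD Q y (N * P y - sg ^+ 2 * y * Q y).
Proof.
have h : isD Q y (\int[mu]_x (cos (y * x) * (x * E x))) := dQ y.
apply: isD_eq h _.
have cs : cont (fun x => - sin (y * x)) := cont_opp (@csin y).
rewrite (@ibp (fun x => cos (y * x)) (fun x => - sin (y * x)) y) //.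
- have [i _] := intgEs (@csin y) (fun x => sin1 _).
  congr (_ + _); rewrite -mulrN; congr (_ * _).
  rewrite -[RHS]mulN1r /Q -(RintegralZl (-1) measurableT i).
  by apply: eq_Rintegral => x _; rewrite mulN1r mulNr.
- by move=> x; rewrite normrN.
- move=> x; apply: isD_eq (isD_cos (isD_cmul y (isD_id x))) _; rewrite mulr1//.
Qed.

Let P0 := \int[mu]_x E x.

Let PQ0 : P 0 = P0 /\ Q 0 = 0.
Proof.
split.
  by apply: eq_Rintegral => x _; rewrite mul0r cos0 mul1r.
rewrite /Q (_ : (fun x => sin (0 * x) * E x) = fun=> 0).
  by rewrite /Rintegral integral0.
by apply/funext => x; rewrite mul0r sin0 mul0r.
Qed.

Let gs y := expR (sg ^+ 2 / 2 * y ^+ 2).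

Let dgs y : isD gs y (sg ^+ 2 * y * gs y).
Proof.
apply: isD_eq (isD_expR (isD_cmul _ (isD_exp 2 (isD_id y)))) _.
by rewrite /gs expr1; field.
Qed.

Lemma gauss_transform y : P y = P0 * expR (- (sg ^+ 2 / 2 * y ^+ 2)) * cos (N * y) /\
  Q y = P0 * expR (- (sg ^+ 2 / 2 * y ^+ 2)) * sin (N * y).
Proof.
have dc z : isD (fun y : R => cos (N * y)) z (- N * sin (N * z)).
  by apply: isD_eq (isD_cos (isD_cmul N (isD_id z))) _; ring.
have ds z : isD (fun y : R => sin (N * y)) z (N * cos (N * z)).
  by apply: isD_eq (isD_sin (isD_cmul N (isD_id z))) _; ring.
have U : gs y * (P y * cos (N * y) + Q y * sin (N * y)) = P0.
  rewrite (@isD0_cst R (fun y => gs y * (P y * cos (N * y) + Q y * sin (N * y))) y 0).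
    have [-> ->] := PQ0.
    by rewrite /gs !mulr0 expr0n /= mulr0 expR0 cos0 mul1r mulr1 mul0r addr0.
  move=> z; apply: isD_eq (isD_mul (dgs z) (isD_add (isD_mul (dP' z) (dc z))
    (isD_mul (dQ' z) (ds z)))) _; ring.
have V : gs y * (Q y * cos (N * y) - P y * sin (N * y)) = 0.
  rewrite (@isD0_cst R (fun y => gs y * (Q y * cos (N * y) - P y * sin (N * y))) y 0).
    have [-> ->] := PQ0.
    by rewrite /gs !mulr0 sin0 mul0r mulr0 subr0 mulr0.
  move=> z; apply: isD_eq (isD_mul (dgs z) (isD_add (isD_mul (dQ' z) (dc z))
    (isD_opp (isD_mul (dP' z) (ds z))))) _; ring.
have CS := cos2Dsin2 (N * y).
have gg : gs y * expR (- (sg ^+ 2 / 2 * y ^+ 2)) = 1 by rewrite -expRD subrr expR0.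
move: U V gg CS; set g := gs y; set g' := expR _; set C := cos _; set S := sin _.
move: (P y) (Q y) => p q U V gg CS; split.
- transitivity (g * g' * (C ^+ 2 + S ^+ 2) * p); first by rewrite gg CS !mul1r.
  transitivity (g' * C * (g * (p * C + q * S)) - g' * S * (g * (q * C - p * S))); first by ring.
  by rewrite U V; ring.
- transitivity (g * g' * (C ^+ 2 + S ^+ 2) * q); first by rewrite gg CS !mul1r.
  transitivity (g' * S * (g * (p * C + q * S)) + g' * C * (g * (q * C - p * S))); first by ring.
  by rewrite U V; ring.
Qed.

Lemma gauss_mass : sg <= P0.
Proof.
have iE : intg E.
  have [|h _] := @intgEs (fun=> 1) (@cont_cst R 1).
    by move=> x; rewrite normr1.
  by move: h; under eq_fun do rewrite mul1r.
have i0 : intg (fun _ : R => 0) by exact: integrable0.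
have z0 : \int[mu]_x (0 : R) = 0 by rewrite /Rintegral integral0.
have ab : N - sg <= N + sg by move: sg0; lra.
have k0 : 0 <= 2^-1 :> R by rewrite invr_ge0.
have g0 x : 0 <= E x by rewrite ltW// gexp_gt0.
suff h x : N - sg <= x <= N + sg -> 2^-1 + 0 <= E x.
  by have := Rint_ge_box ab k0 iE i0 g0 h; rewrite z0 /P0; lra.
move=> /andP[x1 x2]; rewrite addr0 /gexp muln1.
apply: le_trans (expR_ge1Dx _).
have : (x - N) ^+ 2 <= sg ^+ 2.
  rewrite -[leLHS]real_normK ?num_real// ler_pXn2r ?nnegrE ?(ltW sg0)//.
  by rewrite ler_norml; lra.
move=> h; suff : c * (x - N) ^+ 2 <= 2^-1 by lra.
rewrite /c mulrC ler_pdivrMr ?mulr_gt0 ?exprn_gt0//.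
by rewrite mulrA mulVf ?mul1r.
Qed.

End GaussianTransform.

Section GaussianPair.
Context {R : realType}.
Local Notation mu := (@lebesgue_measure R).
Variables (N sg th x0 : R).
Hypothesis sg0 : 0 < sg.

Let c : R := (2 * sg ^+ 2)^-1.
Let c0 : 0 < c. Proof. by rewrite invr_gt0 mulr_gt0// exprn_gt0. Qed.
Let c' : R := sg ^+ 2 / 2.
Let c'0 : 0 < c'. Proof. by rewrite divr_gt0// exprn_gt0. Qed.
Local Notation E := (gexp 1 c N).
Local Notation P0 := (\int[mu]_x E x).
Local Notation E' := (gexp 1 c' (- x0)).

Let phif : R -> R[i]^o := fun x => (cos (- x0 * x + th) * E x) +i* (sin (- x0 * x + th) * E x).
Let psif : R -> R[i]^o := fun x =>
  (P0 * cos (- N * x + (th - N * x0)) * E' x) +i* (P0 * sin (- N * x + (th - N * x0)) * E' x).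

Let phiS : phif \in @schwartz_fun R.
Proof.
apply: (@gclass_schwartz R 1 c N isT c0 (- x0) th).
  by exists 1%:P, 0 => x; rewrite hornerC horner0 mul0r addr0 mul1r.
by exists 0, 1%:P => x; rewrite horner0 hornerC mul0r add0r mul1r.
Qed.

Let psiS : psif \in @schwartz_fun R.
Proof.
apply: (@gclass_schwartz R 1 c' (- x0) isT c'0 (- N) (th - N * x0)).
  by exists P0%:P, 0 => x; rewrite hornerC horner0 mul0r addr0.
by exists 0, P0%:P => x; rewrite horner0 hornerC mul0r add0r.
Qed.

Lemma gauss_pair : exists phi psi : schwartz R,
  [/\ (psi : R -> R[i]) = fourier phi,
      forall x, normc (phi x) = E x,
      forall x, complex.Re (psi x) = P0 * cos (- N * x + (th - N * x0)) * E' x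
    & forall x, complex.Im (psi x) = P0 * sin (- N * x + (th - N * x0)) * E' x].
Proof.
exists (Schwartz phiS), (Schwartz psiS); split => //; last first.
  move=> x; rewrite /= -[RHS]ger0_norm ?(ltW (gexp_gt0 _ _ _ _))// -sqrtr_sqr.
  by congr Num.sqrt; rewrite !exprMn -mulrDl cos2Dsin2 mul1r.
apply/funext => x; rewrite /= /fourier /cintegral /psif.
have [Pe Qe] := @gauss_transform R N sg sg0 (x + x0).
have E'E : expR (- (sg ^+ 2 / 2 * (x + x0) ^+ 2)) = E' x.
  by rewrite /gexp opprK muln1.
rewrite E'E in Pe Qe.
have cE : cont E by exact: derf_cont (@dgexp R 1 c N).
have ci (f : R -> R) : cont f -> (forall x, `|f x| <= 1) -> intg (fun x => f x * E x).
  move=> cf f1; have [C hC] := @poly_lor_bound R 1 c N isT c0 1.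
  apply: (@intg_lordom _ _ C 0 1) => //; first exact: (contM cf cE).
  move=> z; rewrite normrM; apply: le_trans (hC z).
  by rewrite hornerC normr1 mul1r (ger0_norm (ltW (gexp_gt0 _ _ _ _))) ler_piMl// ltW// gexp_gt0.
have cl : cont (fun z : R => (x + x0) * z).
  by apply: cont_mul; [exact: cont_cst|exact: cont_id].
have iP : intg (fun z => cos ((x + x0) * z) * E z).
  apply: ci; first by apply: (@cont_comp R cos); [exact: cont_cos|].
  by move=> z; rewrite ler_norml cos_geN1 cos_le1.
have iQ : intg (fun z => sin ((x + x0) * z) * E z).
  apply: ci; first by apply: (@cont_comp R sin); [exact: cont_sin|].
  by move=> z; rewrite ler_norml sin_geN1 sin_le1.
congr (_ +i* _).
  transitivity (\int[mu]_z (cos th * (cos ((x + x0) * z) * E z) +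
                            sin th * (sin ((x + x0) * z) * E z))).
    rewrite (RintegralD measurableT (intgZ _ iP) (intgZ _ iQ)).
    rewrite (RintegralZl _ measurableT iP) (RintegralZl _ measurableT iQ) Pe Qe.
    have -> : - N * x + (th - N * x0) = th - N * (x + x0) by ring.
    by rewrite cosB; ring.
  apply: eq_Rintegral => z _; rewrite /phif /cis /=.
  have -> : cos th * (cos ((x + x0) * z) * E z) + sin th * (sin ((x + x0) * z) * E z) =
    cos (- (z * x) + (- x0 * z + th)) * E z.
    rewrite (_ : - (z * x) + _ = th - (x + x0) * z); last by ring.
    by rewrite cosB; ring.
  by rewrite [in LHS]cosD; ring.
transitivity (\int[mu]_z (sin th * (cos ((x + x0) * z) * E z) -
                          cos th * (sin ((x + x0) * z) * E z))).
  rewrite (RintegralB measurableT (intgZ _ iP) (intgZ _ iQ)).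
  rewrite (RintegralZl _ measurableT iP) (RintegralZl _ measurableT iQ) Pe Qe.
  have -> : - N * x + (th - N * x0) = th - N * (x + x0) by ring.
  by rewrite sinB; ring.
apply: eq_Rintegral => z _; rewrite /phif /cis /=.
have -> : sin th * (cos ((x + x0) * z) * E z) - cos th * (sin ((x + x0) * z) * E z) =
  sin (- (z * x) + (- x0 * z + th)) * E z.
  rewrite (_ : - (z * x) + _ = th - (x + x0) * z); last by ring.
  by rewrite sinB; ring.
by rewrite [in LHS]sinD; ring.
Qed.

Lemma lor_expR (z : R) : expR (- z ^+ 2) <= (1 + z ^+ 2)^-1.
Proof.
rewrite expRN lef_pV2 ?posrE ?expR_gt0 ?expR_ge1Dx// ltr_wpDr ?sqr_ge0//.
Qed.

Lemma gauss_dual_norm (r eps : R) (phi : schwartz R) : 0 < r -> 1 <= N -> sg <= 1 ->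
  0 < eps -> eps <= 1 -> 2 * (eps * r) <= 1 ->
  (forall x, normc (phi x) = E x) ->
  forall B, 0 <= B -> 2 * (16 / eps) `^ r * (N ^+ 2 / 4) `^ r * (pi * sg) <= B ^+ 2 ->
  (Lnorm mu 2%:E (fun x => ((1 + x ^+ 2) `^ (r / 2) * normc (phi x))%:E) <= B%:E)%E.
Proof.
move=> r0 N1 sg1 e0 e1 er phiE B B0 hB.
have [A AE] : exists A, A = (16 / eps) `^ r * (N ^+ 2 / 4) `^ r by eexists.
have A0 : 0 <= A by rewrite AE mulr_ge0 ?powR_ge0.
have key x : `|((1 + x ^+ 2) `^ (r / 2) * normc (phi x)) ^+ 2| <= 2 * A * lor N sg x.
  rewrite ger0_norm ?sqr_ge0// phiE exprMn.
  have -> : ((1 + x ^+ 2) `^ (r / 2)) ^+ 2 = (1 + x ^+ 2) `^ r.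
    by rewrite -powR_mulrn ?powR_ge0// -powRrM; congr (_ `^ _); field.
  have [z zE] : exists z, z = (x - N) / sg by eexists.
  have -> : E x ^+ 2 = expR (- z ^+ 2).
    rewrite /gexp muln1 -expRM_natl; congr expR.
    by rewrite zE /c; field; rewrite gt_eqF.
  have N0 : 0 < N ^+ 2 / 4 by rewrite divr_gt0// exprn_gt0// (lt_le_trans _ N1).
  have xz : 1 + x ^+ 2 <= (16 / eps) * (N ^+ 2 / 4) * expR (eps * z ^+ 2).
    have ex := expR_ge1Dx (eps * z ^+ 2).
    have xE : x = N + sg * z by rewrite zE; field; rewrite gt_eqF.
    have h1 : 1 + x ^+ 2 <= 4 * N ^+ 2 * (1 + z ^+ 2).
      have sz : (sg * z) ^+ 2 <= z ^+ 2.
        by rewrite exprMn ler_piMl ?sqr_ge0// expr_le1// ltW.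
      have N2 : 1 <= N ^+ 2 by rewrite expr_ge1// (le_trans _ N1).
      have Nz : z ^+ 2 <= N ^+ 2 * z ^+ 2 by rewrite ler_peMl ?sqr_ge0.
      have := sqr_ge0 (N - sg * z); rewrite xE; nra.
    have h2 : eps * (1 + z ^+ 2) <= expR (eps * z ^+ 2).
      by apply: le_trans ex; rewrite mulrDr mulr1 lerD2r.
    apply: (le_trans h1).
    have -> : 16 / eps * (N ^+ 2 / 4) * expR (eps * z ^+ 2) =
      4 * N ^+ 2 * (expR (eps * z ^+ 2) / eps) by field; rewrite gt_eqF.
    by rewrite ler_pM2l ?mulr_gt0 ?exprn_gt0 ?(lt_le_trans _ N1)// ler_pdivlMr// mulrC.
  have h : (1 + x ^+ 2) `^ r <= A * expR (z ^+ 2 / 2).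
    apply: (@le_trans _ _ ((16 / eps * (N ^+ 2 / 4) * expR (eps * z ^+ 2)) `^ r)).
      apply: ge0_ler_powR => //; rewrite ?nnegrE ?(ltW r0)//.
        by rewrite addr_ge0 ?sqr_ge0.
      by apply: le_trans xz; rewrite addr_ge0 ?sqr_ge0.
    have a1 : 0 <= 16 / eps by rewrite divr_ge0// ltW.
    have a2 : 0 <= N ^+ 2 / 4 := ltW N0.
    rewrite (powRM _ (mulr_ge0 a1 a2) (expR_ge0 _)) (powRM _ a1 a2).
    rewrite -AE -expRM; apply: ler_wpM2l => //; rewrite ler_expR.
    have z0 := sqr_ge0 z; have : 2 * (eps * r) * z ^+ 2 <= 1 * z ^+ 2 by apply: ler_wpM2r.
    lra.
  have h' := le_trans (ler_wpM2r (expR_ge0 (- z ^+ 2)) h) _; apply: h'.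
  rewrite -(mulrA A) -(mulrA 2) -expRD [_ / 2 + _](_ : _ = - (z / Num.sqrt 2) ^+ 2); last first.
    by rewrite exprMn exprVn sqr_sqrtr//; field.
  rewrite mulrCA ler_wpM2l//; apply: le_trans (lor_expR _) _.
  rewrite /lor -zE exprMn exprVn sqr_sqrtr//.
  have z0 : 0 < 1 + z ^+ 2 by rewrite ltr_wpDr ?sqr_ge0.
  rewrite ler_pdivlMr// mulrC ler_pdivrMr; last by have := sqr_ge0 z; lra.
  by have := sqr_ge0 z; lra.
have iL := intgZ (2 * A) (intg_lor N sg0).
have i2 : intg (fun x => ((1 + x ^+ 2) `^ (r / 2) * normc (phi x)) ^+ 2).
  apply: intg_mdom iL key; apply: measurable_funX; apply: measurable_funM.
    exact: measurable_weight.
  rewrite (_ : (fun x => _) = E); last exact/funext.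
  by apply: continuous_mfun; exact: derf_cont (@dgexp R 1 c N).
apply: Lnorm2_le => //; apply: le_trans hB; rewrite -(mulrA 2 (_ `^ _)) -AE.
rewrite -(Rint_lor N sg0) -(RintegralZl _ measurableT (intg_lor N sg0)).
by apply: le_Rint => // x; apply: le_trans (key x); exact: ler_norm.
Qed.

End GaussianPair.

Section Plateau.
Context {R : realType}.
Local Notation mu := (@lebesgue_measure R).
Variables (k : nat) (L : R).
Hypotheses (k0 : (0 < k)%N) (L0 : 0 < L).

Let cL : R := L^-1 ^+ (2 * k).
Let cL0 : 0 < cL. Proof. by rewrite exprn_gt0// invr_gt0. Qed.

Definition plateau (x : R) : R := gexp k (L^-1 ^+ (2 * k)) 0 x.
Local Notation w := plateau.

Lemma plateauE x : w x = expR (- (x / L) ^+ (2 * k)).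
Proof. by rewrite /plateau /gexp subr0 -exprMn mulrC. Qed.

Lemma plateau_gt0 x : 0 < w x. Proof. exact: gexp_gt0. Qed.

Lemma plateau_le1 x : w x <= 1. Proof. exact: (gexp_le1 k 0 cL0). Qed.

Lemma plateau_lor x : w x <= expR 1 * lor 0 L x.
Proof.
rewrite plateauE /lor subr0; set y := x / L.
have y2 := sqr_ge0 y.
apply: (@le_trans _ _ (expR 1 * expR (- y ^+ 2))); last first.
  by rewrite ler_wpM2l ?expR_ge0// lor_expR.
rewrite -expRD ler_expR exprM; have [y1|y1] := leP (y ^+ 2) 1.
  by have := exprn_ge0 k y2; lra.
have : y ^+ 2 <= (y ^+ 2) ^+ k by rewrite -{1}[y ^+ 2]expr1 ler_eXn2l.
lra.
Qed.

Definition dplateau (x : R) : R := - (cL * ((2 * k)%:R * (x - 0) ^+ (2 * k).-1)) * w x.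
Local Notation dw := dplateau.

Lemma isD_plateau x : isD w x (dw x). Proof. exact: dgexp. Qed.

Lemma plateau_cont : cont w. Proof. exact: derf_cont isD_plateau. Qed.

Lemma dplateau_cont : cont dw.
Proof.
apply: contM plateau_cont; apply: cont_opp; apply: (contM (contC _)); apply: (contM (contC _)).
by apply: contX; apply: contB; [exact: contid|exact: (contC 0)].
Qed.

Lemma plateau_poly (p : {poly R}) : exists C, forall x, `|p.[x] * w x| <= C * lor 0 1 x.
Proof.
have [C hC] := poly_lor_bound 0 k0 cL0 p; exists C => x; apply: le_trans (hC x).
by rewrite normrM (ger0_norm (ltW (plateau_gt0 _))).
Qed.

Lemma dplateau_lor : exists C, forall x, `|dw x| <= C * lor 0 1 x.
Proof.
have [C hC] := plateau_poly ((- (cL * (2 * k)%:R)) *: 'X^((2 * k).-1)).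
exists C => x; apply: le_trans (hC x).
suff -> : dw x = (- (cL * (2 * k)%:R) *: 'X^((2 * k).-1)).[x] * w x by [].
by rewrite hornerZ hornerXn /dw subr0; ring.
Qed.

Lemma plateau_cvg : w x @[x --> +oo%R] --> 0.
Proof.
have [C hC] := plateau_poly 1.
have h x : w x <= C * lor 0 1 x.
  by have := hC x; rewrite hornerC mul1r => /(le_trans (ler_norm _)).
apply: (@squeeze_cvgr _ _ _ _ (fun=> 0) (fun x => C * lor 0 1 x)).
- by near=> x; rewrite h andbT ltW// plateau_gt0.
- exact: cvg_cst.
- by have := cvgM (@cvg_cst _ C _ (+oo%R) _) (@cvgy_lor R); rewrite mulr0; exact.
Unshelve. end_near. Qed.

Lemma dplateau_mass : \int[mu]_x `|dw x| = 2.
Proof.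
have cn : continuous (fun x => `|dw x|).
  by move=> x; apply: cvg_norm; exact: dplateau_cont.
have ev : (fun x => `|dw x|) =1 (fun x => `|dw x|) \o -%R.
  move=> x; rewrite /= /dw !subr0 plateauE (plateauE (- x)) !normrM !normrN.
  by rewrite !normrM !normrX normrN mulNr !exprM sqrrN.
rewrite /Rintegral (ge0_symfun_integralT _ cn ev); last by move=> x; exact: normr_ge0.
have -> : [set x : R | 0 <= x] = `[0%R, +oo[%classic by rewrite set_itvcy.
have pos (x : R) : 0 <= x -> `|dw x| = - dw x.
  move=> x0; rewrite ler0_norm// /dw subr0 mulNr oppr_le0.
  by rewrite !mulr_ge0 ?(ltW cL0) ?exprn_ge0 ?(ltW (plateau_gt0 _)).
have dF (x : R) : is_derive x (1 : R) (fun x => - w x) (- dw x).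
  exact: (isD_opp (isD_plateau x)).
rewrite (@ge0_continuous_FTC2y R (fun x => `|dw x|) (fun x => - w x) 0 0).
- rewrite plateauE mul0r expr0n (_ : (2 * k == 0)%N = false); last by case: k k0.
  by rewrite /= oppr0 expR0 opprK add0r mulr1.
- by move=> x _; exact: normr_ge0.
- exact: continuous_subspaceT.
- by rewrite -[X in _ --> X]oppr0; apply: cvgN; exact: plateau_cvg.
- by move=> x _; have [] := dF x.
- by apply: cvg_at_right_filter; apply: cvgN; exact: plateau_cont.
- move=> x; rewrite in_itv /= andbT => x0; rewrite derive1E.
  by have [_ ->] := dF x; rewrite pos// ltW.
Qed.

Lemma plateau_intg (f : R -> R) : cont f -> (forall x, `|f x| <= 1) ->
  intg (fun x => f x * w x) /\ intg (fun x => f x * dw x).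
Proof.
move=> cf f1; have [C hC] := plateau_poly 1; have [C' hC'] := dplateau_lor; split.
  apply: (@intg_lordom _ _ C 0 1) => //; first exact: (contM cf plateau_cont).
  move=> x; have := hC x; rewrite hornerC mul1r normrM; apply: le_trans.
  by rewrite ler_piMl.
apply: (@intg_lordom _ _ C' 0 1) => //; first exact: (contM cf dplateau_cont).
move=> x; rewrite normrM; apply: le_trans (hC' x).
by rewrite ler_piMl.
Qed.

(* Both bounds are uniform in the flatness parameter k. *)
Lemma plateau_fourier (f df : R -> R) eta : cont f -> cont df -> (forall x, `|f x| <= 1) ->
  (forall x, `|df x| <= 1) -> (forall x, isD f x (eta * df x)) ->
  (\int[mu]_x (df x * w x)) ^+ 2 * (1 + (L * eta) ^+ 2) <=
    ((expR 1 * pi) ^+ 2 + 4) * L ^+ 2.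
Proof.
move=> cf cdf f1 df1 dff.
have [i0 i1] := plateau_intg cf f1; have [j0 j1] := plateau_intg cdf df1.
set I := \int[mu]_x _.
have h1 : `|I| <= expR 1 * (pi * L).
  apply: (le_trans (le_normr_Rintegral measurableT j0)).
  apply: (@Rint_lordom _ _ (expR 1) 0 L L0).
    by move=> x; apply: cvg_norm; exact: (contM cdf plateau_cont).
  move=> x; rewrite normr_id normrM; apply: le_trans (plateau_lor x).
  by rewrite (ger0_norm (ltW (plateau_gt0 _))) ler_piMl// ltW// plateau_gt0.
have h2 : `|eta * I| <= 2.
  have z : \int[mu]_x (eta * (df x * w x) + f x * dw x) = 0.
    have [C hC] := plateau_poly 1; have [C' hC'] := dplateau_lor.
    have bw (g : R -> R) x : `|g x| <= 1 -> `|g x * w x| <= C * lor 0 1 x.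
      move=> g1; have := hC x; rewrite hornerC mul1r normrM; apply: le_trans.
      by rewrite ler_piMl.
    have ca : cont (fun x => eta * (df x * w x) + f x * dw x).
      exact: (contD (contM (contC eta) (contM cdf plateau_cont)) (contM cf dplateau_cont)).
    have dF x : isD (fun x => f x * w x) x (eta * (df x * w x) + f x * dw x).
      by apply: isD_eq (isD_mul (dff x) (isD_plateau x)) _; rewrite mulrA.
    apply: (@Rint_derive0 R _ _ (Num.max (`|eta| * C + C') C) ca dF).
      move=> x; apply: (@le_trans _ _ ((`|eta| * C + C') * lor 0 1 x)).
        apply: (le_trans (ler_normD _ _)); rewrite mulrDl; apply: lerD.
          by rewrite normrM -mulrA ler_wpM2l//; exact: bw.
        by rewrite normrM; apply: le_trans (hC' x); rewrite ler_piMl.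
      by rewrite ler_wpM2r ?lor_ge0// le_max lexx.
    move=> x; apply: le_trans (bw f x (f1 x)) _.
    by rewrite ler_wpM2r ?lor_ge0// le_max lexx orbT.
  move: z; rewrite (RintegralD measurableT (intgZ eta j0) i1) (RintegralZl _ measurableT j0).
  move/eqP; rewrite addr_eq0 => /eqP; rewrite -/I => ->; rewrite normrN.
  rewrite -dplateau_mass; apply: (le_trans (le_normr_Rintegral measurableT i1)).
  have [C' hC'] := dplateau_lor.
  apply: le_Rint.
  - exact: (integrable_norm i1).
  - apply: (@intg_lordom _ _ C' 0 1) => //; last by move=> x; rewrite normr_id.
    by move=> x; apply: cvg_norm; exact: dplateau_cont.
  - by move=> x; rewrite normrM ler_piMl.
have q1 : I ^+ 2 <= (expR 1 * (pi * L)) ^+ 2.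
  by rewrite -[leLHS]real_normK ?num_real// ler_pXn2r ?nnegrE// (le_trans _ h1).
have q2 : (eta * I) ^+ 2 <= 2 ^+ 2.
  by rewrite -[leLHS]real_normK ?num_real// ler_pXn2r ?nnegrE.
have q3 : L ^+ 2 * (eta * I) ^+ 2 <= L ^+ 2 * 2 ^+ 2 by rewrite ler_wpM2l ?sqr_ge0.
by move: q1 q3; rewrite !exprMn; nra.
Qed.

End Plateau.

Section Datum.
Context {R : realType}.
Local Notation mu := (@lebesgue_measure R).
Variables (k : nat) (L N : R).
Hypotheses (k0 : (0 < k)%N) (L0 : 0 < L).
Local Notation w := (plateau k L).

Let cL0 : 0 < L^-1 ^+ (2 * k). Proof. by rewrite exprn_gt0// invr_gt0. Qed.

Definition datum_fun (a : R) : R -> R[i]^o :=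
  fun x => (a * (cos (N * x) * w x)) +i* (a * (sin (N * x) * w x)).

Lemma datum_schwartz a : datum_fun a \in @schwartz_fun R.
Proof.
apply: (@gclass_schwartz R k _ 0 k0 cL0 N 0).
  by exists a%:P, 0 => x; rewrite /datum_fun /= hornerC horner0 mul0r !addr0 mulrA.
by exists 0, a%:P => x; rewrite /datum_fun /= horner0 hornerC mul0r add0r addr0 mulrA.
Qed.

Definition datum a : schwartz R := Schwartz (datum_schwartz a).

Lemma datumB a b : datum a - datum b = datum (a - b).
Proof.
apply: val_inj; apply/funext => x; rewrite /= /datum_fun.
by apply/eqP; rewrite eq_complex /=; apply/andP; split; apply/eqP; ring.
Qed.

Let cosI eta := \int[mu]_x (cos (eta * x) * w x).
Let sinI eta := \int[mu]_x (sin (eta * x) * w x).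

Let clin (eta : R) : cont (fun x => eta * x).
Proof. by apply: cont_mul; [exact: cont_cst|exact: cont_id]. Qed.
Let ccos (y : R) : cont (fun x : R => cos (y * x)).
Proof. by apply: (@cont_comp R cos); [exact: cont_cos|exact: clin]. Qed.
Let csin (y : R) : cont (fun x : R => sin (y * x)).
Proof. by apply: (@cont_comp R sin); [exact: cont_sin|exact: clin]. Qed.
Let cos1 (z : R) : `|cos z| <= 1. Proof. by rewrite ler_norml cos_geN1 cos_le1. Qed.
Let sin1 (z : R) : `|sin z| <= 1. Proof. by rewrite ler_norml sin_geN1 sin_le1. Qed.

Let icos y := (plateau_intg k0 L0 (@ccos y) (fun x => cos1 (y * x))).1.
Let isin y := (plateau_intg k0 L0 (@csin y) (fun x => sin1 (y * x))).1.

Lemma fourier_datum a xi : fourier (datum a) xi = (a * cosI (N - xi)) +i* (a * sinI (N - xi)).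
Proof.
rewrite /fourier /cintegral; congr (_ +i* _).
  rewrite /cosI -(RintegralZl a measurableT (icos _)); apply: eq_Rintegral => x _.
  rewrite /datum_fun /=.
  have -> : (N - xi) * x = N * x + - (x * xi) by ring.
  by rewrite cosD; ring.
rewrite /sinI -(RintegralZl a measurableT (isin _)); apply: eq_Rintegral => x _.
rewrite /datum_fun /=.
have -> : (N - xi) * x = N * x + - (x * xi) by ring.
by rewrite sinD; ring.
Qed.

Let ldw (p : {poly R}) t0 : ldec t0 (fun _ x => p.[x] * w x).
Proof.
have [C hC] := plateau_poly k0 L0 p.
by exists C; near=> t => x; exact: hC.
Unshelve. end_near. Qed.

Let trig_cont (f df : R -> R) : cont f -> (forall x, isD f x (df x)) ->
  (forall x, `|f x| <= 1) -> (forall x, `|df x| <= 1) ->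
  cont (fun eta => \int[mu]_x (f (eta * x) * w x)).
Proof.
move=> cf dff f1 df1.
suff H eta : exists d, isD (fun eta => \int[mu]_x (f (eta * x) * w x)) eta d.
  have /choice [d hd] := H.
  exact: derf_cont hd.
exists (\int[mu]_x (df (eta * x) * (x * w x))).
apply: (@derive_Rint R eta (fun y x => f (y * x) * w x) (fun y x => df (y * x) * (x * w x))).
- move=> t; apply: (@cont_mul R (fun x => f (t * x)) w); last exact: plateau_cont.
  exact: (@cont_comp R f).
- move=> t x; have h : isD (fun y : R => y * x) t x.
    by apply: isD_eq (isD_mul (isD_id t) (isD_cst x t)) _; rewrite mul1r mulr0 addr0.
  by apply: isD_eq (isD_mul (isD_comp h (dff (t * x))) (isD_cst (w x) t)) _; ring.
- have [C hC] := ldw 1 eta; exists C; apply: filterS hC => t h x.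
  by rewrite normrM; apply: le_trans (h x); rewrite hornerC mul1r ler_piMl.
- have [C hC] := ldw 'X eta; exists C; apply: filterS hC => t h x.
  by rewrite normrM; apply: le_trans (h x); rewrite hornerX ler_piMl.
Qed.

Let cosI_cont : cont cosI.
Proof.
apply: (@trig_cont cos (fun x => - sin x)); first exact: cont_cos.
- by move=> x; exact: is_derive_cos.
- exact: cos1.
- by move=> x; rewrite normrN.
Qed.

Let sinI_cont : cont sinI.
Proof.
apply: (@trig_cont sin cos); first exact: cont_sin.
- by move=> x; exact: is_derive_sin.
- exact: sin1.
- exact: cos1.
Qed.

Let creN : cont (fun xi : R => N - xi).
Proof. by apply: contB; [exact: (contC N)|exact: contid]. Qed.

Lemma fourier_datum_measurable a : cmeasurable (fourier (datum a)).
Proof.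
split.
  rewrite (_ : _ \o _ = fun xi => a * cosI (N - xi)).
    apply: continuous_mfun; apply: (contM (contC a)).
    exact: (@cont_comp R cosI).
  by apply/funext => xi; rewrite [LHS](congr1 (@complex.Re R) (fourier_datum a xi)).
rewrite (_ : _ \o _ = fun xi => a * sinI (N - xi)).
  apply: continuous_mfun; apply: (contM (contC a)).
  exact: (@cont_comp R sinI).
by apply/funext => xi; rewrite [LHS](congr1 (@complex.Im R) (fourier_datum a xi)).
Qed.

Definition datum_const : R := 2 * ((expR 1 * pi) ^+ 2 + 4).

Lemma fourier_datum_le a xi :
  normc (fourier (datum a) xi) ^+ 2 <= datum_const * a ^+ 2 * L ^+ 2 * lor N L^-1 xi.
Proof.
rewrite fourier_datum /= sqr_sqrtr ?addr_ge0 ?sqr_ge0//.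
have H1 : cosI (N - xi) ^+ 2 * (1 + (L * (N - xi)) ^+ 2) <=
    ((expR 1 * pi) ^+ 2 + 4) * L ^+ 2.
  apply: (@plateau_fourier R k L k0 L0 (fun x => sin ((N - xi) * x))) => //.
  by move=> x; apply: isD_eq (isD_sin (isD_cmul _ (isD_id x))) _; rewrite mulr1.
have H2 : sinI (N - xi) ^+ 2 * (1 + (L * (N - xi)) ^+ 2) <=
    ((expR 1 * pi) ^+ 2 + 4) * L ^+ 2.
  apply: (@plateau_fourier R k L k0 L0 (fun x => - cos ((N - xi) * x))) => //.
  - by apply: cont_opp.
  - by move=> x; rewrite normrN.
  - move=> x; apply: isD_eq (isD_opp (isD_cos (isD_cmul _ (isD_id x)))) _.
    by rewrite mulr1; ring.
have -> : lor N L^-1 xi = (1 + (L * (N - xi)) ^+ 2)^-1.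
  by rewrite /lor invrK; congr (_^-1); ring.
rewrite ler_pdivlMr; last by rewrite ltr_wpDr ?sqr_ge0.
rewrite !exprMn -mulrDr -mulrA.
have := ler_wpM2l (sqr_ge0 a) (lerD H1 H2); rewrite /datum_const !exprMn; nra.
Qed.

Lemma datum_weight (s xi : R) : s < 0 -> 0 < N ->
  (1 + xi ^+ 2) `^ s * lor N L^-1 xi <=
  (N ^+ 2 / 4) `^ s * lor N L^-1 xi + 8 / (L ^+ 2 * N ^+ 2) * lor N (N / 2) xi.
Proof.
move=> s0 N0; have l0 := @lor_ge0 R N L^-1 xi; have l1 := @lor_ge0 R N (N / 2) xi.
have p0 : 0 <= 8 / (L ^+ 2 * N ^+ 2) by rewrite divr_ge0// mulr_ge0 ?sqr_ge0.
have NN : 0 < N ^+ 2 / 4 by rewrite divr_gt0// exprn_gt0.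
have powd (x y : R) : 0 < x -> x <= y -> y `^ s <= x `^ s.
  move=> x0 xy; have y0 : 0 < y by exact: lt_le_trans xy.
  rewrite -[s]opprK !(powRN _ (- s)) lef_pV2 ?posrE ?powR_gt0//.
  apply: ge0_ler_powR; rewrite ?nnegrE ?oppr_ge0 ?(ltW s0) ?(ltW x0) ?(ltW y0)//.
have x1 : 1 <= 1 + xi ^+ 2 by rewrite lerDl sqr_ge0.
have [h|h] := leP (N ^+ 2 / 4) (1 + xi ^+ 2).
  rewrite (@le_trans _ _ ((N ^+ 2 / 4) `^ s * lor N L^-1 xi))//.
    by rewrite ler_wpM2r//; exact: powd.
  by rewrite lerDl mulr_ge0.
rewrite (@le_trans _ _ (1 * lor N L^-1 xi))//.
  by rewrite ler_wpM2r//; have := powd _ _ ltr01 x1; rewrite powR1.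
rewrite (@le_trans _ _ (8 / (L ^+ 2 * N ^+ 2) * lor N (N / 2) xi))//; last first.
  by rewrite lerDr mulr_ge0// powR_ge0.
rewrite mul1r /lor invrK.
have d2 : N ^+ 2 <= 4 * (xi - N) ^+ 2.
  have xN : xi < N / 2.
    have h2 : xi ^+ 2 < (N / 2) ^+ 2 by rewrite exprMn exprVn; move: h; lra.
    apply: le_lt_trans (ler_norm _) _; rewrite -(@ltr_pXn2r _ 2) ?nnegrE ?divr_ge0 ?(ltW N0)//.
    by rewrite real_normK ?num_real.
  have : 0 < N / 2 - xi by rewrite subr_gt0.
  nra.
have e : ((xi - N) / (N / 2)) ^+ 2 = 4 * (xi - N) ^+ 2 / N ^+ 2.
  by field; rewrite gt_eqF.
rewrite e.
have q0 : 0 < 1 + ((xi - N) * L) ^+ 2 by rewrite ltr_wpDr ?sqr_ge0.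
have q1 : 0 < N ^+ 2 by rewrite exprn_gt0.
have q2 : 0 < L ^+ 2 by rewrite exprn_gt0.
have q3 : 0 < N ^+ 2 + 4 * (xi - N) ^+ 2 by have := sqr_ge0 (xi - N); lra.
have -> : 8 / (L ^+ 2 * N ^+ 2) * (1 + 4 * (xi - N) ^+ 2 / N ^+ 2)^-1 =
   8 / (L ^+ 2 * (N ^+ 2 + 4 * (xi - N) ^+ 2)).
  field; rewrite !gt_eqF// ?mulr_gt0//.
rewrite ler_pdivlMr ?mulr_gt0// mulrC ler_pdivrMr// exprMn.
have := ler_wpM2l (ltW q2) d2; lra.
Qed.

Lemma datum_sobolev (s a B : R) : s < 0 -> 0 < N -> 0 <= B ->
  4 / (L * N) <= (N ^+ 2 / 4) `^ s ->
  2 * pi * datum_const * a ^+ 2 * L * (N ^+ 2 / 4) `^ s <= B ^+ 2 ->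
  (sobolev_norm s (distr (datum a)) <= B%:E)%E.
Proof.
move=> s0 N0 B0 hW hB; set W := (N ^+ 2 / 4) `^ s in hW hB *.
apply: ereal_inf_le.
exists (Lnorm mu 2%:E (fun xi => ((1 + xi ^+ 2) `^ (s / 2) * normc (fourier (datum a) xi))%:E)).
  exists (fourier (datum a)) => //.
  exact: fourier_distr_schwartz (fourier_datum_measurable a).
pose C := datum_const * a ^+ 2 * L ^+ 2.
have dc0 : 0 <= datum_const by rewrite /datum_const mulr_ge0// addr_ge0// sqr_ge0.
have C0 : 0 <= C by rewrite mulr_ge0 ?sqr_ge0// mulr_ge0 ?sqr_ge0.
pose D := 8 / (L ^+ 2 * N ^+ 2).
have Li : 0 < L^-1 by rewrite invr_gt0.
have N2 : 0 < N / 2 by rewrite divr_gt0.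
have i1 := intg_lor N Li; have i2 := intg_lor N N2.
have i3 := intgZ C (intgD (intgZ W i1) (intgZ D i2)).
have key xi : `|((1 + xi ^+ 2) `^ (s / 2) * normc (fourier (datum a) xi)) ^+ 2| <=
    C * (W * lor N L^-1 xi + D * lor N (N / 2) xi).
  rewrite ger0_norm ?sqr_ge0// exprMn.
  have -> : ((1 + xi ^+ 2) `^ (s / 2)) ^+ 2 = (1 + xi ^+ 2) `^ s.
    by rewrite -powR_mulrn ?powR_ge0// -powRrM; congr (_ `^ _); field.
  apply: (le_trans (ler_wpM2l (powR_ge0 _ _) (fourier_datum_le a xi))).
  by rewrite mulrCA -/C ler_wpM2l//; exact: datum_weight.
have ii : intg (fun xi => ((1 + xi ^+ 2) `^ (s / 2) * normc (fourier (datum a) xi)) ^+ 2).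
  apply: intg_mdom i3 key; apply: measurable_funX; apply: measurable_funM.
    exact: measurable_weight.
  exact: measurable_normc (fourier_datum_measurable a).
apply: Lnorm2_le => //; apply: le_trans hB.
apply: (le_trans (le_Rint ii i3 _)).
  by move=> xi; apply: le_trans (key xi); exact: ler_norm.
rewrite (RintegralZl _ measurableT (intgD (intgZ W i1) (intgZ D i2))).
rewrite (RintegralD measurableT (intgZ W i1) (intgZ D i2)).
rewrite (RintegralZl _ measurableT i1) (RintegralZl _ measurableT i2) !Rint_lor//.
have -> : W * (pi * L^-1) + D * (pi * (N / 2)) = pi / L * (W + 4 / (L * N)).
  by rewrite /D; field; rewrite !gt_eqF.
have -> : 2 * pi * datum_const * a ^+ 2 * L * W = C * (pi / L * (W + W)).
  by rewrite /C; field; rewrite gt_eqF.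
by rewrite ler_wpM2l// ler_wpM2l ?divr_ge0 ?pi_ge0 ?(ltW L0)// lerD2l.
Qed.

End Datum.

(** * Phase separation *)

Section Profiles.
Context {R : realType}.
Local Notation mu := (@lebesgue_measure R).

Lemma gexp_profile (k : nat) (c : R) : (0 < k)%N -> 0 < c ->
  exists f1 f2 : R -> R, exists2 C : R, 1 <= C &
   [/\ forall x, isD (gexp k c 0) x (f1 x), forall x, isD f1 x (f2 x), cont f2 &
    forall x, [/\ `|gexp k c 0 x| <= C * lor 0 1 x, `|f1 x| <= C * lor 0 1 x
      & `|f2 x| <= C * lor 0 1 x]].
Proof.
move=> k0 c0.
have g0 : gclass k c 0 0 0 (gexp k c 0).
  by exists 1%:P, 0 => x; rewrite hornerC horner0 mul0r addr0 !mul0r addr0 cos0 !mul1r.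
have [f1 g1 d1] := gclass_derive g0; have [f2 g2 d2] := gclass_derive g1.
have [f3 _ d3] := gclass_derive g2.
have b f : gclass k c 0 0 0 f -> exists C, forall x, `|f x| <= C * lor 0 1 x.
  move=> gf; have [C hC] := gclass_lor k0 c0 gf 1%:P; exists C => x.
  by have := hC x; rewrite hornerC mul1r.
have [C0 h0] := b _ g0; have [C1 h1] := b _ g1; have [C2 h2] := b _ g2.
pose C := `|C0| + `|C1| + `|C2| + 1.
have le (C' x : R) : C' <= C -> C' * lor 0 1 x <= C * lor 0 1 x.
  by move=> h; rewrite ler_wpM2r ?lor_ge0.
have n0 := normr_ge0 C0; have n1 := normr_ge0 C1; have n2 := normr_ge0 C2.
have m0 := ler_norm C0; have m1 := ler_norm C1; have m2 := ler_norm C2.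
exists f1, f2, C; first by rewrite /C; lra.
split=> //; first exact: derf_cont d3.
move=> x; split.
- by apply: le_trans (h0 x) (le _ _ _); rewrite /C; lra.
- by apply: le_trans (h1 x) (le _ _ _); rewrite /C; lra.
- by apply: le_trans (h2 x) (le _ _ _); rewrite /C; lra.
Qed.

Lemma isD_scale (f f1 : R -> R) (L : R) : (forall x, isD f x (f1 x)) ->
  forall z, isD (fun z => f (z / L)) z (f1 (z / L) / L).
Proof.
move=> h z; apply: isD_eq (isD_comp (isD_mul (isD_id z) (isD_cst L^-1 z)) (h (z / L))) _.
by rewrite mul1r mulr0 addr0 mulrC.
Qed.

Lemma cont_scale (f : R -> R) (L : R) : cont f -> cont (fun z => f (z / L)).
Proof.
move=> cf; apply: (@cont_comp R f) => //.
by apply: cont_mul; [exact: cont_id|exact: cont_cst].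
Qed.

Lemma lor_scale (L z : R) : lor 0 1 (z / L) = lor 0 L z.
Proof. by rewrite /lor !subr0 divr1. Qed.

Lemma lor_scale_le (L z : R) : 1 <= L -> lor 0 L z <= L ^+ 2 * lor 0 1 z.
Proof.
move=> L1; rewrite /lor !subr0 divr1.
have L0 : 0 < L by exact: lt_le_trans L1.
have z2 := sqr_ge0 z; have L2 : 1 <= L ^+ 2 by rewrite expr_ge1// ltW.
have -> : 1 + (z / L) ^+ 2 = (L ^+ 2 + z ^+ 2) / L ^+ 2 by field; rewrite gt_eqF.
rewrite invf_div ler_wpM2l ?(le_trans _ L2)// lef_pV2 ?posrE; lra.
Qed.

Lemma cos_ge_half (x : R) : `|x| <= 2^-1 -> 2^-1 <= cos x.
Proof.
move=> hx; have h (y : R) : 0 <= y -> y <= 2^-1 -> 2^-1 <= cos y.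
  move=> y0 y2; have dc t : isD (fun x : R => - cos x) t (sin t).
    by apply: isD_eq (isD_opp (isD_cos (isD_id t))) _; rewrite mul1r opprK.
  have := @isD_incr_le R _ _ 0 y 1 y0 dc (fun t _ => sin_le1 t).
  by rewrite cos0 subr0 mul1r; lra.
have [x0|x0] := leP 0 x; first by apply: h => //; move: hx; rewrite ger0_norm.
by rewrite -cosN; apply: h; [lra|move: hx; rewrite ltr0_norm].
Qed.

End Profiles.

Section InitialPhase.
Context {R : realType}.
Local Notation mu := (@lebesgue_measure R).

Lemma isD_uniq (f : R -> R) (x a b : R) : isD f x a -> isD f x b -> a = b.
Proof. by move=> [_ <-] [_ <-]. Qed.

Lemma expR2_ge : 4 <= expR 2 :> R.
Proof.
have e1 : 2 <= expR 1 :> R := expR_ge1Dx 1.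
have -> : 2 = 2%:R * 1 :> R by ring.
rewrite expRM_natl; have -> : 4 = 2 ^+ 2 :> R by rewrite -natrX.
by rewrite ler_pXn2r ?nnegrE ?expR_ge0.
Qed.

Lemma expRN8_le : expR (- 8) <= expR (- 2) / 64 :> R.
Proof.
have e2 := expR2_ge.
have -> : - 8 = - 2 + (- (3%:R * 2)) :> R by ring.
rewrite expRD ler_wpM2l ?expR_ge0// expRN lef_pV2 ?posrE ?expR_gt0// expRM_natl.
have -> : 64 = 4 ^+ 3 :> R by rewrite -natrX.
by rewrite ler_pXn2r ?nnegrE ?expR_ge0.
Qed.

Lemma gauss_tail (y : R) : 2^-1 <= `|y| ->
  expR (- (32 * y ^+ 2)) <= 5 / 4 * expR (- 8) * (1 + y ^+ 2)^-1.
Proof.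
move=> y2; have h : 4^-1 <= y ^+ 2.
  rewrite -real_normK ?num_real//.
  have -> : 4^-1 = 2^-1 ^+ 2 :> R by rewrite exprVn -natrX.
  by rewrite ler_pXn2r ?nnegrE.
have -> : - (32 * y ^+ 2) = - 8 + - (32 * (y ^+ 2 - 4^-1)) by field.
rewrite expRD [_ * expR (- 8)]mulrC -mulrA ler_wpM2l ?expR_ge0//.
rewrite expRN; have e := expR_ge1Dx (32 * (y ^+ 2 - 4^-1)).
have e0 := expR_gt0 (32 * (y ^+ 2 - 4^-1)).
have q : 0 < 1 + y ^+ 2 by have := sqr_ge0 y; lra.
rewrite ler_pdivlMr// [leLHS]mulrC ler_pdivrMr//.
apply: (@le_trans _ _ (5 / 4 * (1 + 32 * (y ^+ 2 - 4^-1)))); first lra.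
by rewrite ler_wpM2l.
Qed.

Lemma initial_phase (k : nat) (a T L : R) : (0 < k)%N -> 0 < L -> 0 < a -> 0 <= T ->
  T * a ^+ 2 * (2 / 4 ^+ k) <= 2^-1 ->
  expR (- 2) / 32 * a * L <= \int[mu]_x (a * (expR (- (32 * (x / L) ^+ 2)) *
     (plateau k L x * cos (T * a ^+ 2 * (1 - plateau k L x ^+ 2))))).
Proof.
move=> k0 L0 a0 T0 hk.
set f := fun x => _; set g := fun x => - (a * (5 / 4 * expR (- 8))) * lor 0 L x.
have e80 := expR_gt0 (- 8 : R); have e20 := expR_gt0 (- 2 : R).
have wle x := @plateau_le1 R k L L0 x; have wgt x := plateau_gt0 k L x.
have w_lb x : `|x / L| <= 2^-1 -> 1 - (4 ^+ k)^-1 <= plateau k L x.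
  move=> h; rewrite plateauE; apply: le_trans (expR_ge1Dx _).
  rewrite lerD2l lerN2 exprM -exprVn lerXn2r ?nnegrE ?sqr_ge0 ?invr_ge0//.
  rewrite -real_normK ?num_real//.
  have -> : 4^-1 = 2^-1 ^+ 2 :> R by rewrite exprVn -natrX.
  by rewrite ler_pXn2r ?nnegrE.
have k4 : 4 <= 4 ^+ k :> R by rewrite -{1}[4]expr1 ler_weXn2l// ler1n.
have k40 : 0 < 4 ^+ k :> R by rewrite exprn_gt0.
have kV : (4 ^+ k)^-1 <= 4^-1 :> R by rewrite lef_pV2 ?posrE.
have cosb x : `|x / L| <= 2^-1 -> 2^-1 <= cos (T * a ^+ 2 * (1 - plateau k L x ^+ 2)).
  move=> h; apply: cos_ge_half; have w1 := w_lb x h.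
  have Ta : 0 <= T * a ^+ 2 by rewrite mulr_ge0 ?sqr_ge0.
  have p1 : 0 <= 1 - plateau k L x ^+ 2 by have := wgt x; have := wle x; nra.
  rewrite (ger0_norm (mulr_ge0 Ta p1)); apply: (le_trans _ hk); rewrite ler_wpM2l//.
  have := wgt x; have := wle x; nra.
have gE x : expR (- (32 * (x / L) ^+ 2)) = gexp 1 32 0 (x / L).
  by rewrite /gexp subr0 muln1.
have cf : cont f.
  rewrite /f; apply: (contM (contC a)); apply: contM.
    by apply: (@cont_comp R expR); [exact: cont_expR|];
      apply: cont_opp; apply: (contM (contC 32)); apply: contX;
      exact: (contM contid (contC _)).
  apply: (contM (@plateau_cont R k L)); apply: (@cont_comp R cos); first exact: cont_cos.
  by apply: (contM (contC _)); apply: contB; [exact: (contC 1)|apply: contX; exact: plateau_cont].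
have fb x : `|f x| <= a * expR (- (32 * (x / L) ^+ 2)).
  rewrite /f !normrM (gtr0_norm a0) (ger0_norm (expR_ge0 _)) ler_wpM2l ?(ltW a0)//.
  rewrite ler_piMr ?expR_ge0// mulr_ile1//; first by rewrite (gtr0_norm (wgt x)).
  by rewrite ler_norml cos_geN1 cos_le1.
have lE x : (1 + (x / L) ^+ 2)^-1 = lor 0 L x by rewrite /lor subr0.
have intf : intg f.
  apply: (@intg_lordom _ _ a 0 L) => // x; apply: le_trans (fb x) _.
  rewrite ler_wpM2l ?(ltW a0)// -lE; apply: le_trans (lor_expR _).
  by rewrite ler_expR lerN2; have := sqr_ge0 (x / L); lra.
have C0 : 0 <= a * (5 / 4 * expR (- 8)) by rewrite !mulr_ge0 ?expR_ge0 ?(ltW a0).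
have intG : intg g by exact/intgZ/intg_lor.
have gneg x : g x <= 0 by rewrite /g mulNr oppr_le0 mulr_ge0 ?lor_ge0.
have fpos x : `|x / L| <= 2^-1 -> 0 <= f x.
  move=> h; rewrite /f mulr_ge0 ?(ltW a0)// mulr_ge0 ?expR_ge0// mulr_ge0 ?(ltW (wgt x))//.
  by apply: le_trans (cosb x h).
have gf x : g x <= f x.
  have [h|h] := leP `|x / L| 2^-1; first exact: le_trans (gneg x) (fpos x h).
  rewrite /g mulNr lerNl; apply: le_trans (ler_norm _) _; rewrite normrN.
  apply: le_trans (fb x) _; rewrite -(mulrA a (5 / 4 * expR (- 8))) ler_wpM2l ?(ltW a0)// -lE.
  exact: gauss_tail (ltW h).
have box x : - (L / 4) <= x <= L / 4 -> a * expR (- 2) / 4 + g x <= f x.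
  move=> hx; have h4 : `|x / L| <= 4^-1.
    by rewrite normrM [`|L^-1|]gtr0_norm ?invr_gt0// ler_pdivrMr// ler_norml; move: hx; lra.
  have h2 : `|x / L| <= 2^-1 by apply: le_trans h4 _; lra.
  have e : expR (- 2) <= expR (- (32 * (x / L) ^+ 2)).
    rewrite ler_expR lerN2.
    have : (x / L) ^+ 2 <= 4^-1 ^+ 2.
      by rewrite -real_normK ?num_real// ler_pXn2r ?nnegrE.
    lra.
  have cb := cosb x h2; have wb := w_lb x h2.
  have wc : 4^-1 <= plateau k L x * cos (T * a ^+ 2 * (1 - plateau k L x ^+ 2)).
    have -> : 4^-1 = 2^-1 * 2^-1 :> R by field.
    by apply: ler_pM => //; lra.
  apply: (@le_trans _ _ (a * expR (- 2) / 4)); first by rewrite gerDl.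
  rewrite /f -(mulrA a (expR (- 2))) ler_wpM2l ?(ltW a0)//; apply: ler_pM => //.
have ab : - (L / 4) <= L / 4 by lra.
have k00 : 0 <= a * expR (- 2) / 4 by rewrite divr_ge0// mulr_ge0 ?expR_ge0 ?(ltW a0).
have := Rint_ge_box ab k00 intf intG gf box.
rewrite (RintegralZl _ measurableT (intg_lor 0 L0)) Rint_lor//; apply: le_trans.
have e8 := expRN8_le; have p4 : pi < 4 :> R by have := @pihalf_lt2 R; lra.
have p0 := @pi_gt0 R.
have -> : expR (- 2) / 32 * a * L = (a * L) * (expR (- 2) / 32) by ring.
have -> : a * expR (- 2) / 4 * (L / 4 - - (L / 4)) +
  - (a * (5 / 4 * expR (- 8))) * (pi * L) = (a * L) * (expR (- 2) / 8 - 5 / 4 * (expR (- 8) * pi)).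
  by field.
rewrite ler_wpM2l ?mulr_ge0 ?(ltW a0) ?(ltW L0)//.
have : expR (- 8) * pi <= expR (- 2) / 64 * 4 :> R.
  apply: (@le_trans _ _ (expR (- 2) / 64 * pi)); first by rewrite ler_wpM2r// ltW.
  by rewrite ler_wpM2l ?divr_ge0 ?expR_ge0// ltW.
lra.
Qed.

End InitialPhase.

Section SolutionPhase.
Context {R : realType}.
Local Notation mu := (@lebesgue_measure R).

Let plateau_scale (k : nat) (L x : R) : plateau k L x = gexp k 1 0 (x / L).
Proof. by rewrite plateauE /gexp subr0 mul1r. Qed.

Let plateau_sqr (k : nat) (L x : R) : plateau k L x ^+ 2 = gexp k 2 0 (x / L).
Proof. by rewrite plateauE /gexp subr0 -expRM_natl mulrN. Qed.

Ltac cleaf ::= match goal with |- cont (fun z => ?f (z / ?L)) =>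
  apply: (@cont_scale _ f L); assumption end.

Lemma solution_phase (k : nat) (a T : R) : (0 < k)%N -> 1 <= a -> 0 <= T -> T <= 1 ->
  T * a ^+ 2 * (2 / 4 ^+ k) <= 2^-1 ->
  exists2 L0 : R, 1 <= L0 & forall (L N : R) (k0 : (0 < k)%N) (hL : 0 < L)
    (u : R -> schwartz R), L0 <= L -> nls_solution (datum N k0 hL a) u ->
  expR (- 2) / 64 * a * L <= \int[mu]_x (expR (- (32 * ((x + 2 * N * T) / L) ^+ 2)) *
    (sre 0 (u T) x * cos (N * x + N ^+ 2 * T + T * a ^+ 2)
     + sim 0 (u T) x * sin (N * x + N ^+ 2 * T + T * a ^+ 2))).
Proof.
move=> k0 a1 T0 T1 hk.
have [b1 [b2 [Cb Cb1 [db1 db2 cb2 hb]]]] := gexp_profile k0 (ltr0Sn R 1).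
have [w1 [w2 [Cw Cw1 [dw1 _ _ hw]]]] := gexp_profile k0 (@ltr01 R).
have [g1 [g2 [Cg Cg1 [dg1 dg2 cg2 hg]]]] := gexp_profile (isT : (0 < 1)%N) (ltr0Sn R 31).
pose C := Cb + Cw + Cg.
have C0 : 0 <= C by rewrite /C; lra.
have up (C' v l : R) : C' <= C -> 0 <= l -> `|v| <= C' * l -> `|v| <= C * l.
  by move=> h l0 hv; apply: (le_trans hv); rewrite ler_wpM2r.
have {hb} hb y : [/\ `|gexp k 2 0 y| <= C * lor 0 1 y, `|b1 y| <= C * lor 0 1 y
    & `|b2 y| <= C * lor 0 1 y].
  by have [? ? ?] := hb y; split; (apply: (up Cb); [rewrite /C; lra|exact: lor_ge0|by []]).
have {hw} hw y : `|gexp k 1 0 y| <= C * lor 0 1 y /\ `|w1 y| <= C * lor 0 1 y.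
  by have [? ? ?] := hw y; split; (apply: (up Cw); [rewrite /C; lra|exact: lor_ge0|by []]).
have {hg} hg y : [/\ `|gexp 1 32 0 y| <= C * lor 0 1 y, `|g1 y| <= C * lor 0 1 y
    & `|g2 y| <= C * lor 0 1 y].
  by have [? ? ?] := hg y; split; (apply: (up Cg); [rewrite /C; lra|exact: lor_ge0|by []]).
have lC y : C * lor 0 1 y <= C by rewrite ler_piMr// lor_le1.
pose A := a ^+ 2; have A0 : 0 <= A by rewrite sqr_ge0.
pose c1 := 1 + 2 * (A * C) ^+ 2.
pose q1 := C * (1 + (A * C) ^+ 2); pose q2 := A * (3 * C ^+ 2).
pose Q := q1 ^+ 2 + q2 ^+ 2; pose Q2 := (2 * A + c1 * A) * C ^+ 2.
pose Err := expR 1 * (Q2 * pi) + Q * pi.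
exists (1 + 64 * expR 2 * `|Err|).
  by rewrite lerDl mulr_ge0 ?normr_ge0// mulr_ge0 ?expR_ge0.
move=> L N k0' L0 u hL [[D D0 DS] u0 nls].
have L1 : 1 <= L.
  apply: le_trans hL; rewrite lerDl mulr_ge0// mulr_ge0 ?expR_ge0//.
have a0 : 0 < a by exact: lt_le_trans a1.
pose i := L^-1; have i0 : 0 < i by rewrite invr_gt0.
have i1 : i <= 1 by rewrite invf_le1.
have iL : i * L = 1 by rewrite mulVf// gt_eqF.
pose b z := A * gexp k 2 0 (z / L); pose db z := A * (b1 (z / L) * i).
pose ddb z := A * (b2 (z / L) * i * i).
pose G z := gexp 1 32 0 (z / L); pose dG z := g1 (z / L) * i; pose ddG z := g2 (z / L) * i * i.
pose c := c1 * i ^+ 2.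
have Hb z : isD b z (db z) by apply: isD_cmul; exact: isD_scale.
have Hdb z : isD db z (ddb z).
  have h := isD_cmul A (isD_mul (isD_scale (f := b1) L db2 z) (isD_cst i z)).
  by apply: isD_eq h _; rewrite mulr0 addr0.
have HG z : isD G z (dG z) by exact: isD_scale.
have HdG z : isD dG z (ddG z).
  have h := isD_mul (isD_scale (f := g1) L dg2 z) (isD_cst i z).
  by apply: isD_eq h _; rewrite mulr0 addr0.
have cddb : cont ddb.
  rewrite /ddb; crec.
have cddG : cont ddG.
  rewrite /ddG; crec.
have cdb : cont db := derf_cont Hdb.
have AC0 : 0 <= A * C by rewrite mulr_ge0.
have c10 : 1 <= c1 by rewrite /c1 lerDl mulr_ge0 ?sqr_ge0.
have c1_0 : 0 <= c1 by apply: le_trans c10.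
have ab1 y : `|A * b1 y| <= A * C.
  rewrite normrM (ger0_norm A0) ler_wpM2l//; have [_ h _] := hb y; exact: le_trans h (lC y).
have sqle (v m : R) : `|v| <= m -> v ^+ 2 <= m ^+ 2.
  move=> h; rewrite -real_normK ?num_real// ler_pXn2r ?nnegrE//.
  exact: le_trans h.
have dbC z : 2 * db z ^+ 2 <= c.
  rewrite /db mulrA exprMn mulrA /c ler_wpM2r ?sqr_ge0//.
  have := sqle _ _ (ab1 (z / L)); rewrite /c1; lra.
have bC z : `|b z| <= A * (C * L ^+ 2) * lor 0 1 z.
  rewrite normrM (ger0_norm A0) -(mulrA A) ler_wpM2l//.
  have [h _ _] := hb (z / L); apply: (le_trans h); rewrite lor_scale -mulrA ler_wpM2l//.
  exact: lor_scale_le.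
pose CG := C + A * C.
have ibd (v m : R) : `|v| <= m -> `|v * i| <= m.
  move=> h; rewrite normrM (gtr0_norm i0); apply: le_trans h.
  by rewrite ler_piMr.
have GC z : `|G z| <= CG.
  by have [h _ _] := hg (z / L); apply: (le_trans (le_trans h (lC _))); rewrite lerDl.
have dGC z : `|dG z| <= CG.
  apply: (ibd); have [_ h _] := hg (z / L).
  by apply: (le_trans (le_trans h (lC _))); rewrite lerDl.
have ddGC z : `|ddG z| <= CG.
  do 2!apply: (ibd); have [_ _ h] := hg (z / L).
  by apply: (le_trans (le_trans h (lC _))); rewrite lerDl.
have ddbC z : `|ddb z| <= CG.
  rewrite /ddb normrM (ger0_norm A0); apply: (@le_trans _ _ (A * C)); last by rewrite lerDr.
  rewrite ler_wpM2l//; do 2!apply: (ibd); have [_ _ h] := hb (z / L).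
  exact: le_trans h (lC _).
have cK : 1 <= c * L ^+ 2 by rewrite /c -mulrA -exprMn iL expr1n mulr1.
have G1 z : G z ^+ 2 <= 1.
  by rewrite exprn_ile1 ?(ltW (gexp_gt0 _ _ _ _)) ?gexp_le1.
have AB tau z : - T <= tau <= 0 ->
    (ddG z - tau ^+ 2 * db z ^+ 2 * G z) ^+ 2
    + (2 * tau * db z * dG z + tau * ddb z * G z) ^+ 2 <= (Q * i ^+ 4) * lor 0 L z.
  move=> htau; have tau1 : `|tau| <= 1 by rewrite ler_norml; lra.
  have tau2 : tau ^+ 2 <= 1 by have := sqle _ _ tau1; rewrite expr1n.
  rewrite -lor_scale /ddG /db /G /dG /ddb; set y := z / L; set l := lor 0 1 y.
  have l0 : 0 <= l := lor_ge0 _ _ _; have l1 : l <= 1 := lor_le1 _ _ _.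
  have [_ hb1 hb2] := hb y; have [hG hg1 hg2] := hg y.
  have [b1C b2C] := (le_trans hb1 (lC y), le_trans hb2 (lC y)).
  have [GC' g1C] := (le_trans hG (lC y), le_trans hg1 (lC y)).
  have X1 : `|g2 y - tau ^+ 2 * (A * b1 y) ^+ 2 * gexp 1 32 0 y| <= q1 * l.
    have e3 : `|tau ^+ 2 * (A * b1 y) ^+ 2| <= (A * C) ^+ 2.
      have tb : 0 <= tau ^+ 2 * (A * b1 y) ^+ 2 by apply: mulr_ge0; exact: sqr_ge0.
      rewrite (ger0_norm tb) -[leRHS]mul1r.
      by apply: ler_pM; [exact: sqr_ge0|exact: sqr_ge0|by []|exact: sqle (ab1 y)].
    have e4 : `|tau ^+ 2 * (A * b1 y) ^+ 2 * gexp 1 32 0 y| <= (A * C) ^+ 2 * (C * l).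
      by rewrite normrM; apply: ler_pM.
    have -> : q1 * l = C * l + (A * C) ^+ 2 * (C * l) by rewrite /q1; ring.
    exact: le_trans (ler_normB _ _) (lerD hg2 e4).
  have X2 : `|tau * (A * (2 * (b1 y * g1 y) + b2 y * gexp 1 32 0 y))| <= q2 * l.
    rewrite normrM -[leRHS]mul1r; apply: ler_pM => //.
    rewrite normrM (ger0_norm A0) /q2 -mulrA ler_wpM2l//.
    apply: (le_trans (ler_normD _ _)).
    have e1 : `|2 * (b1 y * g1 y)| <= 2 * (C * (C * l)).
      rewrite normrM (ger0_norm (ler0n _ 2)); apply: ler_wpM2l => //.
      by rewrite normrM; apply: ler_pM.
    have e2 : `|b2 y * gexp 1 32 0 y| <= C * (C * l) by rewrite normrM; apply: ler_pM.
    by rewrite expr2; lra.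
  have Y1 := sqle _ _ X1; have Y2 := sqle _ _ X2.
  have -> : g2 y * i * i - tau ^+ 2 * (A * (b1 y * i)) ^+ 2 * gexp 1 32 0 y =
    i ^+ 2 * (g2 y - tau ^+ 2 * (A * b1 y) ^+ 2 * gexp 1 32 0 y) by ring.
  have -> : 2 * tau * (A * (b1 y * i)) * (g1 y * i) + tau * (A * (b2 y * i * i)) * gexp 1 32 0 y =
    i ^+ 2 * (tau * (A * (2 * (b1 y * g1 y) + b2 y * gexp 1 32 0 y))) by ring.
  set x1 := _ - _ in Y1 *; set x2 := tau * _ in Y2 *.
  have -> : (i ^+ 2 * x1) ^+ 2 + (i ^+ 2 * x2) ^+ 2 = i ^+ 4 * (x1 ^+ 2 + x2 ^+ 2) by ring.
  have -> : Q * i ^+ 4 * l = i ^+ 4 * (Q * l) by ring.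
  rewrite ler_wpM2l ?exprn_ge0 ?(ltW i0)//; apply: (le_trans (lerD Y1 Y2)).
  rewrite (exprMn 2 q1) (exprMn 2 q2) -mulrDl -/Q ler_wpM2l ?addr_ge0 ?sqr_ge0//.
  by rewrite expr2 ler_piMr.
have P := phase_lower D0 DS nls N Hb cdb bC dbC (T * a ^+ 2) HG HdG Hdb cddG cddb
  GC dGC ddGC ddbC T0 L0 L0 cK G1 AB.
have {hL} hL : 64 * expR 2 * `|Err| <= L by apply: le_trans hL; rewrite lerDr.
have CS x := cos2Dsin2 (N * x).
have dpl x : isD (plateau k L) x (w1 (x / L) * i).
  have h := isD_scale L dw1 x; rewrite (_ : plateau k L = fun z => gexp k 1 0 (z / L))//.
  by apply/funext => z; exact: plateau_scale.
pose dat : schwartz R := datum N k0' L0 a.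
have re0 x : sre 0 dat x = a * (cos (N * x) * plateau k L x) by [].
have im0 x : sim 0 dat x = a * (sin (N * x) * plateau k L x) by [].
have re1 x : sre 1 dat x = a * (- (N * sin (N * x)) * plateau k L x + cos (N * x) * (w1 (x / L) * i)).
  apply: isD_uniq (derf_sre 0 dat x) _.
  have h := isD_cmul a (isD_mul (isD_cos (isD_cmul N (isD_id x))) (dpl x)).
  by apply: isD_eq h _; ring.
have im1 x : sim 1 dat x = a * (N * cos (N * x) * plateau k L x + sin (N * x) * (w1 (x / L) * i)).
  apply: isD_uniq (derf_sim 0 dat x) _.
  have h := isD_cmul a (isD_mul (isD_sin (isD_cmul N (isD_id x))) (dpl x)).
  by apply: isD_eq h _; ring.
have b0 x : b (x + 2 * N * 0) = A * plateau k L x ^+ 2 by rewrite mulr0 addr0 plateau_sqr.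
have E0 x : endens u N c b 0 x = 2 * A * (w1 (x / L) * i) ^+ 2 + c * (A * plateau k L x ^+ 2).
  rewrite /endens u0 -/dat b0 re0 im0 re1 im1 /A.
  move: (CS x) (w1 (x / L)) (plateau k L x); set Co := cos _; set Si := sin _ => cs W1 W.
  transitivity (2 * (a ^+ 2 * (W1 * i) ^+ 2 * (Co ^+ 2 + Si ^+ 2))
    + (a ^+ 2 * W ^+ 2 * (Co ^+ 2 + Si ^+ 2) - a ^+ 2 * W ^+ 2) ^+ 2
    + c * (a ^+ 2 * W ^+ 2 * (Co ^+ 2 + Si ^+ 2))); first by ring.
  by rewrite cs; ring.
have E00 x : 0 <= endens u N c b 0 x.
  by apply: endens_ge0; rewrite /c; apply: mulr_ge0 => //; exact: sqr_ge0.
have ie := intg_endens D0 DS N c Hb bC 0.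
have Z0 : \int[mu]_x endens u N c b 0 x <= Q2 * i ^+ 2 * (pi * L).
  rewrite -(Rint_lor 0 L0) -(RintegralZl _ measurableT (intg_lor 0 L0)).
  apply: le_Rint => //; first exact/intgZ/intg_lor.
  move=> x; rewrite E0 -lor_scale plateau_scale.
  have [h1 h2] := hw (x / L); have l0 := @lor_ge0 R 0 1 (x / L); have l1 := @lor_le1 R 0 1 (x / L).
  set l := lor 0 1 (x / L) in h1 h2 l0 l1 *.
  have sq (v : R) : `|v| <= C * l -> v ^+ 2 <= C ^+ 2 * l.
    move=> /sqle h; apply: (le_trans h); rewrite exprMn ler_wpM2l ?sqr_ge0//.
    by rewrite expr2 ler_piMr.
  have s1 := sq _ h1; have s2 := sq _ h2.
  have i2 : 0 <= i ^+ 2 := sqr_ge0 i.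
  have t1 : 2 * A * (w1 (x / L) * i) ^+ 2 <= 2 * A * i ^+ 2 * (C ^+ 2 * l).
    have -> : 2 * A * (w1 (x / L) * i) ^+ 2 = 2 * A * i ^+ 2 * w1 (x / L) ^+ 2 by ring.
    by apply: ler_wpM2l => //; rewrite mulr_ge0// mulr_ge0.
  have t2 : c * (A * gexp k 1 0 (x / L) ^+ 2) <= c1 * i ^+ 2 * (A * (C ^+ 2 * l)).
    apply: ler_wpM2l; first by rewrite mulr_ge0.
    exact: ler_wpM2l.
  apply: (le_trans (lerD t1 t2)); rewrite /Q2.
  by rewrite le_eqVlt; apply/orP; left; apply/eqP; ring.
have I0 := initial_phase k0 L0 a0 T0 hk.
have IE : \int[mu]_x phdens u N b T (T * a ^+ 2) G 0 x =
   \int[mu]_x (a * (expR (- (32 * (x / L) ^+ 2)) *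
     (plateau k L x * cos (T * a ^+ 2 * (1 - plateau k L x ^+ 2))))).
  apply: eq_Rintegral => x _; rewrite /phdens u0 -/dat b0 re0 im0 /G mulr0 !addr0.
  have -> : gexp 1 32 0 (x / L) = expR (- (32 * (x / L) ^+ 2)) by rewrite /gexp subr0 muln1.
  have -> : T * a ^+ 2 * (1 - plateau k L x ^+ 2) =
    (N * x + N ^+ 2 * 0 + T * a ^+ 2 + A * plateau k L x ^+ 2 * (0 - T)) - N * x.
    by rewrite /A; ring.
  by rewrite cosB; ring.
have TE : \int[mu]_x phdens u N b T (T * a ^+ 2) G T x =
  \int[mu]_x (expR (- (32 * ((x + 2 * N * T) / L) ^+ 2)) *
    (sre 0 (u T) x * cos (N * x + N ^+ 2 * T + T * a ^+ 2)
     + sim 0 (u T) x * sin (N * x + N ^+ 2 * T + T * a ^+ 2))).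
  apply: eq_Rintegral => x _; rewrite /phdens subrr mulr0 addr0 /G.
  by rewrite /gexp subr0 muln1.
rewrite -TE; apply: le_trans P; rewrite IE.
have Q0 : 0 <= Q by rewrite addr_ge0 ?sqr_ge0.
have Q20 : 0 <= Q2.
  by apply: mulr_ge0; [apply: addr_ge0; exact: mulr_ge0|exact: sqr_ge0].
have p0 := @pi_ge0 R.
have err : T * (L * (expR T * (\int[mu]_x endens u N c b 0 x)) + L / 2 * (Q * i ^+ 4 * (pi * L)))
   <= `|Err|.
  apply: le_trans (ler_norm _); rewrite /Err -[leRHS]mul1r; apply: ler_pM => //.
    apply: addr_ge0; last first.
      by rewrite !mulr_ge0 ?exprn_ge0 ?(ltW i0) ?(ltW L0).
    rewrite mulr_ge0 ?(ltW L0)// mulr_ge0 ?expR_ge0//.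
    by apply: Rintegral_ge0 => x _; exact: E00.
  apply: lerD.
    apply: (@le_trans _ _ (L * (expR 1 * (Q2 * i ^+ 2 * (pi * L))))).
      rewrite ler_wpM2l ?(ltW L0)//; apply: ler_pM; rewrite ?expR_ge0 ?ler_expR//.
      by apply: Rintegral_ge0 => x _; exact: E00.
    rewrite (_ : L * _ = (i * L) ^+ 2 * (expR 1 * (Q2 * pi))); last by ring.
    by rewrite iL expr1n mul1r.
  rewrite (_ : L / 2 * _ = (i * L) ^+ 2 * (i ^+ 2 / 2) * (Q * pi)); last by field.
  rewrite iL expr1n mul1r ler_piMl ?mulr_ge0//.
  have : i ^+ 2 <= 1 by rewrite expr_le1// ltW.
  lra.
have e : 64 * `|Err| <= expR (- 2) * a * L.
  have : 64 * `|Err| <= expR (- 2) * L.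
    rewrite expRN ler_pdivlMl ?expR_gt0//; apply: le_trans hL.
    by rewrite mulrCA mulrA.
  move=> h; apply: (le_trans h); rewrite ler_wpM2r ?(ltW L0)//.
  by rewrite ler_peMr ?expR_ge0.
by move: I0 err e; lra.
Qed.

End SolutionPhase.

Section IllPosed.
Context {R : realType}.
Local Notation mu := (@lebesgue_measure R).

Lemma distr_gauss (U : schwartz R) (P0 L N T theta : R) (psi : schwartz R) :
  (forall x, complex.Re (psi x) = P0 * cos (- N * x + (N ^+ 2 * T - theta - N * (2 * N * T)))
     * expR (- (32 * ((x + 2 * N * T) / L) ^+ 2))) ->
  (forall x, complex.Im (psi x) = P0 * sin (- N * x + (N ^+ 2 * T - theta - N * (2 * N * T)))
     * expR (- (32 * ((x + 2 * N * T) / L) ^+ 2))) ->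
  complex.Re (distr U psi) = \int[mu]_x (P0 * (expR (- (32 * ((x + 2 * N * T) / L) ^+ 2)) *
    (sre 0 U x * cos (N * x + N ^+ 2 * T + theta)
     + sim 0 U x * sin (N * x + N ^+ 2 * T + theta)))).
Proof.
move=> hr hi; rewrite /distr /=; apply: eq_Rintegral => x _.
have -> : complex.Re (U x * psi x) =
    sre 0 U x * complex.Re (psi x) - sim 0 U x * complex.Im (psi x).
  by rewrite sre_val sim_val; case: (U x) (psi x) => [? ?] [].
rewrite hr hi.
have -> : - N * x + (N ^+ 2 * T - theta - N * (2 * N * T)) = - (N * x + N ^+ 2 * T + theta) by ring.
by rewrite cosN sinN; ring.
Qed.

Lemma separation (L N T P0 th1 th2 J : R) (U1 U2 psi : schwartz R) : 0 <= P0 ->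
  th2 = th1 + pi ->
  (forall x, complex.Re (psi x) = P0 * cos (- N * x + (N ^+ 2 * T - th1 - N * (2 * N * T)))
     * expR (- (32 * ((x + 2 * N * T) / L) ^+ 2))) ->
  (forall x, complex.Im (psi x) = P0 * sin (- N * x + (N ^+ 2 * T - th1 - N * (2 * N * T)))
     * expR (- (32 * ((x + 2 * N * T) / L) ^+ 2))) ->
  (forall U th, (U, th) = (U1, th1) \/ (U, th) = (U2, th2) ->
    J <= \int[mu]_x (expR (- (32 * ((x + 2 * N * T) / L) ^+ 2)) *
    (sre 0 U x * cos (N * x + N ^+ 2 * T + th)
     + sim 0 U x * sin (N * x + N ^+ 2 * T + th)))) ->
  P0 * (2 * J) <= complex.Re ((distr U1 - distr U2) psi).
Proof.
move=> P00 th21 hr hi hJ.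
have ci U th : intg (fun x => expR (- (32 * ((x + 2 * N * T) / L) ^+ 2)) *
    (sre 0 U x * cos (N * x + N ^+ 2 * T + th)
     + sim 0 U x * sin (N * x + N ^+ 2 * T + th))).
  have [C hC] := normc_val_lor U.
  have cl : cont (fun x : R => N * x + N ^+ 2 * T + th).
    by apply: contD (contC th); apply: contD (contC _); exact: (contM (contC N) contid).
  have cc : cont (fun x : R => cos (N * x + N ^+ 2 * T + th)).
    by apply: (@cont_comp R cos); first exact: cont_cos.
  have cs : cont (fun x : R => sin (N * x + N ^+ 2 * T + th)).
    by apply: (@cont_comp R sin); first exact: cont_sin.
  have ce : cont (fun x : R => expR (- (32 * ((x + 2 * N * T) / L) ^+ 2))).
    apply: (@cont_comp R expR); first exact: cont_expR.
    apply: cont_opp; apply: (contM (contC 32)); apply: contX.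
    exact: (contM (contD contid (contC _)) (contC _)).
  apply: (@intg_lordom _ _ (C + C) 0 1) => //.
    exact: (contM ce (contD (contM (@cont_Re R U) cc) (contM (@cont_Im R U) cs))).
  move=> x; rewrite normrM -[leRHS]mul1r; apply: ler_pM => //.
    rewrite ger0_norm ?expR_ge0// -expR0 ler_expR oppr_le0 mulr_ge0 ?sqr_ge0//.
  have hx := hC x; rewrite mulrDl.
  apply: (le_trans (ler_normD _ _)); apply: lerD; rewrite normrM.
    apply: le_trans hx; apply: le_trans (@Re_le_normc R (U x)).
    by rewrite ler_piMr// ler_norml cos_geN1 cos_le1.
  apply: le_trans hx; apply: le_trans (@Im_le_normc R (U x)).
  by rewrite ler_piMr// ler_norml sin_geN1 sin_le1.
have -> : complex.Re ((distr U1 - distr U2) psi) =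
    complex.Re (distr U1 psi) - complex.Re (distr U2 psi).
  by rewrite !fctE; case: (distr U1 psi) (distr U2 psi) => [? ?] [].
rewrite (distr_gauss U1 hr hi) (distr_gauss U2 hr hi).
rewrite (RintegralZl _ measurableT (ci U1 th1)) (RintegralZl _ measurableT (ci U2 th1)).
have -> : \int[mu]_x (expR (- (32 * ((x + 2 * N * T) / L) ^+ 2)) *
    (sre 0 U2 x * cos (N * x + N ^+ 2 * T + th1)
     + sim 0 U2 x * sin (N * x + N ^+ 2 * T + th1))) =
  - \int[mu]_x (expR (- (32 * ((x + 2 * N * T) / L) ^+ 2)) *
    (sre 0 U2 x * cos (N * x + N ^+ 2 * T + th2)
     + sim 0 U2 x * sin (N * x + N ^+ 2 * T + th2))).
  rewrite -[RHS]mulN1r -(RintegralZl _ measurableT (ci U2 th2)); apply: eq_Rintegral => x _.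
  by rewrite th21 addrA cosDpi sinDpi; ring.
rewrite mulrN opprK -mulrDr ler_wpM2l//.
have h1 := hJ U1 th1 (or_introl erefl); have h2 := hJ U2 th2 (or_intror erefl).
lra.
Qed.


Lemma phase_amplitudes (D delta : R) : 0 < D -> 0 < delta ->
  exists a b : R, [/\ 1 <= a, a <= b, b <= 2 * a, b ^+ 2 = a ^+ 2 + D & b - a < delta * (4 * a)].
Proof.
move=> D0 d0; have Dd : 0 < D / delta by rewrite divr_gt0.
pose a := 1 + D + D / delta.
have a1 : 1 <= a by rewrite /a; lra.
have aD : D <= a by rewrite /a; lra.
have aDd : D <= delta * a by rewrite mulrC -ler_pdivrMr// /a; lra.
have aa : a <= a ^+ 2 by rewrite expr2 ler_peMl//; lra.
pose b := Num.sqrt (a ^+ 2 + D).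
have bE : b ^+ 2 = a ^+ 2 + D by rewrite sqr_sqrtr// addr_ge0 ?sqr_ge0// ltW.
have b0 : 0 <= b := sqrtr_ge0 _.
have a0 : 0 < a by lra.
have ab : a <= b by rewrite -(@ler_pXn2r _ 2) ?nnegrE ?(ltW a0)// bE lerDl ltW.
exists a, b; split => //.
  have h : 0 <= 2 * a by rewrite mulr_ge0// ltW.
  by rewrite -(@ler_pXn2r _ 2) ?nnegrE// bE exprMn; move: aa aD; nra.
have h : (b - a) * (a + a) <= D by move: bE ab a0; nra.
have h2 : D < delta * (4 * a) * (a + a).
  apply: (le_lt_trans aDd); have : 0 < delta * a by rewrite mulr_gt0.
  by move: a1; nra.
have h3 : 0 < a + a by lra.
by rewrite -(ltr_pM2r h3); exact: le_lt_trans h2.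
Qed.

Lemma frequency_scale (s c M : R) : s < 0 -> 0 < c ->
  exists L N, [/\ M <= L, 1 <= N, 4 * c <= N & (N ^+ 2 / 4) `^ s = (c * L)^-1].
Proof.
move=> s0 c0; pose X := (1 + 4 * c) ^+ 2.
have r0 : 0 < - s by rewrite oppr_gt0.
have X0 : 0 < X by rewrite exprn_gt0// addr_gt0// mulr_gt0.
pose L := `|M| + X `^ (- s) / c.
have hL : X `^ (- s) <= c * L.
  by rewrite mulrC -ler_pdivrMr// /L lerDr.
have L0 : 0 < c * L := lt_le_trans (powR_gt0 _ X0) hL.
pose Y := (c * L) `^ (- s)^-1.
have Y0 : 0 < Y by rewrite powR_gt0.
have XY : X <= Y.
  have -> : X = (X `^ (- s)) `^ (- s)^-1.
    by rewrite -powRrM divff ?gt_eqF// powRr1// ltW.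
  by rewrite ge0_ler_powR ?nnegrE ?powR_ge0 ?invr_ge0 ?(ltW r0) ?(ltW L0).
have N0 : 1 + 4 * c <= Num.sqrt Y.
  rewrite -(@ler_pXn2r _ 2) ?nnegrE ?sqrtr_ge0//; last by rewrite addr_ge0// mulr_ge0// ltW.
  by rewrite sqr_sqrtr// ltW.
exists L, (2 * Num.sqrt Y); split.
- by rewrite /L (le_trans (ler_norm M))// lerDl divr_ge0 ?powR_ge0 ?ltW.
- by move: N0 c0; lra.
- by move: N0 c0; lra.
have -> : (2 * Num.sqrt Y) ^+ 2 / 4 = Y by rewrite exprMn sqr_sqrtr ?(ltW Y0)//; field.
by rewrite -powRrM invrN mulNr mulVf ?lt_eqF// powR_inv1// ltW.
Qed.

End IllPosed.

Theorem theorem2 (R : realType) (S : schwartz R -> R -> schwartz R)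
    (HS : is_solution_map S) (s : R) (hs : s < 0) :
  ~ locally_well_posed S s.
Proof.
move=> /(_ 1 ltr01) [tau tau0 [Phi [[_ UC Ext] _]]].
pose T := Num.min tau 1 / 2.
have m0 : 0 < Num.min tau 1 by rewrite lt_min tau0 ltr01.
have m1 : Num.min tau 1 <= 1 by rewrite ge_min lexx orbT.
have m2 : Num.min tau 1 <= tau by rewrite ge_min lexx.
have T0 : 0 < T by rewrite divr_gt0.
have T1 : T <= 1 by rewrite /T; lra.
have Ttau : T < tau by rewrite /T; lra.
pose r := - s; have r0 : 0 < r by rewrite oppr_gt0.
have [eps [e0 e1 er]] : exists eps, [/\ 0 < eps, eps <= 1 & 2 * (eps * r) <= 1].
  have q : 0 < 1 + 2 * r by rewrite addr_gt0 ?mulr_gt0.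
  exists (1 + 2 * r)^-1; split.
  - by rewrite invr_gt0.
  - by rewrite invf_le1// lerDl mulr_ge0// ltW.
  - rewrite mulrCA ler_pdivrMl// mulr1; lra.
have p0 := @pi_gt0 R.
have [C E C0] : exists2 C : R, C = datum_const & 0 < C.
  by eexists; [reflexivity | rewrite /datum_const mulr_gt0// ltr_wpDl ?sqr_ge0].
have [G GE G0] : exists2 G : R, G = 16 * pi * (16 / eps) `^ r * (32 * pi * C) & 0 < G.
  by eexists; [reflexivity | rewrite !mulr_gt0// powR_gt0// divr_gt0].
have sG0 : 0 < Num.sqrt G by rewrite sqrtr_gt0.
have [eps0 eps0E eps00] : exists2 e : R, e = expR (- 2) / 4 / Num.sqrt G & 0 < e.
  by eexists; [reflexivity | rewrite !divr_gt0// expR_gt0].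
have [delta d0 UCd] := UC _ eps00.
have D0 : 0 < pi / T by rewrite divr_gt0.
have [a [b [a1 ab b2 bE bad]]] := phase_amplitudes D0 d0.
have a0 : 0 < a by lra.
have a40 : 0 < 4 * a by lra.
have a2 : a <= 2 * a by lra.
have [k [k0 hk]] : exists k, (0 < k)%N /\ 16 * a ^+ 2 <= 4 ^+ k.
  exists (Num.bound (16 * a ^+ 2)).+1; split => //.
  have q : 0 <= 16 * a ^+ 2 by rewrite mulr_ge0// sqr_ge0.
  apply: (le_trans (ltW (archi_boundP q))); rewrite -natrX ler_nat.
  by apply: (leq_trans (leqnSn _)); apply: ltnW; apply: ltn_expl.
have phk c : 1 <= c -> c <= 2 * a -> T * c ^+ 2 * (2 / 4 ^+ k) <= 2^-1.
  move=> c1 c2; have c3 : c ^+ 2 <= 4 * a ^+ 2.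
    have -> : 4 * a ^+ 2 = (2 * a) ^+ 2 by ring.
    by rewrite ler_pXn2r// nnegrE; lra.
  have k40 : 0 < 4 ^+ k :> R by rewrite exprn_gt0.
  rewrite mulrA ler_pdivrMr//.
  apply: (@le_trans _ _ (1 * (4 * a ^+ 2) * 2)).
    by rewrite ler_wpM2r// ler_pM ?(ltW T0) ?sqr_ge0.
  by lra.
have b1 : 1 <= b := le_trans a1 ab.
have [La La1 hLa] := solution_phase k0 a1 (ltW T0) T1 (phk a a1 a2).
have [Lb Lb1 hLb] := solution_phase k0 b1 (ltW T0) T1 (phk b b1 b2).
have c0 : 0 < 32 * pi * C * a ^+ 2 by rewrite !mulr_gt0// exprn_gt0.
have [L [N [ML N1 cN NW]]] := frequency_scale (La + Lb + 8) hs c0.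
have L0 : 0 < L by lra.
have N0 : 0 < N by lra.
have cL0 := mulr_gt0 c0 L0.
have small c : (sobolev_norm s (distr (datum N k0 L0 c)) <= (`|c| / (4 * a))%:E)%E.
  apply: datum_sobolev => //.
  - by rewrite divr_ge0// ltW.
  - rewrite NW ler_pdivrMr ?mulr_gt0// mulrC ler_pdivlMr//.
    by have := ler_wpM2r (ltW L0) cN; lra.
  - rewrite NW -E exprMn real_normK ?num_real// le_eqVlt; apply/orP; left; apply/eqP.
    by move: p0; move: (pi : R) => P P0; field; rewrite !gt_eqF.
have inball c : 0 <= c -> c <= 2 * a -> sobolev_ball s 1 (distr (datum N k0 L0 c)).
  move=> c_ge0 c2; have h : (sobolev_norm s (distr (datum N k0 L0 c)) < 1%:E)%E.
    by apply: (le_lt_trans (small c)); rewrite lte_fin ger0_norm// ltr_pdivrMr//; lra.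
  by split => //; split; [exact: distr_tempered | apply: (lt_trans h); rewrite ltry].
have b0 : 0 <= b by lra.
have ba := inball a (ltW a0) a2; have bb := inball b b0 b2.
have close : (sobolev_norm s (distr (datum N k0 L0 a) - distr (datum N k0 L0 b))%R < delta%:E)%E.
  rewrite distrB datumB; apply: (le_lt_trans (small _)).
  by rewrite lte_fin distrC ger0_norm ?subr_ge0// ltr_pdivrMr.
have tT : `|T| < tau by rewrite gtr0_norm.
have far : (sobolev_norm s (distr (S (datum N k0 L0 a) T) - distr (S (datum N k0 L0 b) T))%R
   < eps0%:E)%E.
  apply: le_lt_trans (UCd _ _ ba bb close).
  rewrite -!Ext//; apply: ereal_sup_ubound; exists T => //=.
  by rewrite in_itv /= -ltr_norml.
have [sg sgE] : exists sg, sg = 8 / L by eexists.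
have sg0 : 0 < sg by rewrite sgE divr_gt0.
have sg1 : sg <= 1 by rewrite sgE ler_pdivrMr//; lra.
have [phi [psi [psiE phiE psr psim]]] :=
  gauss_pair N (N ^+ 2 * T - T * a ^+ 2) (2 * N * T) sg0.
have mass := gauss_mass N sg0.
have expE x : gexp 1 (sg ^+ 2 / 2) (- (2 * N * T)) x =
    expR (- (32 * ((x + 2 * N * T) / L) ^+ 2)).
  by rewrite /gexp muln1 opprK sgE; congr expR; field; rewrite gt_eqF.
have hr x := etrans (psr x) (congr1 _ (expE x)).
have hi x := etrans (psim x) (congr1 _ (expE x)).
have P00 := le_trans (ltW sg0) mass.
have bT : T * b ^+ 2 = T * a ^+ 2 + pi by rewrite bE mulrDr [T * (_ / _)]mulrC divfK ?gt_eqF.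
have sep : (\int[@lebesgue_measure R]_x gexp 1 (2 * sg ^+ 2)^-1 N x) * (2 * (expR (- 2) / 64 * a * L)) <=
    complex.Re ((distr (S (datum N k0 L0 a) T) - distr (S (datum N k0 L0 b) T)) psi).
  apply: (separation P00 bT hr hi) => U th [[-> ->]|[-> ->]].
    by apply: hLa; [lra | exact: (HS _).1].
  apply: (@le_trans _ _ (expR (- 2) / 64 * b * L)).
    by rewrite ler_wpM2r ?(ltW L0)// ler_wpM2l// divr_ge0// expR_ge0.
  by apply: hLb; [lra | exact: (HS _).1].
have GB : 0 < Num.sqrt G * a by rewrite mulr_gt0.
have norm := gauss_dual_norm sg0 r0 N1 sg1 e0 e1 er phiE (ltW GB).
have /norm{}norm : 2 * (16 / eps) `^ r * (N ^+ 2 / 4) `^ r * (pi * sg) <= (Num.sqrt G * a) ^+ 2.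
  rewrite [X in _ <= X]exprMn sqr_sqrtr ?(ltW G0)// /r [X in _ * X * _]powRN NW invrK sgE GE.
  by rewrite le_eqVlt; apply/orP; left; apply/eqP; field; rewrite gt_eqF.
have := sobolev_norm_ge (s := s) (distr (S (datum N k0 L0 a) T) - distr (S (datum N k0 L0 b) T))
  psiE GB.
rewrite -mulNr => /(_ norm) low.
suff h : eps0 <= complex.Re ((distr (S (datum N k0 L0 a) T) -
    distr (S (datum N k0 L0 b) T)) psi) / (Num.sqrt G * a).
  by have := le_lt_trans (le_trans _ low) far; rewrite -lee_fin in h; move=> /(_ _ h); rewrite ltxx.
rewrite ler_pdivlMr//; apply: le_trans sep.
have J0 : 0 <= 2 * (expR (- 2) / 64 * a * L) :> R by rewrite !mulr_ge0 ?divr_ge0 ?expR_ge0 ?ltW.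
apply: le_trans (ler_wpM2r J0 mass).
by rewrite le_eqVlt; apply/orP; left; apply/eqP; rewrite eps0E sgE; field; rewrite !gt_eqF.
Qed.
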